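(* Let $\mathbb{F}$ be a field of characteristic zero and fix $K\in\mathbb{N}$. There exists $N\in\mathbb{N}$ such that the following holds: if $W_{N,N+K}\cong\bigoplus_{\lambda\vdash N+K}m^{\lambda}S^{\lambda}$ is the decomposition of $W_{N,N+K}$ into irreducible $S_{N+K}$-representations, then for every $n\geq N$ there is an isomorphism of $S_{n+K}$-representations $$W_{n,n+K}\cong\bigoplus_{\lambda\vdash N+K}m^{\lambda}S^{\lambda^{(n-N)}}.$$
   Context: $\mathbb{F}\langle X\rangle$ is the free non-unitary associative algebra over $\mathbb{F}$ on countably many non-commuting variables $X=\{x_1,x_2,\dots\}$. A $T$-ideal is a two-sided ideal of $\mathbb{F}\langle X\rangle$ invariant under all algebra endomorphisms of $\mathbb{F}\langle X\rangle$; $(x^n)^T$ denotes the smallest $T$-ideal containing $x^n$. $V_m$ is the span of the monomials $x_{\sigma(1)}\cdots x_{\sigma(m)}$, $\sigma\in S_m$ (multilinear polynomials of degree $m$ in $x_1,\dots,x_m$), and $W_{n,m}:=V_m\cap(x^n)^T$ for $n\le m$. $S_m$ acts on $V_m$ on the left by $(\sigma.f)(x_1,\dots,x_m)=f(x_{\sigma(1)},\dots,x_{\sigma(m)})$, making $W_{n,m}$ an $S_m$-representation. $S^{\lambda}$ denotes the irreducible $S_m$-representation corresponding to the partition $\lambda\vdash m$. For a partition $\lambda=(\lambda_1,\dots,\lambda_r)$ and $s\in\mathbb{Z}_{\ge0}$, $\lambda^{(s)}:=(\lambda_1+s,\lambda_2,\dots,\lambda_r)$. *)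

(* Defs.v *)
From HB Require Import structures.
From mathcomp Require Import all_boot all_order all_algebra all_fingroup.
Set Implicit Arguments. Unset Strict Implicit. Unset Printing Implicit Defensive.
Import GRing.Theory.
Local Open Scope ring_scope.

(* The free non-unitary associative algebra F<X> on X = {x_1, x_2, ...}.      *)
(* The variable x_(k+1) is encoded by the letter k : nat; a monomial is a     *)
(* word (seq nat).  An element of F<X> is a coefficient function on words,   *)
(* with finite support and zero constant term (non-unitary).                 *)
(* Operations are defined on all coefficient functions.                       *)
Section FreeAlgebra.
Variable F : fieldType.

Definition ncpoly := seq nat -> F.

Definition is_ncpoly (f : ncpoly) : Prop :=
  f [::] = 0 /\ exists s : seq (seq nat), forall w, w \notin s -> f w = 0.

Definition nc0 : ncpoly := fun _ => 0.
Definition ncadd (f g : ncpoly) : ncpoly := fun w => f w + g w.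
Definition ncscale (a : F) (f : ncpoly) : ncpoly := fun w => a * f w.
Definition ncmul (f g : ncpoly) : ncpoly :=
  fun w => \sum_(i < (size w).+1) f (take i w) * g (drop i w).

Definition is_ideal (I : ncpoly -> Prop) : Prop :=
  [/\ (forall f, I f -> is_ncpoly f),
      I nc0,
      (forall f g, I f -> I g -> I (ncadd f g)),
      (forall a f, I f -> I (ncscale a f)) &
      (forall p f, is_ncpoly p -> I f -> I (ncmul p f) /\ I (ncmul f p))].

Definition is_endo (phi : ncpoly -> ncpoly) : Prop :=
  [/\ (forall f, is_ncpoly f -> is_ncpoly (phi f)),
      (forall f g, is_ncpoly f -> is_ncpoly g -> phi (ncadd f g) = ncadd (phi f) (phi g)),
      (forall a f, is_ncpoly f -> phi (ncscale a f) = ncscale a (phi f)) &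
      (forall f g, is_ncpoly f -> is_ncpoly g -> phi (ncmul f g) = ncmul (phi f) (phi g))].

Definition is_Tideal (I : ncpoly -> Prop) : Prop :=
  is_ideal I /\ forall phi, is_endo phi -> forall f, I f -> I (phi f).

Definition Tideal_gen (p : ncpoly) : ncpoly -> Prop :=
  fun g => forall I, is_Tideal I -> I p -> I g.

Definition xpow (n : nat) : ncpoly := fun w => if w == nseq n 0%N then 1 else 0.

(* V_m : span of the monomials x_{s(1)} ... x_{s(m)}, s in S_m *)
Definition Vm (m : nat) (f : ncpoly) : Prop :=
  forall w, ~~ perm_eq w (iota 0 m) -> f w = 0.

Definition Wnm (n m : nat) (f : ncpoly) : Prop := Vm m f /\ Tideal_gen (xpow n) f.

(* left S_m-action (s.f)(x_1,..,x_m) = f(x_{s(1)},..,x_{s(m)}) *)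
Definition permact (m : nat) (s : 'S_m) (f : ncpoly) : ncpoly :=
  fun w => f (map (fun k => if insub k is Some i then val ((s^-1)%g i) else k) w).

(* Specht modules S^lambda, realised (over F, char 0) as the left ideal      *)
(* F[S_m] c_lambda of the group algebra, c_lambda = a_lambda b_lambda the     *)
(* Young symmetrizer of the row-reading tableau (Fulton-Harris, Lect. 4).     *)
(* Group algebra elements are functions 'S_m -> F; the product uses the      *)
(* composition of permutations as functions (s o t = (t * s)%g).             *)

Definition is_partition (m : nat) (la : seq nat) : bool :=
  [&& sorted (fun a b => b <= a)%N la, all (fun x => 0 < x)%N la & sumn la == m].

Definition shiftpart (s : nat) (la : seq nat) : seq nat :=
  if la is a :: l then (a + s)%N :: l else [:: s].

(* row and column of entry k in the tableau of shape la filled row by row *)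
Definition rowof (la : seq nat) (k : nat) : nat :=
  find (fun r => k < sumn (take r.+1 la))%N (iota 0 (size la)).
Definition colof (la : seq nat) (k : nat) : nat :=
  (k - sumn (take (rowof la k) la))%N.

Definition galg (m : nat) := {ffun 'S_m -> F}.

Definition gconv (m : nat) (x y : galg m) : galg m :=
  [ffun s => \sum_(t : 'S_m) x t * y ((s * t^-1)%g)].

Definition gact (m : nat) (g : 'S_m) (x : galg m) : galg m :=
  [ffun s => x ((s * g^-1)%g)].

Definition row_stab (m : nat) (la : seq nat) (s : 'S_m) : bool :=
  [forall i : 'I_m, rowof la (s i) == rowof la i].
Definition col_stab (m : nat) (la : seq nat) (s : 'S_m) : bool :=
  [forall i : 'I_m, colof la (s i) == colof la i].

Definition row_sym (m : nat) (la : seq nat) : galg m :=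
  [ffun s => if row_stab la s then 1 else 0].
Definition col_antisym (m : nat) (la : seq nat) : galg m :=
  [ffun s => if col_stab la s then (-1) ^+ odd_perm s else 0].

Definition young_sym (m : nat) (la : seq nat) : galg m :=
  gconv (row_sym m la) (col_antisym m la).

Definition Specht (m : nat) (la : seq nat) (x : galg m) : Prop :=
  exists y : galg m, x = gconv y (young_sym m la).

(* W_{n,m} is isomorphic, as an S_m-representation, to the direct sum of    *)
(* the Specht modules S^{ls_i}, i < size ls (multiplicity of lambda =       *)
(* count of lambda in ls): there are linear equivariant maps psi_i from      *)
(* S^{ls_i} into W_{n,m} such that sum_i psi_i is a bijection onto W_{n,m}. *)
Definition W_iso_sum (n m : nat) (ls : seq (seq nat)) : Prop :=
  exists psi : nat -> galg m -> ncpoly,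
  [/\ (forall i, (i < size ls)%N -> forall a (x y : galg m),
         Specht (nth [::] ls i) x -> Specht (nth [::] ls i) y ->
         forall w, psi i [ffun s => a * x s + y s] w = a * psi i x w + psi i y w),
      (forall i, (i < size ls)%N -> forall (g : 'S_m) (x : galg m),
         Specht (nth [::] ls i) x ->
         forall w, psi i (gact g x) w = permact g (psi i x) w),
      (forall i, (i < size ls)%N -> forall x,
         Specht (nth [::] ls i) x -> Wnm n m (psi i x)),
      (forall f, Wnm n m f -> exists x : nat -> galg m,
         (forall i, (i < size ls)%N -> Specht (nth [::] ls i) (x i)) /\
         forall w, f w = \sum_(i < size ls) psi i (x i) w) &
      (forall x : nat -> galg m,
         (forall i, (i < size ls)%N -> Specht (nth [::] ls i) (x i)) ->
         (forall w, \sum_(i < size ls) psi i (x i) w = 0) ->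
         forall i, (i < size ls)%N -> x i = 0)].

End FreeAlgebra.

(* Main.v *)
(** Identify [W_(n,m)] with a left ideal of the group algebra of [S_m]: in
characteristic 0 it is spanned by the multilinear elements
[u0 P(u_1,...,u_n) u1], where [P] is the polarization of [x^n] and the [u_i]
are words.  Put [m = n + K].  Setting one variable equal to 1 maps [W_(n+1,m+1)]
to [W_(n,m)], and induction on [m - n] shows that this map stays onto between
the invariants of Young subgroups, when the deleted variable lies in the first
block.  At most [2K] variables are not interchangeable in a generator, so the
dimension of the invariants of [S_(n-K)] is bounded in [n]; hence the map is
eventually bijective on the invariants that matter.

The multiplicity of [S^la] in a left ideal [W] is
[dim a_la W - dim U_la W], where [a_la] is the row symmetrizer and [U_la W] is
spanned by the images under [a_la] of the invariants of the Young subgroups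
obtained by moving one box of [la] to a higher row.  Both terms are preserved by
the deletion map when the first row of [la] grows by one box.  The multiplicity
formula and the completeness of the Specht modules both come from the
straightening relation [a_la b_la a_la = k a_la] modulo [U_la], in which
[k <> 0] because the coefficients of the Young symmetrizer are integers. *)
From HB Require Import structures.
From mathcomp Require Import all_boot all_order all_algebra all_fingroup.
Require Import Defs.
From mathcomp Require Import zify.
From Stdlib Require Import Classical ClassicalEpsilon FunctionalExtensionality.
Set Implicit Arguments. Unset Strict Implicit. Unset Printing Implicit Defensive.
Import GRing.Theory Num.Theory.
Local Open Scope ring_scope.

(** * The group algebra *)

(** Deleting a letter commutes only with the permutations fixing it, so it is no map of
    representations of the larger group. Multiplicities are therefore expressed through invariants
    of Young subgroups alone, where deletion can be controlled.

    Surjectivity is the delicate point. Symmetrizing a preimage of a generator moves the deleted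
    letter into other words. The terms where it leaves its one-letter word lose a letter but no word
    under deletion, so they land in [W_(n+1,m)], where the excess of letters over words is smaller;
    this drives the induction.

    The range of shapes comes from the fact that a generator of [W_(n,n+K)] has at least [n - K]
    one-letter words, which may be permuted freely. A shape with a shorter first row has
    multiplicity zero. For the others, row invariants are also invariant under the [n - K]
    interchangeable letters, where deletion is eventually injective. At most [2K] boxes then lie
    outside the first row, so beyond [3K] lengthening and shortening the first row are inverse
    operations on the shapes that occur. *)

Definition grpalg (F : fieldType) (m : nat) : Type := {ffun 'S_m -> F^o}.

Section GroupAlgebra.
Variables (F : fieldType) (m : nat).
Local Notation FG := (grpalg F m).
Implicit Types (x y z : FG) (g h s t : 'S_m).

(** Values in [F^o] give finite functions their vector space structure, while [grpalg] stays
    convertible to the [galg] of the statement. *)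
HB.instance Definition _ := Vector.on FG.

Definition gelt g : FG := [ffun s => (s == g)%:R].

Definition fgmul x y : FG := gconv x y.

Lemma fgmulE x y s : fgmul x y s = \sum_t x t * y (s * t^-1)%g.
Proof. by rewrite ffunE. Qed.

Lemma fgmulE' x y s : fgmul x y s = \sum_t x (t^-1 * s)%g * y t.
Proof.
rewrite fgmulE (reindex_inj (inj_comp (mulIg s) invg_inj)) /=.
by apply: eq_bigr => t _; rewrite invMg invgK mulKVg.
Qed.

Fact fgmulA : associative fgmul.
Proof.
move=> x y z; apply/ffunP => s; rewrite fgmulE.
under eq_bigr => t _ do rewrite fgmulE' big_distrr /=.
rewrite fgmulE' exchange_big /=; apply: eq_bigr => t _.
rewrite fgmulE big_distrl /=; apply: eq_bigr => u _.
by rewrite mulrA !mulgA.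
Qed.

Fact fgmul1l : left_id (gelt 1) fgmul.
Proof.
move=> x; apply/ffunP => s; rewrite fgmulE (bigD1 1%g) //= ffunE eqxx mul1r.
rewrite invg1 mulg1 big1 ?addr0 // => t nt.
by rewrite ffunE (negPf nt) mul0r.
Qed.

Fact fgmul1r : right_id (gelt 1) fgmul.
Proof.
move=> x; apply/ffunP => s; rewrite fgmulE' (bigD1 1%g) //= ffunE eqxx mulr1.
rewrite invg1 mul1g big1 ?addr0 // => t nt.
by rewrite ffunE (negPf nt) mulr0.
Qed.

Fact fgmulDl : left_distributive fgmul +%R.
Proof.
move=> x y z; apply/ffunP => s; rewrite [RHS]ffunE !fgmulE -big_split /=.
by apply: eq_bigr => t _; rewrite ffunE mulrDl.
Qed.

Fact fgmulDr : right_distributive fgmul +%R.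
Proof.
move=> x y z; apply/ffunP => s; rewrite [RHS]ffunE !fgmulE -big_split /=.
by apply: eq_bigr => t _; rewrite ffunE mulrDr.
Qed.

Fact gelt1_neq0 : gelt 1 != 0.
Proof.
apply/eqP => /ffunP/(_ 1%g); rewrite !ffunE eqxx => /eqP.
by rewrite oner_eq0.
Qed.

HB.instance Definition _ := GRing.Zmodule_isNzRing.Build FG
  fgmulA fgmul1l fgmul1r fgmulDl fgmulDr gelt1_neq0.

Fact fg_scaleAl (a : F) x y : a *: (x * y) = a *: x * y.
Proof.
apply/ffunP => s; rewrite [LHS]ffunE !fgmulE [LHS]big_distrr /=.
by apply: eq_bigr => t _; rewrite ffunE mulrA.
Qed.

HB.instance Definition _ := GRing.Lmodule_isLalgebra.Build F FG fg_scaleAl.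

Fact fg_scaleAr (a : F) x y : a *: (x * y) = x * (a *: y).
Proof.
apply/ffunP => s; rewrite [LHS]ffunE !fgmulE [LHS]big_distrr /=.
by apply: eq_bigr => t _; rewrite ffunE mulrCA.
Qed.

HB.instance Definition _ := GRing.Lalgebra_isAlgebra.Build F FG fg_scaleAr.

Lemma mulfgE x y s : (x * y) s = \sum_t x t * y (s * t^-1)%g.
Proof. exact: fgmulE. Qed.

Lemma mulfgE' x y s : (x * y) s = \sum_t x (t^-1 * s)%g * y t.
Proof. exact: fgmulE'. Qed.

Lemma gelt1 : gelt 1 = 1. Proof. by []. Qed.

Lemma geltmulE g x s : (gelt g * x) s = x (s * g^-1)%g.
Proof.
rewrite mulfgE (bigD1 g) //= ffunE eqxx mul1r big1 ?addr0 // => t nt.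
by rewrite ffunE (negPf nt) mul0r.
Qed.

Lemma gact_gelt g x : gact g x = gelt g * x.
Proof. by apply/ffunP => s; rewrite geltmulE ffunE. Qed.

(* [gconv] composes permutations as functions, MathComp multiplies them left to right. *)
Lemma geltM g h : gelt g * gelt h = gelt (h * g).
Proof.
apply/ffunP => s; rewrite geltmulE !ffunE; congr (_%:R).
by rewrite (canF_eq (mulgKV g)) .
Qed.

Lemma geltVK g x : gelt g^-1 * (gelt g * x) = x.
Proof. by rewrite mulrA geltM mulgV gelt1 mul1r. Qed.

Lemma fg_sum x : x = \sum_g x g *: gelt g.
Proof.
apply/ffunP => s; rewrite sum_ffunE (bigD1 s) //= !ffunE eqxx [X in X + _]mulr1.
rewrite big1 ?addr0 // => t nt; rewrite !ffunE eq_sym (negPf nt).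
exact: mulr0.
Qed.

Lemma mul_fg_sum x y z : x * (z * y) = \sum_g z g *: (x * (gelt g * y)).
Proof.
rewrite {1}[z]fg_sum mulr_suml mulr_sumr; apply: eq_bigr => g _.
by rewrite -scalerAl -scalerAr.
Qed.

(** The anti-involution inverting permutations: it turns left annihilation into right annihilation
    and plays the role of an adjoint in the positivity argument. *)
Definition star x : FG := [ffun s => x s^-1%g].

Lemma starK x : star (star x) = x.
Proof. by apply/ffunP => s; rewrite !ffunE invgK. Qed.

Lemma starM x y : star (x * y) = star y * star x.
Proof.
apply/ffunP => s; rewrite ffunE (fgmulE' x y) mulfgE (reindex_inj invg_inj) /=.
by apply: eq_bigr => t _; rewrite mulrC !ffunE invgK invMg invgK.
Qed.

Lemma star0 : star 0 = 0.
Proof. by apply/ffunP => s; rewrite !ffunE. Qed.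

Definition lmul_fun z x : FG := z * x.
Definition rmul_fun z x : FG := x * z.
Fact lmul_fun_linear z : linear (lmul_fun z).
Proof. by move=> a x y; rewrite /lmul_fun mulrDr scalerAr. Qed.
Fact rmul_fun_linear z : linear (rmul_fun z).
Proof. by move=> a x y; rewrite /rmul_fun mulrDl scalerAl. Qed.
HB.instance Definition _ z :=
  GRing.isLinear.Build F FG FG _ (lmul_fun z) (lmul_fun_linear z).
HB.instance Definition _ z :=
  GRing.isLinear.Build F FG FG _ (rmul_fun z) (rmul_fun_linear z).
Definition lmulg z : 'End(FG) := linfun (lmul_fun z).
Definition rmulg z : 'End(FG) := linfun (rmul_fun z).

Lemma lmulgE z x : lmulg z x = z * x.
Proof. by rewrite lfunE. Qed.
Lemma rmulgE z x : rmulg z x = x * z.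
Proof. by rewrite lfunE. Qed.
End GroupAlgebra.

(** * Colorings and straightening *)

Section Colorings.
Variables (F : fieldType) (m : nat).
Local Notation FG := (grpalg F m).
Implicit Types (x y z w : FG) (g h s t : 'S_m) (c r : 'I_m -> nat) (W V : {vspace FG}).

(** Young subgroups are encoded as stabilizers of colorings, so that moving a box or adding a letter
    is a pointwise change of a function. *)
Definition cstab c g := [forall i, c (g i) == c i].

Lemma cstabP c g : reflect (forall i, c (g i) = c i) (cstab c g).
Proof. by apply: (iffP forallP) => H i; apply/eqP. Qed.

Lemma cstab1 c : cstab c 1.
Proof. by apply/cstabP => i; rewrite perm1. Qed.

Lemma cstabV c g : cstab c g -> cstab c g^-1.
Proof. by move/cstabP => H; apply/cstabP => i; rewrite -H permKV. Qed.

Lemma cstabM c g h : cstab c g -> cstab c h -> cstab c (g * h).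
Proof. by move=> /cstabP H /cstabP H'; apply/cstabP => i; rewrite permM H'. Qed.

Lemma cstabMr c g h : cstab c g -> cstab c (h * g) = cstab c h.
Proof.
move=> sg; apply/idP/idP => [H|/cstabM -> //].
by rewrite -(mulgK g h); apply: cstabM; rewrite ?cstabV.
Qed.

Lemma cstabMl c g h : cstab c g -> cstab c (g * h) = cstab c h.
Proof.
move=> sg; apply/idP/idP => [H|]; last exact: cstabM.
by rewrite -(mulKg g h); apply: cstabM; rewrite ?cstabV.
Qed.

Lemma cstab_tperm c i j : c i = c j -> cstab c (tperm i j).
Proof. by move=> e; apply/cstabP => k; case: tpermP => [->|->|]. Qed.

Definition csym c : FG := \sum_(g | cstab c g) gelt F g.

Lemma eq_csym c c' : c =1 c' -> csym c = csym c'.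
Proof.
by move=> e; apply: eq_bigl => g; apply: eq_forallb => i; rewrite !e.
Qed.

Definition cinv c w := forall g, cstab c g -> gelt F g * w = w.

Lemma csymMl c g : cstab c g -> gelt F g * csym c = csym c.
Proof.
move=> sg; rewrite /csym big_distrr /= [RHS](reindex_inj (mulIg g)) /=.
by apply: eq_big => h; rewrite ?cstabMr // => _; rewrite geltM.
Qed.

Lemma csymMr c g : cstab c g -> csym c * gelt F g = csym c.
Proof.
move=> sg; rewrite /csym big_distrl /= [RHS](reindex_inj (mulgI g)) /=.
by apply: eq_big => h; rewrite ?cstabMl // => _; rewrite geltM.
Qed.

Lemma cinv_csym c w : cinv c (csym c * w).
Proof. by move=> g sg; rewrite mulrA csymMl. Qed.

Definition nstab c := #|[pred g | cstab c g]|.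

Lemma nstab_gt0 c : (0 < nstab c)%N.
Proof. by apply/card_gt0P; exists 1%g; rewrite inE cstab1. Qed.

Lemma csym_cinv c w : cinv c w -> csym c * w = (nstab c)%:R *: w.
Proof.
move=> iw; rewrite /csym big_distrl /= (eq_bigr (fun _ => w)) //.
by rewrite sumr_const -scaler_nat.
Qed.

Lemma csym_csym c : csym c * csym c = (nstab c)%:R *: csym c.
Proof. by apply: csym_cinv => g sg; rewrite csymMl. Qed.

Definition ctranslate c g : 'I_m -> nat := fun i => c (g^-1%g i).

Lemma cstab_ctranslate c g h : cstab (ctranslate c g) h = cstab c (g * h * g^-1).
Proof.
apply/cstabP/cstabP => H i.
  by have := H (g i); rewrite /ctranslate !permM permK.
by have := H (g^-1%g i); rewrite /ctranslate !permM permKV.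
Qed.

Lemma cinv_ctranslate c g w : cinv c w -> cinv (ctranslate c g) (gelt F g * w).
Proof.
move=> iw h; rewrite cstab_ctranslate => sh; rewrite -[in RHS](iw _ sh) !mulrA !geltM.
by rewrite mulgKV.
Qed.

Lemma gelt_csym c g : gelt F g * csym c = csym (ctranslate c g) * gelt F g.
Proof.
rewrite /csym big_distrr big_distrl /=.
rewrite [LHS](reindex_inj (conjg_inj (g^-1)%g)) /=.
apply: eq_big => h; first by rewrite cstab_ctranslate conjgE invgK mulgA.
by rewrite !geltM conjgE invgK mulgA mulgKV.
Qed.

(** A permutation [g] of the Young subgroup is the product of the transposition of [j] with its
    preimage under [g] and of a permutation fixing [j]. This is used for a moved box and for the
    deleted letter. *)
Lemma csym_decomp c j :
  csym c = (\sum_(g | cstab c g && (g j == j)) gelt F g)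
           * (\sum_(i | c i == c j) gelt F (tperm i j)).
Proof.
rewrite /csym (partition_big (fun g => (g^-1)%g j) (fun i => c i == c j)) /=; last first.
  by move=> g /cstabV/cstabP ->.
rewrite [RHS]big_distrr /=; apply: eq_bigr => i /eqP ci.
rewrite (reindex_inj (mulgI (tperm i j))) big_distrl /=.
apply: eq_big => g; last by rewrite geltM.
rewrite cstabMl; last exact: cstab_tperm.
congr (_ && _); rewrite invMg permM tpermV.
by rewrite (canF_eq (tpermK i j)) tpermL (canF_eq (permKV g)) eq_sym.
Qed.

(** Left ideals of the group algebra. *)
Definition stable W := forall g w, w \in W -> gelt F g * w \in W.

Lemma stable_mul W z w : stable W -> w \in W -> z * w \in W.
Proof.
move=> sW Ww; rewrite [z]fg_sum mulr_suml rpred_sum // => g _.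
by rewrite -scalerAl rpredZ // sW.
Qed.

Lemma stable_full : stable fullv.
Proof. by move=> g w _; apply: memvf. Qed.

Definition recolor r i k : 'I_m -> nat := fun j => if j == i then k else r j.

(* Moving a box to a higher row increases the shape in the dominance order, so
   the Specht module of shape [r] contributes nothing here. *)
Definition raised r W : {vspace FG} :=
  (\sum_(i < m) \sum_(0 <= k < r i) lmulg (csym r * csym (recolor r i k)) @: W)%VS.

Lemma mem_raised r W i k w : (k < r i)%N -> w \in W ->
  csym r * (csym (recolor r i k) * w) \in raised r W.
Proof.
move=> ki Ww; rewrite /raised (bigD1 i) //=.
apply: (subvP (addvSl _ _)); rewrite big_mkord (bigD1 (Ordinal ki)) //=.
apply: (subvP (addvSl _ _)); rewrite mulrA -lmulgE; exact: memv_img.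
Qed.

Lemma raised_sub r W V :
  (forall i k w, (k < r i)%N -> w \in W -> csym r * (csym (recolor r i k) * w) \in V) ->
  (raised r W <= V)%VS.
Proof.
move=> H; rewrite /raised; apply/subv_sumP => i _; rewrite big_mkord.
apply/subv_sumP => k _; apply/subvP => _ /memv_imgP[w Ww ->].
by rewrite lmulgE -mulrA H.
Qed.

Hypothesis F0 : [pchar F] =i pred0.

Lemma natF_eq0 n : (n%:R == 0 :> F) = (n == 0)%N.
Proof. by have /pcharf0P -> := F0. Qed.

Lemma nstab_neq0 c : (nstab c)%:R != 0 :> F.
Proof. by rewrite natF_eq0 -lt0n nstab_gt0. Qed.

Lemma mem_csym_img W c w : stable W ->
  (w \in lmulg (csym c) @: W)%VS <-> (w \in W /\ cinv c w).
Proof.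
move=> sW; split.
  by case/memv_imgP => v Wspace ->; rewrite lmulgE; split; [apply: stable_mul | apply: cinv_csym].
case=> Ww iw; apply/memv_imgP; exists ((nstab c)%:R^-1 *: w); first exact: rpredZ.
by rewrite lmulgE -scalerAr csym_cinv // scalerA mulVf ?scale1r // nstab_neq0.
Qed.

(** Decompose the symmetrizer of the recolored tableau at [j]: its elements fixing [j] preserve [r]
    too and are absorbed by [csym r]. What is left is the identity and the transpositions of [j]
    with the points of row [k]; characteristic 0 removes the common factor. *)
Lemma csym_tperm_raised r W j k w : stable W -> (k < r j)%N -> w \in W ->
  csym r * w + \sum_(i | r i == k) csym r * (gelt F (tperm i j) * w) \in raised r W.
Proof.
move=> sW kj Ww; have := mem_raised kj Ww.
rewrite (csym_decomp (recolor r j k) j) mulrA.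
set s0 := \sum_(g | _) _; set s1 := \sum_(i | _) _.
have -> : csym r * (s0 * s1) = #|[pred g | cstab (recolor r j k) g && (g j == j)]|%:R *: (csym r * s1).
  rewrite mulrA scalerAl; congr (_ * _); rewrite {}/s0 big_distrr /= scaler_nat -sumr_const.
  apply: eq_bigr => g /andP[/cstabP sg /eqP gj]; rewrite csymMr //.
  apply/cstabP => i; have := sg i; rewrite /recolor; case: (altP (i =P j)) => [->|ni].
    by rewrite gj.
  by rewrite ifN // -[X in _ != X]gj (inj_eq perm_inj).
rewrite -scalerAl rpredZeq natF_eq0 eqn0Ngt.
have -> : (0 < #|[pred g | cstab (recolor r j k) g && (g j == j)]|)%N.
  by apply/card_gt0P; exists 1%g; rewrite inE cstab1 perm1 eqxx.
rewrite /= /s1 (bigD1 j) //= tperm1 gelt1 mulrDr mulr1 mulrDl.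
rewrite mulr_sumr (mulr_suml _ (fun i => (recolor r j k i == recolor r j k j) && (i != j))).
set S1 := \sum_(i | _ && _) _; set S2 := \sum_(i | r i == k) _; suff -> : S1 = S2 by [].
rewrite /S1 /S2.
apply: eq_big => [i|i _]; last by rewrite mulrA.
rewrite /recolor eqxx; case: (altP (i =P j)) => [->|]; rewrite ?andbF ?andbT //=.
by apply/esym; rewrite gtn_eqF.
Qed.

Definition agree r k c := forall i l, (l < k)%N -> (c i == l) = (r i == l).

Definition fib c k := [set i | c i == k].

Lemma card_fib_ctranslate c g k : #|fib (ctranslate c g) k| = #|fib c k|.
Proof.
rewrite -[RHS](card_imset _ (@perm_inj _ g)); apply: eq_card => i.
rewrite inE /ctranslate; apply/idP/imsetP => [H|[j]].
  by exists ((g^-1)%g i); rewrite ?inE ?permKV.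
by rewrite inE => H ->; rewrite permK.
Qed.

(* A transposition exchanges a misplaced point of the fibre of [c] with a
   misplaced point of the fibre of [r]; modulo [raised] this reduces the defect. *)
Lemma straighten_step W r V k n c w :
  stable W -> (raised r W <= V)%VS -> w \in W -> cinv c w -> agree r k c ->
  (#|fib r k| <= #|fib c k|)%N -> (#|fib r k :\: fib c k| <= n)%N ->
  (forall g, agree r k.+1 (ctranslate c g) -> csym r * (gelt F g * w) \in V) ->
  csym r * w \in V.
Proof.
move=> sW UV; elim: n c w => [|n IHn] c w Ww iw agr le_rc le_n HV.
all: have [sub|/subsetPn[j]] := boolP (fib c k \subset fib r k).
1,3: have e : fib c k = fib r k by apply/eqP; rewrite eqEcard sub.
1,2: rewrite -[w]mul1r -gelt1; apply: HV => i l; rewrite ltnS /ctranslate invg1 perm1 leq_eqVlt.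
1,2: case/predU1P => [->|lk]; last exact: agr.
1,2: by move/setP/(_ i): e; rewrite !inE.
all: rewrite !inE => /eqP cj rj.
all: have krj : (k < r j)%N.
1,3: by rewrite ltn_neqAle eq_sym rj /= leqNgt; apply/negP => lt;
  have := agr j (r j) lt; rewrite eqxx cj => /eqP ej; move: rj; rewrite -ej eqxx.
all: have := csym_tperm_raised sW krj Ww; move/(subvP UV).
(* Transpositions within a color class of [c] fix [w], so their terms add up with the leading one to
   a positive multiple of [csym r * w]. The remaining points [i] are misplaced in [r]. *)
all: rewrite (bigID (fun i => c i == k)) /= addrA.
all: rewrite (eq_bigr (fun _ => csym r * w)); last by
  move=> i /andP[_ /eqP ci]; rewrite iw //; apply: cstab_tperm; rewrite ci cj.
all: rewrite sumr_const -mulrS.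
all: have HH (S : FG) q : S \in V -> (csym r * w) *+ q.+1 + S \in V -> csym r * w \in V
  by move=> HS; rewrite rpredDr // -scaler_nat rpredZeq natF_eq0.
all: apply: HH; apply: rpred_sum => i /andP[/eqP ri ci].
  move: le_n; rewrite leqn0 cards_eq0 => /eqP/setP/(_ i).
  by rewrite !inE ri eqxx ci.
have ij : i != j by apply: contraNneq rj => <-; rewrite ri.
apply: (IHn (ctranslate c (tperm i j))) => //.
- exact: sW.
- exact: cinv_ctranslate.
- move=> l q qk; rewrite /ctranslate tpermV; case: tpermP => [->|->|_ _].
  + by rewrite cj ri.
  + rewrite (agr _ _ qk) ri -(agr j _ qk) cj; by [].
  + exact: agr.
- by rewrite card_fib_ctranslate.
- rewrite -ltnS; apply: leq_trans le_n.
  apply: proper_card; apply/properP; split.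
    apply/subsetP => l; rewrite !inE /ctranslate tpermV; case: tpermP => [->|->|_ _] //.
      by rewrite cj eqxx.
    by rewrite (negPf rj) andbF.
  exists i; rewrite !inE; first by rewrite ri eqxx ci.
  by rewrite /ctranslate tpermV tpermL cj eqxx.
- move=> g; rewrite [gelt F g * _]mulrA geltM => H; apply: HV => a l lk; rewrite -H // /ctranslate invMg permM.
  by [].
Qed.

(** No translate of [c] can agree with [r] on color 0, because the fibres have different sizes; the
    exceptional case of [straighten_step] is thus empty. *)
Lemma straighten_gt W r c w :
  stable W -> w \in W -> cinv c w -> (#|fib r 0| < #|fib c 0|)%N ->
  csym r * w \in raised r W.
Proof.
move=> sW Ww iw lt; apply: (straighten_step (c := c) (k := 0) sW (subvv _)) (leqnn _) _ => //.
  exact: ltnW.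
move=> g agr; suff: #|fib r 0| = #|fib c 0| by move=> e; rewrite e ltnn in lt.
rewrite -(card_fib_ctranslate c g 0); apply: eq_card => i; rewrite !inE.
by rewrite agr.
Qed.

(** Colors are matched one at a time, the equal fibre sizes allowing [straighten_step] at each of
    them; [d] bounds the number of colors still to be matched. *)
Lemma straighten_eq W r V c w :
  stable W -> (raised r W <= V)%VS -> w \in W -> cinv c w ->
  (forall k, #|fib c k| = #|fib r k|) ->
  (forall g, ctranslate c g =1 r -> csym r * (gelt F g * w) \in V) ->
  csym r * w \in V.
Proof.
move=> sW UV; pose M := (\max_i r i).+1.
have rM i : (r i < M)%N by rewrite ltnS leq_bigmax.
suff: forall d k c w, (M <= k + d)%N -> w \in W -> cinv c w -> agree r k c ->
    (forall k, #|fib c k| = #|fib r k|) ->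
    (forall g, ctranslate c g =1 r -> csym r * (gelt F g * w) \in V) ->
    csym r * w \in V.
  by move=> H Ww iw ec HV; apply: (H M 0%N c).
elim=> [|d IHd] k {}c {}w Mk Ww iw agr ec HV.
  rewrite -[w]mul1r -gelt1; apply: HV => i; rewrite /ctranslate invg1 perm1.
  by apply/eqP; rewrite agr ?eqxx // (leq_trans (rM i)) // -(addn0 k).
apply: (straighten_step sW UV Ww iw agr) (leqnn _) _; first by rewrite ec.
move=> g agr'; apply: (IHd k.+1 (ctranslate c g)) => //.
- by rewrite addSnnS.
- exact: sW.
- exact: cinv_ctranslate.
- by move=> l; rewrite card_fib_ctranslate.
- move=> h; rewrite [gelt F h * _]mulrA geltM => H; apply: HV => i; rewrite -H /ctranslate invMg permM.
  by [].
Qed.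

(** [gelt F g * csym r] is invariant under a conjugate Young subgroup with the same fibre sizes, so
    straightening applies, and the permutations that survive it lie in the stabilizer of [r]. *)
Lemma csym_gelt_csym r g :
  csym r * (gelt F g * csym r) \in (<[csym r]> + raised r fullv)%VS.
Proof.
apply: (straighten_eq (c := ctranslate r g) stable_full) => //.
- exact: addvSr.
- exact: memvf.
- by apply: cinv_ctranslate => h; apply: csymMl.
- by move=> k; rewrite card_fib_ctranslate.
move=> h e; rewrite [gelt F h * _]mulrA geltM csymMl.
  by rewrite csym_csym rpredZ // (subvP (addvSl _ _)) // memv_line.
apply/cstabP => i; have := e ((g * h)%g i); rewrite /ctranslate.
by rewrite permM permK permK => ->.
Qed.

Lemma csym_mul_csym r z :
  exists k, csym r * (z * csym r) - k *: csym r \in raised r fullv.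
Proof.
have : csym r * (z * csym r) \in (<[csym r]> + raised r fullv)%VS.
  by rewrite mul_fg_sum rpred_sum // => g _; rewrite rpredZ // csym_gelt_csym.
by case/memv_addP => _ /vlineP[k ->] [u Uu ->]; exists k; rewrite addrC addKr.
Qed.

End Colorings.

(** * Tableaux *)

Section Tableaux.
Local Open Scope nat_scope.
Implicit Types (la mu : seq nat).

Lemma rowof_cons a l k :
  rowof (a :: l) k = if k < a then 0 else (rowof l (k - a)).+1.
Proof.
rewrite /rowof /= take0 /= addn0; case: ltnP => //= ak.
rewrite -[1]/(1 + 0) iotaDl find_map; congr _.+1; apply: eq_find => i /=.
by rewrite add1n /=; lia.
Qed.

Lemma colof_cons a l k :
  colof (a :: l) k = if k < a then k else colof l (k - a).
Proof.
rewrite /colof rowof_cons; case: ltnP => ak /=; first by rewrite subn0.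
by rewrite subnDA.
Qed.

Lemma rowof_lt la k : k < sumn la -> rowof la k < size la.
Proof.
elim: la k => [|a l IH] k //=; rewrite rowof_cons; case: (ltnP k a) => //= ak kl.
by apply: IH; rewrite ltn_subLR.
Qed.

Lemma colof_lt la k : k < sumn la -> colof la k < nth 0 la (rowof la k).
Proof.
elim: la k => [|a l IH] k //=; rewrite rowof_cons colof_cons.
by case: (ltnP k a) => //= ak kl; rewrite IH // ltn_subLR.
Qed.

Lemma rowof_le la k i : k < sumn la ->
  (rowof la k <= i) = (k < sumn (take i.+1 la)).
Proof.
elim: la k i => [|a l IH] k i //=; rewrite rowof_cons; case: (ltnP k a) => /= ak kl.
  by rewrite leq0n ltn_addr.
case: i => [|i]; first by rewrite take0 /= ltn0; lia.
by rewrite ltnS IH ?ltn_subLR.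
Qed.

Lemma cell_exists la i j : i < size la -> j < nth 0 la i ->
  exists k, [/\ k < sumn la, rowof la k = i & colof la k = j].
Proof.
elim: la i => [|a l IH] //= [|i] /= il ja.
  by exists j; rewrite rowof_cons colof_cons ja ltn_addr.
have [k [kl <- <-]] := IH i il ja; exists (a + k).
rewrite rowof_cons colof_cons ltn_add2l kl addKn.
by rewrite ltnNge leq_addr.
Qed.

Lemma cell_inj la k l : k < sumn la -> l < sumn la ->
  rowof la k = rowof la l -> colof la k = colof la l -> k = l.
Proof.
elim: la k l => [|a la IH] k l //=; rewrite !rowof_cons !colof_cons.
case: (ltnP k a) => ak; case: (ltnP l a) => al //= kl ll [e] f.
have := IH (k - a) (l - a); rewrite !ltn_subLR // kl ll => /(_ isT isT e f); lia.
Qed.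

Lemma partition_nth m la i j : is_partition m la -> i <= j -> nth 0 la j <= nth 0 la i.
Proof.
case/and3P => srt _ _ ij; have [jl|lj] := ltnP j (size la); last by rewrite nth_default.
have tr : transitive (fun a b => b <= a) by move=> a b c ab bc; apply: leq_trans ab.
exact: (sorted_leq_nth tr (fun x => leqnn x) 0 srt) (leq_ltn_trans ij jl) jl ij.
Qed.

Lemma partition_eq la mu : all (fun x => 0 < x) la -> all (fun x => 0 < x) mu ->
  (forall k, sumn (take k.+1 la) = sumn (take k.+1 mu)) -> la = mu.
Proof.
elim: la mu => [|a l IH] [|b u] //=.
- by move=> _ /andP[b0 _] /(_ 0); rewrite take0 /=; lia.
- by move=> /andP[a0 _] _ /(_ 0); rewrite take0 /=; lia.
case/andP => a0 pl /andP[b0 pu] H; have := H 0; rewrite !take0 /= !addn0 => e.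
rewrite -e in H *; rewrite (IH u) // => k; exact: (addnI (H k.+1)).
Qed.

Lemma partition_sumn m la : is_partition m la -> sumn la = m.
Proof. by case/and3P => _ _ /eqP. Qed.

Definition rrow m la : 'I_m -> nat := fun i => rowof la i.
Arguments rrow m la : clear implicits.

(** For a row coloring these are the partial sums of the partition, so comparing them expresses
    dominance for arbitrary colorings as well. *)
Definition pcard m (c : 'I_m -> nat) k := #|[set i | c i <= k]|.

Lemma pcard_rrow m la k : sumn la = m -> pcard (rrow m la) k = sumn (take k.+1 la).
Proof.
move=> sla; rewrite /pcard.
have le : sumn (take k.+1 la) <= m by rewrite -sla -{2}(cat_take_drop k.+1 la) sumn_cat leq_addr.
have wi : injective (widen_ord le) by move=> i j /(congr1 val) ij; apply: val_inj.
rewrite -[RHS]card_ord -(card_imset _ wi).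
apply: eq_card => i; rewrite inE /rrow rowof_le ?sla //.
apply/idP/imsetP => [lt|[j _ ->]]; last by rewrite /=.
by exists (Ordinal lt) => //; apply: val_inj.
Qed.

Lemma partition_neq m la mu : is_partition m la -> is_partition m mu -> la != mu ->
  exists k, pcard (rrow m la) k != pcard (rrow m mu) k.
Proof.
move=> pl pm; case: (classic (exists k, pcard (rrow m la) k != pcard (rrow m mu) k)) => //.
move=> H; case/eqP; case/and3P: (pl) => _ Hl _; case/and3P: (pm) => _ Hm _.
apply: partition_eq => // k; rewrite -!(@pcard_rrow m) ?(partition_sumn pl) ?(partition_sumn pm) //.
by apply/eqP; apply: contraT => Hk; case: H; exists k.
Qed.

(* A coloring injective on the columns puts at most [min (k+1) h] of the first
   [k+1] colors in a column of height [h]; this is dominance. *)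
Lemma pcard_collision m la (c : 'I_m -> nat) k : is_partition m la ->
  pcard (rrow m la) k < pcard c k ->
  exists p q : 'I_m, [/\ p != q, colof la p = colof la q & c p = c q].
Proof.
move=> pl lt; apply: NNPP => H.
have inj (p q : 'I_m) : colof la p = colof la q -> c p = c q -> p = q.
  by move=> e f; apply/eqP; apply: contraT => ne; case: H; exists p, q.
move: lt; rewrite ltnNge; case/negP.
have colm (i : 'I_m) : colof la i < m.+1.
  by rewrite ltnS ltnW // (leq_ltn_trans (leq_subr _ _)).
pose col (i : 'I_m) := Ordinal (colm i).
rewrite /pcard -!sum1_card (partition_big col predT) //=.
rewrite [X in _ <= X](partition_big col predT) //=; apply: leq_sum => j _.
rewrite !sum1dep_card.
(* Without a cell below row [k], the whole column is counted on the right. Otherwise each of the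
   rows 0 to [k] meets the column, giving [k + 1] on the right, and injectivity bounds the left by
   [k + 1]. *)
case: (boolP [exists p : 'I_m, (col p == j) && (k < rrow m la p)]); last first.
  rewrite negb_exists => /forallP Hn; apply: subset_leq_card.
  apply/subsetP => p; rewrite !inE => /andP[_ cp]; rewrite cp andbT.
  by have := Hn p; rewrite cp /= -leqNgt.
case/existsP => p /andP[/eqP cp kp].
have lek : #|[set i | (i \in [set i0 | c i0 <= k]) && (col i == j)]| <= k.+1.
  rewrite -[X in _ <= X]card_ord.
  have ci : {in [set i | (i \in [set i0 | c i0 <= k]) && (col i == j)] &,
       injective (fun i => inord (c i) : 'I_k.+1)}.
    move=> x y; rewrite !inE => /andP[cx /eqP jx] /andP[cy /eqP jy] /(congr1 val).
    rewrite /= !inordK ?ltnS // => e; apply: inj e.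
    by have /(congr1 val) := etrans jx (esym jy).
  by rewrite -(card_in_imset ci) max_card.
apply: leq_trans lek _.
have slm := partition_sumn pl.
have cellr (i : 'I_k.+1) : exists q : 'I_m, rrow m la q = i /\ col q = j.
  have ps : p < sumn la by rewrite slm.
  have ip : (i <= rowof la p) by apply: ltnW; apply: leq_trans kp.
  have [] := @cell_exists la i (colof la p).
  - by apply: leq_ltn_trans ip _; apply: rowof_lt.
  - by apply: leq_trans (partition_nth pl ip); apply: colof_lt.
  move=> q [qm rq cq]; rewrite slm in qm; exists (Ordinal qm); split => //.
  by rewrite -cp; apply: val_inj.
pose f i := projT1 (constructive_indefinite_description _ (cellr i)).
have fP i : rrow m la (f i) = i /\ col (f i) = j.
  exact: (projT2 (constructive_indefinite_description _ (cellr i))).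
have fi : injective f by move=> x y e; apply: val_inj; have := (fP x).1; rewrite e (fP y).1.
rewrite -[k.+1]card_ord -(card_imset _ fi); apply: subset_leq_card.
apply/subsetP => _ /imsetP[x _ ->]; rewrite !inE (fP x).1 (fP x).2 eqxx andbT.
by rewrite -ltnS ltn_ord.
Qed.

End Tableaux.
Arguments rrow m la : clear implicits.

(** * Young symmetrizers *)

Section YoungSymmetrizers.
Variables (F : fieldType) (m : nat).
Hypothesis F0 : [pchar F] =i pred0.
Local Notation FG := (grpalg F m).
Implicit Types (x y z w u : FG) (g h s t : 'S_m) (c : 'I_m -> nat) (la mu : seq nat).

Definition casym la : FG := col_antisym F m la.
Definition ysym la : FG := young_sym F m la.
Local Notation ra la := (csym F (rrow m la)).

Lemma ysymE la : ysym la = ra la * casym la.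
Proof.
rewrite /ysym /young_sym; congr (gconv _ _); apply/ffunP => s.
rewrite ffunE sum_ffunE; under eq_bigr => g _ do rewrite ffunE.
have -> : row_stab la s = cstab (rrow m la) s by [].
case: ifP => sl.
  rewrite (bigD1 s) //= eqxx big1 ?addr0 // => g /andP[_ ng].
  by rewrite eq_sym (negPf ng).
by rewrite big1 // => g sg; case: eqP => // e; rewrite e sg in sl.
Qed.

Lemma casym_tperm la (p q : 'I_m) : p != q -> colof la p = colof la q ->
  casym la * gelt F (tperm p q) = - casym la.
Proof.
move=> npq e; apply/ffunP => s; rewrite mulfgE'.
rewrite (bigD1 (tperm p q)) //= !ffunE eqxx mulr1 big1 => [|t nt]; last first.
  by rewrite !ffunE (negPf nt) mulr0.
rewrite addr0 tpermV.
have -> : col_stab la (tperm p q * s)%g = col_stab la s.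
  apply: (@cstabMl _ (fun i : 'I_m => colof la i) (tperm p q) s).
  exact: cstab_tperm.
rewrite odd_permM odd_tperm npq; case: ifP => _; last by rewrite oppr0.
by case: (odd_perm s); rewrite /= ?expr1 ?expr0 ?opprK.
Qed.

Lemma star_casym la : star (casym la) = casym la.
Proof.
apply/ffunP => s; rewrite !ffunE odd_permV.
suff -> : col_stab la s^-1 = col_stab la s by [].
pose c (i : 'I_m) := colof la i.
by apply/idP/idP => /(@cstabV _ c); rewrite ?invgK.
Qed.

Lemma star_csym c : star (csym F c) = csym F c.
Proof.
apply/ffunP => s; rewrite ffunE /csym !sum_ffunE (reindex_inj invg_inj) /=.
apply: eq_big => g; first by apply/idP/idP => /cstabV; rewrite ?invgK.
by move=> _; rewrite !ffunE (inj_eq invg_inj).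
Qed.

Lemma pcard_ctranslate c g k : pcard (ctranslate c g) k = pcard c k.
Proof.
rewrite /pcard -[RHS](card_imset _ (@perm_inj _ g)); apply: eq_card => i.
rewrite inE /ctranslate; apply/idP/imsetP => [H|[j]].
  by exists ((g^-1)%g i); rewrite ?inE ?permKV.
by rewrite inE => H ->; rewrite permK.
Qed.

Lemma oppr_self x : x = - x -> x = 0.
Proof.
move/eqP; rewrite -subr_eq0 opprK -mulr2n -scaler_nat scaler_eq0.
by rewrite (natF_eq0 F0) => /eqP.
Qed.

(** Expand [z] into permutations. For each of them some transposition lies in both the column group
    and the translated color group; it acts by -1 on one factor and by 1 on the other. *)
Lemma casym_asym0 la c k z : is_partition m la ->
  (pcard (rrow m la) k < pcard c k)%N -> casym la * (z * csym F c) = 0.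
Proof.
move=> pl lt; rewrite mul_fg_sum big1 // => g _.
rewrite gelt_csym mulrA.
have [p [q [npq ecol ec]]] : exists p q : 'I_m,
    [/\ p != q, colof la p = colof la q & ctranslate c g p = ctranslate c g q].
  by apply: (@pcard_collision m la _ k) => //; rewrite pcard_ctranslate.
suff -> : casym la * csym F (ctranslate c g) = 0 by rewrite mul0r scaler0.
apply: oppr_self; rewrite -mulNr -(casym_tperm npq ecol) -mulrA csymMl //.
exact: cstab_tperm.
Qed.

(** The mirror image of [casym_asym0] under [star], which fixes both symmetrizers. *)
Lemma csym_casym0 la c k z : is_partition m la ->
  (pcard (rrow m la) k < pcard c k)%N -> csym F c * (z * casym la) = 0.
Proof.
move=> pl lt; rewrite -[LHS]starK.
suff -> : star (csym F c * (z * casym la)) = 0 by rewrite star0.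
by rewrite !starM star_casym star_csym -mulrA (casym_asym0 _ pl lt).
Qed.

Lemma pcard_recolor c i k : (k < c i)%N -> (pcard c k < pcard (recolor c i k) k)%N.
Proof.
move=> ki; apply: proper_card; apply/properP; split.
  by apply/subsetP => j; rewrite !inE /recolor; case: eqP.
by exists i; rewrite !inE /recolor ?eqxx // -ltnNge.
Qed.

Lemma casym_raised la z u : is_partition m la -> u \in raised (rrow m la) fullv ->
  casym la * (z * u) = 0.
Proof.
move=> pl; have sub : (raised (rrow m la) fullv <= lker (lmulg (casym la * z)))%VS.
  apply: raised_sub => i k w ki _; rewrite memv_ker lmulgE.
  rewrite -mulrA [z * _]mulrA [z * _ * (_ * w)]mulrA [casym la * _]mulrA.
  by rewrite (casym_asym0 _ pl (pcard_recolor ki)) mul0r.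
by move/(subvP sub); rewrite memv_ker lmulgE mulrA => /eqP.
Qed.

Lemma raised_casym la u : is_partition m la -> u \in raised (rrow m la) fullv ->
  u * casym la = 0.
Proof.
move=> pl; have sub : (raised (rrow m la) fullv <= lker (rmulg (casym la)))%VS.
  apply: raised_sub => i k w ki _; rewrite memv_ker rmulgE.
  by rewrite -!mulrA (csym_casym0 _ pl (pcard_recolor ki)) mulr0.
by move/(subvP sub); rewrite memv_ker rmulgE => /eqP.
Qed.

Definition intval x := exists f : 'S_m -> int, forall s, x s = (f s)%:~R.

Lemma intval_mul x y : intval x -> intval y -> intval (x * y).
Proof.
case=> f fx [f' fy]; exists (fun s => \sum_t f t * f' (s * t^-1)%g) => s.
rewrite mulfgE rmorph_sum /=; apply: eq_bigr => t _.
by rewrite fx fy rmorphM.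
Qed.

Lemma intF_eq0 (a : int) : (a%:~R == 0 :> F) = (a == 0).
Proof.
case: a => n; first by rewrite -pmulrn (natF_eq0 F0).
by rewrite NegzE rmorphN /= oppr_eq0 -pmulrn (natF_eq0 F0).
Qed.

(* The coefficient of [x * star x] at the identity is a sum of squares of integers. *)
Lemma intval_mul_star x : intval x -> x != 0 -> x * star x != 0.
Proof.
case=> f fx; apply: contraNneq => /ffunP/(_ 1%g).
rewrite mulfgE ffunE => e; apply/eqP/ffunP => s; rewrite ffunE fx.
have : \sum_t f t * f t = 0.
  apply/eqP; rewrite -intF_eq0 rmorph_sum /= -[X in _ == X]e; apply/eqP.
  by apply: eq_bigr => t _; rewrite rmorphM /= ffunE mul1g invgK fx.
move/eqP; rewrite psumr_eq0 => [|t _]; last by rewrite -expr2 sqr_ge0.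
by move/allP/(_ s (mem_index_enum _)); rewrite mulf_eq0 orbb => /eqP ->.
Qed.

Lemma intval_csym c : intval (csym F c).
Proof.
exists (fun s => \sum_(g | cstab c g) (s == g)%:R) => s.
rewrite sum_ffunE rmorph_sum /=; apply: eq_bigr => g _.
by rewrite ffunE rmorph_nat.
Qed.

Lemma intval_casym la : intval (casym la).
Proof.
exists (fun s => if col_stab la s then (-1) ^+ odd_perm s else 0) => s.
rewrite ffunE; case: ifP => _; last by rewrite rmorph0.
by rewrite rmorphXn /= rmorphN rmorph1.
Qed.

(** A row and a column share at most one cell, so the identity is the only permutation preserving
    both and a single term contributes. *)
Lemma ysym_coef1 la : is_partition m la -> ysym la 1%g = 1.
Proof.
move=> pl; rewrite ysymE mulfgE (bigD1 1%g) //= big1 ?addr0 => [|t nt].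
  rewrite /csym sum_ffunE (bigD1 1%g) ?cstab1 //= big1 ?addr0 => [|g /andP[_ ng]].
    rewrite !ffunE eqxx mul1r invg1 mulg1 odd_perm1 /= expr0.
    have -> // : col_stab la (1%g : 'S_m).
    exact: (@cstab1 m (fun i => colof la i)).
  by rewrite ffunE eq_sym (negPf ng).
rewrite [casym la _]ffunE mul1g; case: ifP => [ct|_]; last by rewrite mulr0.
rewrite /csym sum_ffunE big1 ?mul0r // => g sg; rewrite ffunE; case: eqP => // e.
case/eqP: nt; apply/permP => i; rewrite perm1; apply: val_inj.
have sl := partition_sumn pl.
apply: (@cell_inj la); rewrite ?sl ?ltn_ord //.
  by move/cstabP: sg => /(_ i); rewrite -e.
have /(@cstabV _ (fun i : 'I_m => colof la i)) := ct.
by rewrite invgK => /cstabP/(_ i).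
Qed.

Lemma ysym_neq0 la : is_partition m la -> ysym la != 0.
Proof.
move=> pl; apply/eqP => e; have := ysym_coef1 pl; rewrite e ffunE => /eqP.
by rewrite eq_sym oner_eq0.
Qed.

Lemma casym_casym_exists la : exists k, casym la * casym la = k *: casym la.
Proof.
pose c (i : 'I_m) := colof la i; exists (nstab c)%:R.
apply/ffunP => s; rewrite mulfgE [RHS]ffunE.
under eq_bigr => t _ do rewrite !ffunE.
have colE t : col_stab la t = cstab c t by [].
rewrite (bigID (cstab c)) /= [X in _ + X]big1 ?addr0 => [|t /negPf nt]; last first.
  by rewrite colE nt mul0r.
rewrite (eq_bigr (fun _ => casym la s)) => [|t ct].
  by rewrite sumr_const -[LHS]mulr_natl.
rewrite colE ct ffunE colE cstabMr ?cstabV //.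
rewrite colE; case: ifP => _; last by rewrite mulr0.
rewrite odd_permM odd_permV; case: (odd_perm t); case: (odd_perm s);
by rewrite /= ?expr0 ?expr1 ?mulrNN ?mulr1 ?mul1r.
Qed.

(** If [k] were 0, then [y = ra * casym * ra] would lie in [raised], which [casym] annihilates, so
    [y * star y = y * y = 0] and [y = 0] by positivity. But [ysym * star ysym] is a multiple of [y]
    and is nonzero, again by positivity. *)
Lemma ysym_sq_scalar la : is_partition m la ->
  exists2 k, k != 0 & ra la * (casym la * ra la) - k *: ra la \in raised (rrow m la) fullv.
Proof.
move=> pl; have [k Hk] := csym_mul_csym F0 (rrow m la) (casym la).
exists k => //; apply/eqP => k0; rewrite k0 scale0r subr0 in Hk.
pose y := ra la * (casym la * ra la).
have y0 : y != 0.
  have := intval_mul_star (intval_mul (intval_csym (rrow m la)) (intval_casym la)).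
  rewrite -ysymE ysym_neq0 // => /(_ isT); rewrite ysymE starM star_casym star_csym.
  have [l el] := casym_casym_exists la.
  rewrite -mulrA [casym la * (_ * _)]mulrA el -scalerAl -scalerAr -/y.
  by apply: contraNneq => ->; rewrite scaler0.
have iy : intval y by do !apply: intval_mul; rewrite ?intval_csym ?intval_casym //;
  [exact: intval_csym | exact: intval_casym | exact: intval_csym].
have := intval_mul_star iy y0; rewrite {2}/y !starM star_casym star_csym.
rewrite -{1}/y -mulrA {1}/y.
have -> : ra la * (casym la * ra la) * (ra la * (casym la * ra la))
   = ra la * (casym la * (ra la * (ra la * (casym la * ra la)))) by rewrite !mulrA.
by rewrite casym_raised // mulr0 eqxx.
Qed.

End YoungSymmetrizers.

(** * Left ideals *)

Section Modules.
Variables (F : fieldType) (m : nat).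
Hypothesis F0 : [pchar F] =i pred0.
Local Notation FG := (grpalg F m).
Local Notation ra la := (csym F (rrow m la)).
Local Notation ysym := (@ysym F m).
Implicit Types (x y z w u : FG) (g h s t : 'S_m) (la mu : seq nat) (W V T : {vspace FG}).

Lemma ysym_sq la : is_partition m la -> exists2 k, k != 0 & ysym la * ysym la = k *: ysym la.
Proof.
move=> pl; have [k k0 Hk] := ysym_sq_scalar F0 pl; exists k => //.
have := raised_casym F0 pl Hk; rewrite mulrBl -scalerAl -ysymE => /subr0_eq <-.
by rewrite !ysymE !mulrA.
Qed.

Lemma ysym_mul la z : is_partition m la -> exists k, ysym la * (z * ysym la) = k *: ysym la.
Proof.
move=> pl; have [k Hk] := csym_mul_csym F0 (rrow m la) (casym F m la * z).
exists k; have := raised_casym F0 pl Hk; rewrite mulrBl -scalerAl -ysymE => /subr0_eq <-.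
by rewrite !ysymE !mulrA.
Qed.

(** Some partial sum differs; the partition with the larger one supplies the row symmetrizer, the
    other the column antisymmetrizer, and the two collide. *)
Lemma ysym_ortho la mu z : is_partition m la -> is_partition m mu -> la != mu ->
  ysym la * (z * ysym mu) = 0.
Proof.
move=> pl pm /(partition_neq pl pm)[k]; rewrite neq_ltn !ysymE => /orP[] lt.
  rewrite -mulrA [z * _]mulrA [casym _ _ _ * _]mulrA.
  by rewrite (casym_asym0 F0 z pl lt) mul0r mulr0.
have := csym_casym0 F0 (casym F m la * (z * ra mu)) pm lt.
by rewrite !mulrA.
Qed.

(** Averaging a linear projection onto [W] over the group gives a map of left modules, that is,
    right multiplication by its value [e] at 1. *)
Lemma maschke W : stable W -> exists2 e, e \in W & forall w, w \in W -> w * e = w.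
Proof.
move=> sW; pose n : F := (#|'S_m|%:R)^-1.
have n0 : #|'S_m|%:R != 0 :> F.
  by rewrite (natF_eq0 F0) -lt0n; apply/card_gt0P; exists 1%g.
exists (n *: \sum_g gelt F g^-1 * projv W (gelt F g)).
  by rewrite rpredZ // rpred_sum // => g _; rewrite sW ?memv_proj.
move=> w Ww; rewrite -scalerAr.
have -> : w * (\sum_g gelt F g^-1 * projv W (gelt F g)) =
    \sum_g gelt F g^-1 * projv W (gelt F g * w).
  rewrite mulr_sumr {1}[w]fg_sum.
  under eq_bigr do rewrite mulr_suml.
  rewrite exchange_big /=.
  under [RHS]eq_bigr => g _.
    rewrite {1}[w]fg_sum mulr_sumr linear_sum mulr_sumr /=.
    under eq_bigr do rewrite -scalerAr linearZ -scalerAr /= geltM.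
    over.
  rewrite [RHS]exchange_big /=; apply: eq_bigr => h _.
  rewrite (reindex_inj (mulgI h)) /=; apply: eq_bigr => g _.
  by rewrite -scalerAl mulrA geltM invMg mulgKV.
rewrite (eq_bigr (fun _ => w)) => [|g _]; last by rewrite projv_id ?geltVK // sW.
rewrite sumr_const -scaler_nat scalerA mulVf ?scale1r //.
Qed.

(** A substitute for Schur's lemma. The kernel [K] of right multiplication by [w] on the left ideal
    of [ysym la] has a right identity [e = z * ysym la], and [ysym la * e = k *: ysym la]. If [k] is
    nonzero, [e * w = 0] forces [ysym la * w = 0]; if [k] is 0, then [e = e * e = 0], so [K = 0]. *)
Lemma ysym_mul_inj la x w : is_partition m la -> ysym la * w != 0 ->
  x * (ysym la * w) = 0 -> x * ysym la = 0.
Proof.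
move=> pl cw0 xcw.
pose K := (limg (rmulg (ysym la)) :&: lker (rmulg w))%VS.
have sK : stable K.
  move=> g y; rewrite !memv_cap !memv_ker !rmulgE => /andP[/memv_imgP[z _ ->] /eqP e].
  by rewrite -mulrA e mulr0 eqxx andbT rmulgE mulrA -rmulgE memv_img ?memvf.
have [e Ke eid] := maschke sK.
have e0 : e = 0.
  rewrite -(eid e Ke); move: (Ke); rewrite memv_cap => /andP[/memv_imgP[z _ Ez] _].
  rewrite rmulgE in Ez; have [k ek] := ysym_mul z pl.
  rewrite {1}Ez -mulrA Ez ek; case: (eqVneq k 0) => [->|k0].
    by rewrite scale0r mulr0.
  case/eqP: cw0; apply: (scalerI k0); rewrite scaler0 scalerAl -ek -Ez.
  move: Ke; rewrite memv_cap => /andP[_]; rewrite memv_ker rmulgE => /eqP.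
  by rewrite -mulrA => ->; rewrite mulr0.
rewrite -(eid (x * ysym la)); first by rewrite e0 mulr0.
by rewrite memv_cap memv_ker rmulgE -mulrA xcw eqxx andbT -rmulgE memv_img ?memvf.
Qed.

Lemma raised_mulr r W u w : stable W -> u \in raised r fullv -> w \in W -> u * w \in raised r W.
Proof.
move=> sW Uu Ww; have sub : (raised r fullv <= rmulg w @^-1: raised r W)%VS.
  apply: raised_sub => i k z ki _; rewrite -memv_preim rmulgE -!mulrA.
  by rewrite mem_raised // stable_mul.
by move/(subvP sub): Uu; rewrite -memv_preim rmulgE.
Qed.

Lemma raised_ysym la W w : stable W -> is_partition m la -> w \in W ->
  ysym la * (ra la * w) = 0 -> ra la * w \in raised (rrow m la) W.
Proof.
move=> sW pl Ww e; have [k k0 Hk] := ysym_sq_scalar F0 pl.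
have := raised_mulr sW Hk Ww; rewrite mulrBl -scalerAl.
have -> : ra la * (casym F m la * ra la) * w = 0 by rewrite -e ysymE !mulrA.
by rewrite sub0r rpredN rpredZeq (negPf k0).
Qed.

(** Rank and nullity of left multiplication by [ysym la] on the row invariants: the kernel is
    [raised] by [raised_ysym], and the image is everything because [ysym la] is a nonzero multiple
    of an idempotent. *)
Lemma dim_csym_img la W : stable W -> is_partition m la ->
  \dim (lmulg (ra la) @: W) = (\dim (raised (rrow m la) W) + \dim (lmulg (ysym la) @: W))%N.
Proof.
move=> sW pl; rewrite -(limg_ker_dim (lmulg (ysym la))); congr (_ + _)%N.
  congr (\dim _); apply/eqP; rewrite eqEsubv; apply/andP; split.
    apply/subvP => _ /memv_capP[/memv_imgP[w Ww ->]]; rewrite memv_ker !lmulgE.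
    by move=> /eqP; apply: raised_ysym.
  rewrite subv_cap; apply/andP; split.
    by apply: raised_sub => i k w ki Ww; rewrite -lmulgE memv_img // stable_mul.
  apply: raised_sub => i k w ki Ww; rewrite memv_ker lmulgE ysymE -mulrA.
  have Uu : csym F (rrow m la) * (csym F (recolor (rrow m la) i k) * w) \in raised (rrow m la) fullv.
    by apply: mem_raised; rewrite ?memvf.
  by have := casym_raised F0 1 pl Uu; rewrite mul1r => ->; rewrite mulr0.
congr (\dim _); apply/eqP; rewrite eqEsubv; apply/andP; split; apply/subvP => w.
  case/memv_imgP => _ /memv_imgP[y Wy ->] ->; rewrite !lmulgE -[ysym la * _]lmulgE memv_img //.
  by rewrite stable_mul.
case/memv_imgP => y Wy ->; have [k k0 ek] := ysym_sq pl.
rewrite lmulgE; have -> : ysym la * y = ysym la * (ra la * (casym F m la * (k^-1 *: y))).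
  rewrite [ra la * _]mulrA -ysymE mulrA ek -scalerAl -scalerAr scalerA mulfV //.
  by rewrite scale1r.
by rewrite -[ysym la * _]lmulgE memv_img // -lmulgE memv_img // stable_mul // rpredZ.
Qed.

(** Splits off the left ideal [T] generated by [ysym la * w0], with complement the kernel of right
    multiplication by the right identity of [T]. The independence clause says that [T] is a faithful
    copy of the Specht module. *)
Lemma split_specht la W : stable W -> is_partition m la -> (0 < \dim (lmulg (ysym la) @: W))%N ->
  exists w0 W', [/\ w0 \in W, stable W', (W' <= W)%VS,
    (forall w, w \in W -> exists x w', w' \in W' /\ w = x * (ysym la * w0) + w') &
    (forall x w', w' \in W' -> x * (ysym la * w0) + w' = 0 -> x * ysym la = 0 /\ w' = 0) /\
    (forall mu, is_partition m mu ->
       \dim (lmulg (ysym mu) @: W) = ((mu == la) + \dim (lmulg (ysym mu) @: W'))%N)].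
Proof.
move=> sW pl; rewrite lt0n dimv_eq0 => n0.
have [w0 Ww0 cw0] : exists2 w0, w0 \in W & ysym la * w0 != 0.
  apply: NNPP => H; case/negP: n0; rewrite -subv0; apply/subvP => _ /memv_imgP[w Ww ->].
  by rewrite lmulgE memv0; apply: contraT => e; case: H; exists w.
pose T := limg (rmulg (ysym la * w0)).
have sT : stable T.
  by move=> g _ /memv_imgP[z _ ->]; rewrite rmulgE mulrA -rmulgE memv_img ?memvf.
have TW : (T <= W)%VS by apply/subvP => _ /memv_imgP[z _ ->]; rewrite rmulgE !stable_mul.
have [e Te eid] := maschke sT.
pose W' := (W :&: lker (rmulg e))%VS.
have W'e w : w \in W' -> w * e = 0 by rewrite memv_cap memv_ker rmulgE => /andP[_ /eqP].
exists w0, W'; split => //.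
- move=> g w; rewrite !memv_cap !memv_ker !rmulgE => /andP[Ww /eqP we].
  by rewrite -mulrA we mulr0 sW //=.
- exact: capvSl.
- move=> w Ww; have Twe : w * e \in T by rewrite stable_mul.
  have /memv_imgP[x _ ex] := Twe; rewrite rmulgE in ex.
  exists x, (w - w * e); split; last by rewrite -ex addrC subrK.
  rewrite memv_cap memv_ker rmulgE mulrBl (eid (w * e)) // subrr eqxx andbT.
  by rewrite rpredB // (subvP TW).
have disj : (T :&: W' = 0)%VS.
  apply/eqP; rewrite -subv0; apply/subvP => w /memv_capP[Tw /W'e we].
  by rewrite memv0 -(eid w Tw) we.
split.
  move=> x w' Ww' E; have : x * (ysym la * w0) = 0.
    rewrite -(eid (x * _)); last by rewrite -rmulgE memv_img ?memvf.
    have -> : x * (ysym la * w0) = - w' by apply/eqP; rewrite -addr_eq0 E.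
    by rewrite mulNr W'e ?oppr0.
  move=> x0; move: E; rewrite x0 add0r => ->; split => //.
  exact: ysym_mul_inj x0.
move=> mu pm.
have WE : W = (T + W')%VS.
  apply/eqP; rewrite eqEsubv subv_add TW capvSl !andbT; apply/subvP => w Ww.
  have Twe : w * e \in T by rewrite stable_mul.
  rewrite -(subrK (w * e) w) addrC memv_add // memv_cap memv_ker rmulgE mulrBl.
  by rewrite (eid (w * e)) // subrr eqxx andbT rpredB // (subvP TW).
rewrite {1}WE limgD dimv_disjoint_sum; last first.
  apply/eqP; rewrite -subv0 -disj; apply: capvS; apply/subvP => _ /memv_imgP[w Ww ->];
    rewrite lmulgE.
    exact: stable_mul.
  move: Ww; rewrite !memv_cap !memv_ker !rmulgE => /andP[Ww /eqP we].
  by rewrite -mulrA we mulr0 eqxx stable_mul.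
congr (_ + _)%N; case: eqVneq => [->|ne]; last first.
  apply/eqP; rewrite dimv_eq0 -subv0; apply/subvP => _ /memv_imgP[_ /memv_imgP[z _ ->] ->].
  by rewrite lmulgE rmulgE [z * _]mulrA [ysym mu * _]mulrA (ysym_ortho _ pm pl ne) mul0r mem0v.
(* The symmetrizer sandwiches every element into a scalar multiple of itself, so this image is a
   line. *)
have -> : (lmulg (ysym la) @: T)%VS = <[ysym la * w0]>%VS; last by rewrite dim_vline cw0.
apply/eqP; rewrite eqEsubv; apply/andP; split.
  apply/subvP => _ /memv_imgP[_ /memv_imgP[z _ ->] ->]; rewrite lmulgE rmulgE.
  have [k ek] := ysym_mul z pl; rewrite [z * _]mulrA [ysym la * _]mulrA ek -scalerAl.
  by rewrite rpredZ // memv_line.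
have [k k0 ek] := ysym_sq pl; rewrite -memvE.
have -> : ysym la * w0 = lmulg (ysym la) (k^-1 *: (ysym la * w0)).
  by rewrite linearZ /= lmulgE mulrA ek -scalerAl scalerA mulVf ?scale1r.
by rewrite memv_img // rpredZ // -[ysym la * w0]mul1r -rmulgE memv_img ?memvf.
Qed.

End Modules.

(** * Decomposition into Specht modules *)

Section PartitionOfColoring.
Local Open Scope nat_scope.

Lemma nth_flatten_rowof (T : eqType) (x0 : T) (ss : seq (seq T)) p :
  p < size (flatten ss) -> nth x0 (flatten ss) p \in nth [::] ss (rowof (shape ss) p).
Proof.
elim: ss p => [|s ss IH] p //=; rewrite size_cat rowof_cons nth_cat.
case: (ltnP p (size s)) => [ps _|sp lt] /=; first exact: mem_nth.
by apply: IH; rewrite ltn_subLR.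
Qed.

(** List the nonempty color classes by decreasing size: their concatenation fills the tableau row by
    row, and [g] sends each point to its position in it. *)
Lemma partition_of_coloring m (c : 'I_m -> 'I_m) :
  exists la (g : 'S_m), is_partition m la /\
    forall i j, (rrow m la (g i) == rrow m la (g j)) = (c i == c j).
Proof.
case: m c => [|m] c; first by exists [::], 1%g; split => // - [].
pose le (k l : 'I_m.+1) := #|fib c l| <= #|fib c k|.
have le_total : total le by move=> k l; exact: leq_total.
pose cs := sort le [seq k : 'I_m.+1 <- enum 'I_m.+1 | 0 < #|fib c k|].
pose ss := [seq enum (fib c (k : 'I_m.+1)) | k <- cs].
pose la := [seq #|fib c (k : 'I_m.+1)| | k <- cs].
have shE : shape ss = la.
  by rewrite /shape /ss /la -map_comp; apply: eq_map => k /=; rewrite cardE.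
have cs_uniq : uniq cs by rewrite sort_uniq filter_uniq // enum_uniq.
have memcs k : (k \in cs) = (0 < #|fib c k|) by rewrite mem_sort mem_filter mem_enum andbT.
have memss i : i \in flatten ss.
  apply/flattenP; exists (enum (fib c (c i))); last by rewrite mem_enum inE.
  by apply: map_f; rewrite memcs; apply/card_gt0P; exists i; rewrite inE.
have uss : uniq (flatten ss).
  move: cs_uniq; rewrite /ss; elim: (cs) => //= k ks IH /andP[nk uk].
  rewrite cat_uniq enum_uniq IH // andbT -all_predC; apply/allP => i.
  case/flattenP => _ /mapP[l lks ->]; rewrite mem_enum inE /= mem_enum inE => /eqP e.
  by rewrite e; apply: contraNN nk => /eqP/val_inj <-.
have szss : size (flatten ss) = m.+1.
  rewrite -[RHS]card_ord -(card_uniqP uss); apply: eq_card => i; exact: memss.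
have pl : is_partition m.+1 la.
  apply/and3P; split.
  - rewrite /la sorted_map; exact: (sort_sorted le_total).
  - by apply/allP => x /mapP[k]; rewrite memcs => k0 ->.
  - by rewrite -shE -size_flatten szss.
pose s (p : 'I_m.+1) := nth ord0 (flatten ss) p.
have s_inj : injective s.
  move=> p q /eqP; rewrite /s nth_uniq ?szss ?ltn_ord // => /eqP; exact: val_inj.
have cs_row (p : 'I_m.+1) : c (s p) = nth ord0 cs (rowof la p) /\ rowof la p < size cs.
  have ps : p < size (flatten ss) by rewrite szss.
  have rl : rowof la p < size cs.
    by have := @rowof_lt la p; rewrite size_map; apply; rewrite (partition_sumn pl).
  split=> //; have := nth_flatten_rowof ord0 ps.
  rewrite shE (nth_map ord0) // mem_enum inE => /eqP e; exact: val_inj.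
exists la, (perm s_inj)^-1%g; split => // i j.
have ci k : c k = c (s ((perm s_inj)^-1%g k)) by rewrite -(permE s_inj) permKV.
rewrite (ci i) (ci j); move: ((perm s_inj)^-1%g i) ((perm s_inj)^-1%g j) => p q.
rewrite (cs_row p).1 (cs_row q).1 nth_uniq // ?(cs_row p).2 ?(cs_row q).2 //.
Qed.

(** The sum of the squares of the class sizes. It stands in for the dominance order: it grows when a
    box moves to a higher row and depends only on the partition into classes. *)
Definition energy m (c : 'I_m -> nat) := \sum_i \sum_j (c i == c j).

Lemma energy_recolor m (c : 'I_m -> nat) i k : k < c i -> #|fib c (c i)| <= #|fib c k| ->
  energy c < energy (recolor c i k).
Proof.
move=> ki le; rewrite /energy (bigD1 i) //= [X in _ < X](bigD1 i) //=.
have spl (d : 'I_m -> nat) : \sum_(a | a != i) \sum_b (d a == d b) =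
   \sum_(a | a != i) (d i == d a) + \sum_(a | a != i) \sum_(b | b != i) (d a == d b).
  rewrite -big_split /=; apply: eq_bigr => a _; rewrite (bigD1 i) //=; congr (_ + _).
  by rewrite eq_sym.
have self (d : 'I_m -> nat) : \sum_b (d i == d b) = 1 + \sum_(b | b != i) (d i == d b).
  by rewrite (bigD1 i) //= eqxx.
rewrite !spl !self.
have -> : \sum_(a | a != i) \sum_(b | b != i) (recolor c i k a == recolor c i k b) =
          \sum_(a | a != i) \sum_(b | b != i) (c a == c b).
  apply: eq_bigr => a /negPf na; apply: eq_bigr => b /negPf nb.
  by rewrite /recolor na nb.
suff: \sum_(b | b != i) (c i == c b) < \sum_(b | b != i) (recolor c i k i == recolor c i k b) by lia.
have cE : #|fib c (c i)| = 1 + \sum_(b | b != i) (c i == c b).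
  rewrite -self -sum1_card big_mkcond /=; apply: eq_bigr => b _.
  by rewrite inE eq_sym; case: eqP.
have kE : #|fib c k| = \sum_(b | b != i) (recolor c i k i == recolor c i k b).
  rewrite -sum1_card big_mkcond /= (bigD1 i) //= inE gtn_eqF //=.
  by apply: eq_bigr => b nb; rewrite inE /recolor eqxx (negPf nb) eq_sym; case: eqP.
by lia.
Qed.

(** Moving each cell up its column injects the lower row into the higher one. *)
Lemma card_fib_rrow m la i j : is_partition m la -> i <= j ->
  #|fib (rrow m la) j| <= #|fib (rrow m la) i|.
Proof.
move=> pl ij; have sl := partition_sumn pl.
have H (p : 'I_m) : exists q : 'I_m, rrow m la p = j -> rrow m la q = i /\ colof la q = colof la p.
  case: (eqVneq (rrow m la p) j) => [e|ne]; last by exists p => e; rewrite e eqxx in ne.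
  have ps : p < sumn la by rewrite sl.
  have rl := rowof_lt ps; have cl := colof_lt ps; rewrite -/(rrow m la p) e in rl cl.
  have [q [qm rq cq]] := cell_exists (leq_ltn_trans ij rl) (leq_trans cl (partition_nth pl ij)).
  by rewrite sl in qm; exists (Ordinal qm).
pose f p := projT1 (constructive_indefinite_description _ (H p)).
have fP p : rrow m la p = j -> rrow m la (f p) = i /\ colof la (f p) = colof la p.
  exact: (projT2 (constructive_indefinite_description _ (H p))).
have fi : {in fib (rrow m la) j &, injective f}.
  move=> p q; rewrite !inE => /eqP rp /eqP rq e; apply: val_inj.
  apply: (@cell_inj la); rewrite ?sl ?ltn_ord //.
    by rewrite -/(rrow m la p) -/(rrow m la q) rp rq.
  by rewrite -(fP p rp).2 -(fP q rq).2 e.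
rewrite -(card_in_imset fi); apply: subset_leq_card; apply/subsetP => _ /imsetP[p + ->].
by rewrite !inE => /eqP rp; rewrite (fP p rp).1.
Qed.

End PartitionOfColoring.

Section Decomposition.
Variables (F : fieldType) (m : nat).
Hypothesis F0 : [pchar F] =i pred0.
Local Notation FG := (grpalg F m).
Local Notation ra la := (csym F (rrow m la)).
Local Notation ysym := (@ysym F m).
Implicit Types (x y z w u : FG) (g h s t : 'S_m) (la mu : seq nat) (W V T : {vspace FG}).

Lemma csym_kernel (c d : 'I_m -> nat) :
  (forall i j, (c i == c j) = (d i == d j)) -> csym F c = csym F d.
Proof. by move=> e; apply: eq_bigl => g; apply: eq_forallb => i; rewrite e. Qed.

(* Among the colorings whose symmetrizer does not kill [W], one with the largest
   energy is a partition for which [raised] vanishes. *)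
Lemma specht_exists W : stable W -> W != 0%VS ->
  exists2 la, is_partition m la & (lmulg (ysym la) @: W != 0)%VS.
Proof.
move=> sW W0.
pose P (c : {ffun 'I_m -> 'I_m}) := (lmulg (csym F (fun i => c i : nat)) @: W != 0)%VS.
pose E (c : {ffun 'I_m -> 'I_m}) := energy (fun i => c i : nat).
pose c0 := [ffun i : 'I_m => i].
(* With all colors distinct the Young subgroup is trivial, so the maximum is taken over a nonempty
   set. *)
have Pc0 : P c0.
  rewrite /P; have -> : csym F (fun i => c0 i : nat) = 1.
    rewrite /csym (bigD1 1%g) ?cstab1 //= gelt1 big1 ?addr0 // => g /andP[/cstabP sg].
    by case/eqP; apply/permP => i; have := sg i; rewrite !ffunE perm1 => /val_inj.
  suff -> : (lmulg (1 : FG) @: W = W)%VS by [].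
  apply/eqP; rewrite eqEsubv; apply/andP; split; apply/subvP => w.
    by case/memv_imgP => v Vv ->; rewrite lmulgE mul1r.
  by move=> Ww; rewrite -[w]mul1r -lmulgE memv_img.
have [c Pc cmax] := @arg_maxnP _ c0 P E Pc0.
have [la [g [pl Hg]]] := partition_of_coloring c.
have sl := partition_sumn pl.
have eqE (d : 'I_m -> nat) : (forall i j, (d (g i) == d (g j)) = (c i == c j)) -> energy d = E c.
  move=> Hd; rewrite /energy (reindex_inj (@perm_inj _ g)) /=; apply: eq_bigr => i _.
  by rewrite (reindex_inj (@perm_inj _ g)) /=; apply: eq_bigr => j _; rewrite Hd.
have rmulg (i : 'I_m) : (rrow m la i < m)%N.
  have il : (i < sumn la)%N by rewrite sl.
  apply: leq_trans (rowof_lt il) _; case/and3P: pl => _ + /eqP <-; elim: (la) => //= a l IH.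
  by case/andP => a0 /IH; lia.
have U0 : raised (rrow m la) W = 0%VS.
  apply/eqP; rewrite -subv0; apply: raised_sub => i k w ki Ww.
  have km : (k < m)%N by apply: ltn_trans ki (rmulg i).
  pose d := [ffun j => if j == i then Ordinal km else Ordinal (rmulg j)].
  have dE j : recolor (rrow m la) i k j = d j by rewrite /recolor ffunE; case: eqP.
  rewrite (eq_csym F dE).
  suff : ~~ P d.
    rewrite negbK => /eqP e.
    have := memv_img (lmulg (csym F (fun i => d i : nat))) Ww; rewrite e memv0 lmulgE => /eqP ->.
    by rewrite mulr0 mem0v.
  apply/negP => /cmax Hd; have {Hd} : (E d <= E c)%N by []; rewrite leqNgt => /negP; apply.
  have -> : E c = energy (rrow m la) by rewrite (eqE _ Hg).
  have -> : E d = energy (recolor (rrow m la) i k).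
    by apply: eq_bigr => a _; apply: eq_bigr => b _; rewrite !dE.
  apply: energy_recolor => //; apply: card_fib_rrow => //; exact: ltnW.
(* If [ysym la] killed [W], the row invariants would lie in [raised], which is 0; translating back
   by [g], the symmetrizer of [c] would kill [W] as well. *)
exists la => //; apply: contraNneq Pc => e0; rewrite -subv0; apply/subvP => _ /memv_imgP[w Ww ->].
rewrite lmulgE memv0 -(geltVK g (_ * w)) [gelt F g * _]mulrA gelt_csym.
have -> : csym F (ctranslate (fun i => c i : nat) g) = ra la.
  apply: csym_kernel => i j; rewrite /ctranslate.
  by have := Hg (g^-1 i)%g (g^-1 j)%g; rewrite !permKV => ->.
have Wg : gelt F g * w \in W by apply: sW.
have : ra la * (gelt F g * w) \in raised (rrow m la) W.
  apply: raised_ysym => //; apply/eqP; rewrite -memv0 -e0 -lmulgE memv_img //.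
  exact: stable_mul.
by rewrite U0 memv0 -mulrA => /eqP ->; rewrite mulr0.
Qed.

(** The [i]-th Specht module is embedded by right multiplication by [v i]. The coefficient [x i]
    matters only through its product with the symmetrizer, hence the form of the last clause. *)
Definition specht_sum W ls := exists v : nat -> FG,
  [/\ forall i, (i < size ls)%N -> v i \in W,
      forall w, w \in W -> exists x : nat -> FG,
        w = \sum_(i < size ls) x i * (ysym (nth [::] ls i) * v i) &
      forall x : nat -> FG, \sum_(i < size ls) x i * (ysym (nth [::] ls i) * v i) = 0 ->
        forall i, (i < size ls)%N -> x i * ysym (nth [::] ls i) = 0].

(** Each entry of [ls] splits off one summand and lowers one multiplicity; once all multiplicities
    are 0, [specht_exists] leaves nothing over. *)
Lemma specht_sum_exists ls W : stable W -> all (is_partition m) ls ->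
  (forall mu, is_partition m mu -> \dim (lmulg (ysym mu) @: W) = count_mem mu ls) ->
  specht_sum W ls.
Proof.
elim: ls W => [|la ls IH] W sW /=.
  move=> _ dW; have W0 : W = 0%VS.
    apply/eqP; apply: contraT => /(specht_exists sW)[la pl].
    by rewrite -dimv_eq0 dW.
  exists (fun _ => 0); split=> // w; rewrite W0 memv0 => /eqP ->.
  by exists (fun _ => 0); rewrite big_ord0.
case/andP => pl pls dW; have dpos : (0 < \dim (lmulg (ysym la) @: W))%N by rewrite dW // eqxx.
have [w0 [W' [Ww0 sW' W'W spanW [indW dimW]]]] := split_specht F0 sW pl dpos.
have [|v [vW' vspan vind]] := IH W' sW' pls.
  by move=> mu pm; have := dimW mu pm; rewrite dW //= [mu == la]eq_sym => /addnI.
exists (fun i => if i is i'.+1 then v i' else w0); split.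
- by case=> //= i il; rewrite (subvP W'W) // vW'.
- move=> w /spanW[x [w' [/vspan[x' ->] ->]]].
  by exists (fun i => if i is i'.+1 then x' i' else x); rewrite big_ord_recl.
move=> x; rewrite big_ord_recl /= => E.
have [] := indW _ _ _ E.
  by apply: rpred_sum => i _; do 2!apply: stable_mul => //; apply: vW'; apply: ltn_ord.
move=> x0 /(vind (fun i => x i.+1)) H [|i] //= il; exact: H.
Qed.

Section FromIso.
Variables (W : {vspace FG}) (ls : seq (seq nat)) (psi : nat -> FG -> FG).
Hypothesis sW : stable W.
Hypothesis pls : all (is_partition m) ls.
Local Notation S i := (limg (rmulg (ysym (nth [::] ls i)))).
Hypothesis psiP : forall i, (i < size ls)%N -> forall a x y, x \in S i -> y \in S i ->
  psi i (a *: x + y) = a *: psi i x + psi i y.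
Hypothesis psiG : forall i, (i < size ls)%N -> forall g x, x \in S i ->
  psi i (gelt F g * x) = gelt F g * psi i x.
Hypothesis psiW : forall i, (i < size ls)%N -> forall x, x \in S i -> psi i x \in W.
Hypothesis psiS : forall w, w \in W -> exists x : nat -> FG,
  (forall i, (i < size ls)%N -> x i \in S i) /\ w = \sum_(i < size ls) psi i (x i).
Hypothesis psiI : forall x : nat -> FG, (forall i, (i < size ls)%N -> x i \in S i) ->
  \sum_(i < size ls) psi i (x i) = 0 -> forall i, (i < size ls)%N -> x i = 0.

Let psi0 i : (i < size ls)%N -> psi i 0 = 0.
Proof.
move=> il; have := psiP il (-1) (mem0v _) (mem0v _); rewrite scaler0 addr0 => ->.
by rewrite scaleN1r addNr.
Qed.

Let stS i : stable (S i).
Proof. by move=> g _ /memv_imgP[z _ ->]; rewrite rmulgE mulrA -rmulgE memv_img ?memvf. Qed.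

Let psiM i z x : (i < size ls)%N -> x \in S i -> psi i (z * x) = z * psi i x.
Proof.
move=> il Sx; rewrite {1}[z]fg_sum {2}[z]fg_sum !mulr_suml.
elim: (index_enum _) => [|g s IH]; first by rewrite !big_nil psi0.
rewrite !big_cons -!scalerAl psiP ?psiG ?IH //; first exact: stS.
by apply: rpred_sum => h _; rewrite -scalerAl rpredZ // stS.
Qed.

(** Left multiplication by [ysym mu] kills the summands of other shapes and maps each summand of
    shape [mu] onto the line of [psi i (ysym mu)]; these lines are independent by [psiI]. *)
Lemma dim_from_iso mu : is_partition m mu -> \dim (lmulg (ysym mu) @: W) = count_mem mu ls.
Proof.
move=> pm.
pose l i := psi i (ysym mu).
have pn (i : 'I_(size ls)) : is_partition m (nth [::] ls i).
  by apply: (allP pls); apply: mem_nth.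
have Sc (i : 'I_(size ls)) : nth [::] ls i == mu -> ysym mu \in S i.
  by move/eqP->; apply/memv_imgP; exists 1; rewrite ?memvf // rmulgE mul1r.
have -> : (lmulg (ysym mu) @: W = \sum_(i < size ls | nth [::] ls i == mu) <[l i]>)%VS.
  apply/eqP; rewrite eqEsubv; apply/andP; split; last first.
    apply/subv_sumP => i ei; rewrite -memvE; have [k k0 ek] := ysym_sq F0 pm.
    have -> : l i = ysym mu * psi i (k^-1 *: ysym mu).
      rewrite -psiM //; last by rewrite rpredZ // Sc.
      by rewrite -scalerAr ek scalerA mulVf ?scale1r.
    by rewrite -lmulgE memv_img // psiW // rpredZ // Sc.
  apply/subvP => _ /memv_imgP[w /psiS[x [Sx ->]] ->]; rewrite lmulgE mulr_sumr.
  rewrite rpred_sum // => i _; rewrite -psiM ?Sx //.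
  have /memv_imgP[z _ ->] := Sx i (ltn_ord i); rewrite rmulgE.
  case: (eqVneq (nth [::] ls i) mu) => [e|ne]; last first.
    by rewrite ysym_ortho // 1?eq_sym // psi0 ?mem0v.
  rewrite e; have [k ->] := ysym_mul F0 z pm.
  have -> : psi i (k *: ysym mu) = k *: l i.
    rewrite -[k *: ysym mu]addr0 psiP ?psi0 ?addr0 ?mem0v //.
    by rewrite Sc // e eqxx.
  rewrite rpredZ // (bigD1 i) ?e //= (subvP (addvSl _ _)) // memv_line //.
have dv : directv (\sum_(i < size ls | nth [::] ls i == mu) <[l i]>).
  apply/directv_sum_independent => us Hus us0 i ei.
  have Ha (j : 'I_(size ls)) : exists a, nth [::] ls j == mu -> us j = a *: l j.
    case: (boolP (nth [::] ls j == mu)) => [ej|_]; last by exists 0.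
    by have /vlineP[a ->] := Hus j ej; exists a.
  have [a {}Ha] := fin_all_exists Ha.
  (* Extends the coefficients from ordinals to a family on [nat], as [psiI] expects. *)
  pose x j := if insub j is Some j' then
     (if nth [::] ls j == mu then a j' *: ysym mu else 0) else 0.
  have xE (j : 'I_(size ls)) : x j = if nth [::] ls j == mu then a j *: ysym mu else 0.
    by rewrite /x valK.
  have Sx j : (j < size ls)%N -> x j \in S j.
    move=> jl; rewrite -[j]/(val (Ordinal jl)) xE; case: ifP => [ej|_]; last exact: mem0v.
    by rewrite rpredZ // Sc.
  have psix (j : 'I_(size ls)) : psi j (x j) = if nth [::] ls j == mu then us j else 0.
    rewrite xE; case: ifP => ej; last by rewrite psi0.
    by rewrite -[a j *: ysym mu]addr0 psiP ?psi0 ?addr0 ?mem0v ?Sc // Ha.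
  have := psix i; rewrite ei => <-; rewrite (psiI Sx) ?psi0 //.
  by rewrite (eq_bigr _ (fun j _ => psix j)) -big_mkcond.
rewrite (directvP dv) /=.
rewrite (eq_bigr (fun _ => 1%N)) => [|i ei].
  by rewrite -[RHS]sum1_count [RHS](big_nth [::]) big_mkord.
(* A vanishing [l i] would be a relation whose only nonzero entry is [ysym mu]. *)
rewrite dim_vline; apply/eqP; rewrite eqb1; apply/eqP => li0.
pose x j := if j == i :> nat then ysym mu else 0.
have Sx j : (j < size ls)%N -> x j \in S j.
  by move=> jl; rewrite /x; case: eqP => [->|_]; [exact: Sc | exact: mem0v].
have H : \sum_(j < size ls) psi j (x j) = 0.
  by rewrite big1 // => j _; rewrite /x; case: eqP => [->|_] //; rewrite psi0.
by have /eqP := psiI Sx H (ltn_ord i); rewrite /x eqxx (negPf (ysym_neq0 _ pm)).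
Qed.

End FromIso.
End Decomposition.

(** * Words and generators *)

Section Perms.
Variable T : Type.

Fixpoint insertions (x : T) (s : seq T) : seq (seq T) :=
  if s is y :: s' then (x :: s) :: map (cons y) (insertions x s') else [:: [:: x]].

(* Lists all rearrangements with multiplicity, so that it commutes with [map];
   [permutations] does not. *)
Fixpoint perms (s : seq T) : seq (seq T) :=
  if s is x :: s' then flatten (map (insertions x) (perms s')) else [:: [::]].

Lemma size_insertions x s : size (insertions x s) = (size s).+1.
Proof. by elim: s => //= y s IH; rewrite size_map IH. Qed.
End Perms.

Lemma map_insertions (T U : Type) (f : T -> U) x s :
  map (map f) (insertions x s) = insertions (f x) (map f s).
Proof. by elim: s => //= y s IH; rewrite -IH -!map_comp. Qed.

Lemma map_perms (T U : Type) (f : T -> U) s : map (map f) (perms s) = perms (map f s).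
Proof.
elim: s => //= x s IH; rewrite map_flatten -IH -!map_comp; congr flatten.
by apply: eq_map => t /=; rewrite map_insertions.
Qed.

Section PermsEq.
Variable T : eqType.
Implicit Types (s t : seq T).

Lemma mem_insertions (x : T) s1 s2 : s1 ++ x :: s2 \in insertions x (s1 ++ s2).
Proof.
elim: s1 => [|y s1 IH] /=; last by rewrite inE map_f ?orbT.
by case: s2 => [|z s2] /=; rewrite mem_head.
Qed.

Lemma insertionsP (x : T) s t : t \in insertions x s ->
  exists s1 s2, s = s1 ++ s2 /\ t = s1 ++ x :: s2.
Proof.
elim: s t => [|y s IH] t /=; rewrite inE.
  by move/eqP->; exists [::], [::].
case/orP => [/eqP->|/mapP[t' /IH[s1 [s2 [-> ->]]] ->]]; first by exists [::], (y :: s).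
by exists (y :: s1), s2.
Qed.

Lemma mem_perms s t : (t \in perms s) = perm_eq t s.
Proof.
apply/idP/idP.
  elim: s t => [|x s IH] t /=; first by rewrite inE => /eqP->.
  case/flattenP => _ /mapP[t' /IH Ht ->] /insertionsP[s1 [s2 [e ->]]].
  by rewrite -cat1s perm_catCA /= perm_cons -e.
elim: s t => [|x s IH] t /=; first by move/perm_nilP->.
move=> Ht; have xt : x \in t by rewrite (perm_mem Ht) mem_head.
case/path.splitPr: xt Ht => s1 s2 Ht; apply/flattenP; exists (insertions x (s1 ++ s2)).
  by apply: map_f; apply: IH; move: Ht; rewrite -cat1s perm_catCA /= perm_cons.
exact: mem_insertions.
Qed.

Lemma size_perms s : size (perms s) = (size s)`!.
Proof.
elim: s => //= x s IH; rewrite factS mulnC -IH size_flatten /shape -map_comp.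
have : all (fun t => size t == size s) (perms s).
  by apply/allP => t; rewrite mem_perms => /perm_size ->.
elim: (perms s) => //= t l IHl /andP[/eqP st /IHl ->].
by rewrite size_insertions st mulSn.
Qed.

End PermsEq.

(** The values of [f] may repeat, so the comparison is made on positions, where both lists are free
    of duplicates and have size [n!]. *)
Lemma sum_perms_ord (V : nmodType) (T : Type) n (f : 'I_n -> T) (G : seq T -> V) :
  \sum_(t <- perms (map f (enum 'I_n))) G t
  = \sum_(s : 'S_n) G [seq f (s i) | i <- enum 'I_n].
Proof.
rewrite -map_perms big_map.
have P : perm_eq (perms (enum 'I_n)) [seq [seq s i | i <- enum 'I_n] | s : 'S_n <- enum {: 'S_n}].
  have us : uniq [seq [seq s i | i <- enum 'I_n] | s : 'S_n <- enum {: 'S_n}].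
    rewrite map_inj_uniq ?enum_uniq // => s t e; apply/permP => i.
    by move/eq_in_map: e; apply; rewrite mem_enum.
  have sub : {subset [seq [seq s i | i <- enum 'I_n] | s : 'S_n <- enum {: 'S_n}] <= perms (enum 'I_n)}.
    move=> _ /mapP[s _ ->]; rewrite mem_perms; apply: uniq_perm.
    - by rewrite map_inj_uniq ?enum_uniq //; apply: perm_inj.
    - exact: enum_uniq.
    by move=> i; rewrite mem_enum -[i in LHS](permKV s) map_f // mem_enum.
  have sz : size (perms (enum 'I_n)) = size [seq [seq s i | i <- enum 'I_n] | s : 'S_n <- enum {: 'S_n}].
    by rewrite size_perms size_map size_enum_ord -cardE card_Sn.
  have up : uniq (perms (enum 'I_n)) by apply: leq_size_uniq us sub _; rewrite sz.
  rewrite perm_sym; apply: uniq_perm => //.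
  by case: (uniq_min_size us sub); rewrite sz.
rewrite (perm_big _ P) big_map big_enum /=; apply: eq_bigr => s _.
by rewrite -map_comp.
Qed.

Lemma sum_perms_eq (V : nmodType) (T : eqType) (us vs : seq T) (G : seq T -> V) :
  perm_eq us vs -> \sum_(t <- perms us) G t = \sum_(t <- perms vs) G t.
Proof.
move=> P; have sz := perm_size P.
case/(tuple_permP (t := in_tuple vs)): P => p e.
have {}e : us = map (fun i => tnth (in_tuple vs) (p i)) (enum 'I_(size vs)) by rewrite e.
have vsE : vs = map (tnth (in_tuple vs)) (enum 'I_(size vs)).
  by rewrite map_tnth_enum.
rewrite e [in RHS]vsE !sum_perms_ord [RHS](reindex_inj (mulIg p)) /=; apply: eq_bigr => s _.
by congr G; apply: eq_map => i; rewrite permM.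
Qed.

(** An empty word can be inserted at [(size us).+1] places without changing the concatenation: this
    is the effect on a polarized power of setting one variable equal to 1. *)
Lemma sum_perms_nil (V : nmodType) (A : eqType) (us : seq (seq A)) (G : seq A -> V) :
  \sum_(t <- perms ([::] :: us)) G (flatten t) = (\sum_(t <- perms us) G (flatten t)) *+ (size us).+1.
Proof.
rewrite /= big_flatten big_map -sumrMnl.
have H (t : seq (seq A)) : \sum_(t' <- insertions [::] t) G (flatten t') = G (flatten t) *+ (size t).+1.
  elim: t G => [|u t IH] G /=; first by rewrite big_seq1 /= mulr1n.
  by rewrite big_cons big_map /= (IH (fun w => G (u ++ w))) -!mulrS.
rewrite big_seq [RHS]big_seq; apply: eq_bigr => t; rewrite mem_perms => /perm_size e.
by rewrite H e.
Qed.

Section Words.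
Variables (F : fieldType) (m : nat).
Local Notation FG := (grpalg F m).
Implicit Types (g s t : 'S_m) (u w : seq nat).

Definition word_of s : seq nat := [seq val (s i) | i <- enum 'I_m].

Lemma size_word_of s : size (word_of s) = m.
Proof. by rewrite size_map size_enum_ord. Qed.

Lemma nth_word_of s (i : 'I_m) : nth 0%N (word_of s) i = s i.
Proof. by rewrite (nth_map i) ?size_enum_ord // nth_ord_enum. Qed.

Lemma word_of_inj : injective word_of.
Proof. by move=> s t e; apply/permP => i; have := nth_word_of s i; rewrite e nth_word_of => /val_inj. Qed.

Lemma perm_word_of s : perm_eq (word_of s) (iota 0 m).
Proof.
rewrite -val_enum_ord /word_of; have -> : [seq val (s i) | i <- enum 'I_m] = map val (map s (enum 'I_m)).
  exact: map_comp.
apply: perm_map; apply: uniq_perm; rewrite ?enum_uniq ?(map_inj_uniq perm_inj) ?enum_uniq //.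
by move=> i; rewrite mem_enum -[i in LHS](permKV s) map_f // mem_enum.
Qed.

Lemma word_of_surj u : perm_eq u (iota 0 m) -> exists s, word_of s = u.
Proof.
move=> P; have su : size u = m by rewrite (perm_size P) size_iota.
have uu : uniq u by rewrite (perm_uniq P) iota_uniq.
have um (i : 'I_m) : (nth 0%N u i < m)%N.
  by have := mem_nth 0%N (s := u) (n := i); rewrite su ltn_ord (perm_mem P) mem_iota => /(_ isT).
pose f i := Ordinal (um i).
have fi : injective f.
  by move=> i j [] /eqP; rewrite nth_uniq ?su // => /eqP/val_inj.
exists (perm fi); apply: (@eq_from_nth _ 0%N); rewrite size_word_of ?su // => i im.
by rewrite -[i]/(val (Ordinal im)) nth_word_of permE.
Qed.

Definition monom u : FG := [ffun s => (word_of s == u)%:R].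

Lemma monom_word_of s : monom (word_of s) = gelt F s.
Proof. by apply/ffunP => t; rewrite !ffunE (inj_eq word_of_inj). Qed.

Lemma mon0 u : ~~ perm_eq u (iota 0 m) -> monom u = 0.
Proof.
move=> nu; apply/ffunP => s; rewrite !ffunE; case: eqP => // e.
by case/negP: nu; rewrite -e perm_word_of.
Qed.

Definition perm_letter g (k : nat) : nat := if insub k is Some i then val (g i) else k.

Lemma perm_letter_ord g (i : 'I_m) : perm_letter g i = g i.
Proof. by rewrite /perm_letter valK. Qed.

Lemma perm_letterK g : cancel (perm_letter g) (perm_letter g^-1).
Proof.
move=> k; rewrite {2}/perm_letter; case: insubP => [i _ <-|nk]; first by rewrite perm_letter_ord permK.
by rewrite /perm_letter insubN.
Qed.

Lemma perm_letter_inj g : injective (perm_letter g). Proof. exact: can_inj (@perm_letterK g). Qed.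

Lemma wdM s g : word_of (s * g)%g = map (perm_letter g) (word_of s).
Proof. by rewrite /word_of -map_comp; apply: eq_map => i /=; rewrite perm_letter_ord permM. Qed.

Lemma gelt_monom g u : gelt F g * monom u = monom (map (perm_letter g) u).
Proof.
apply/ffunP => s; rewrite geltmulE !ffunE; congr (_%:R).
by rewrite -(inj_eq (inj_map (@perm_letter_inj g))) -wdM mulgKV.
Qed.

Definition Gen u0 (us : seq (seq nat)) u1 : FG :=
  \sum_(t <- perms us) monom (u0 ++ flatten t ++ u1).

Lemma Gen_perm u0 us vs u1 : perm_eq us vs -> Gen u0 us u1 = Gen u0 vs u1.
Proof.
by move=> P; rewrite /Gen (sum_perms_eq _ P).
Qed.

Lemma gelt_Gen g u0 us u1 :
  gelt F g * Gen u0 us u1 = Gen (map (perm_letter g) u0) (map (map (perm_letter g)) us) (map (perm_letter g) u1).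
Proof.
rewrite /Gen mulr_sumr -map_perms big_map; apply: eq_bigr => t _.
by rewrite gelt_monom !map_cat map_flatten.
Qed.

(** The inner words are nonempty because substitutions have no constant term; [u0] or [u1] may be
    empty, standing for an absent outer factor. *)
Definition gdata n u0 (us : seq (seq nat)) u1 : bool :=
  [&& size us == n, all (fun u => u != [::]) us & perm_eq (u0 ++ flatten us ++ u1) (iota 0 m)].

End Words.

(** * The free algebra and T-ideals *)

Section FreeAlgebraTheory.
Variable F : fieldType.
Local Notation ncpoly := (ncpoly F).
Implicit Types (f g h p q : ncpoly) (u v w : seq nat).

Definition mono u : ncpoly := fun w => (w == u)%:R.
Definition nc1 : ncpoly := mono [::].

Lemma ncP f g : (forall w, f w = g w) -> f = g.
Proof. exact: functional_extensionality. Qed.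

Lemma ncmul_nil f g : ncmul f g [::] = f [::] * g [::].
Proof. by rewrite /ncmul big_ord1. Qed.

Lemma ncmul_cons f g x w :
  ncmul f g (x :: w) = f [::] * g (x :: w) + ncmul (fun v => f (x :: v)) g w.
Proof. by rewrite /ncmul big_ord_recl. Qed.

Lemma ncaddA : associative (@ncadd F).
Proof. by move=> f g h; apply: ncP => w; rewrite /ncadd addrA. Qed.
Lemma ncaddC : commutative (@ncadd F).
Proof. by move=> f g; apply: ncP => w; rewrite /ncadd addrC. Qed.
Lemma ncadd0l : left_id (nc0 F) (@ncadd F).
Proof. by move=> f; apply: ncP => w; rewrite /ncadd add0r. Qed.
Lemma ncmulDl : left_distributive (@ncmul F) (@ncadd F).
Proof.
move=> f g h; apply: ncP => w; rewrite /ncadd /ncmul -big_split /=.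
by apply: eq_bigr => i _; rewrite mulrDl.
Qed.
Lemma ncmulDr : right_distributive (@ncmul F) (@ncadd F).
Proof.
move=> f g h; apply: ncP => w; rewrite /ncadd /ncmul -big_split /=.
by apply: eq_bigr => i _; rewrite mulrDr.
Qed.
Lemma ncmul0l : left_zero (nc0 F) (@ncmul F).
Proof. by move=> f; apply: ncP => w; rewrite /ncmul big1 // => i _; rewrite mul0r. Qed.
Lemma ncmul0r : right_zero (nc0 F) (@ncmul F).
Proof. by move=> f; apply: ncP => w; rewrite /ncmul big1 // => i _; rewrite mulr0. Qed.
Lemma ncmulZl a f g : ncmul (ncscale a f) g = ncscale a (ncmul f g).
Proof.
apply: ncP => w; rewrite /ncscale /ncmul mulr_sumr.
by apply: eq_bigr => i _; rewrite mulrA.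
Qed.
Lemma ncmulZr a f g : ncmul f (ncscale a g) = ncscale a (ncmul f g).
Proof.
apply: ncP => w; rewrite /ncscale /ncmul mulr_sumr.
by apply: eq_bigr => i _; rewrite mulrCA.
Qed.

Lemma ncmulA : associative (@ncmul F).
Proof.
move=> f g h; apply: ncP => w; elim: w f g => [|x w IH] f g.
  by rewrite !ncmul_nil mulrA.
rewrite !ncmul_cons IH ncmul_nil mulrDr mulrA -addrA; congr (_ + _).
have -> : (fun v => ncmul f g (x :: v)) =
    ncadd (ncscale (f [::]) (fun v => g (x :: v))) (ncmul (fun v => f (x :: v)) g).
  by apply: ncP => v; rewrite ncmul_cons.
by rewrite ncmulDl ncmulZl.
Qed.

Lemma ncmul_mono u v : ncmul (mono u) (mono v) = mono (u ++ v).
Proof.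
apply: ncP => w; elim: u w => [|x u IH] w /=.
  case: w => [|y w]; first by rewrite ncmul_nil /mono eqxx mul1r.
  rewrite ncmul_cons {1}/mono eqxx mul1r [X in _ + X]big1 ?addr0 // => i _.
  by rewrite mul0r.
case: w => [|y w]; first by rewrite ncmul_nil /mono mul0r.
rewrite ncmul_cons {1}/mono mul0r add0r.
have -> : (fun v => mono (x :: u) (y :: v)) = ncscale (y == x)%:R (mono u).
  by apply: ncP => z; rewrite /mono /ncscale eqseq_cons -natrM mulnb.
by rewrite ncmulZl /ncscale IH /mono eqseq_cons -natrM mulnb.
Qed.

Lemma ncmul1l : left_id nc1 (@ncmul F).
Proof.
move=> f; apply: ncP => - [|x w]; rewrite ?ncmul_nil ?ncmul_cons /nc1 /mono eqxx mul1r //.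
by rewrite /ncmul big1 ?addr0 // => i _; rewrite mul0r.
Qed.
Lemma ncmul1r : right_id nc1 (@ncmul F).
Proof.
move=> f; apply: ncP => w; elim: w f => [|x w IH] f.
  by rewrite ncmul_nil /nc1 /mono mulr1.
by rewrite ncmul_cons IH /nc1 /mono mulr0 add0r.
Qed.

(** Monoid and distributivity laws are enough for the big operators to expand powers of sums, on
    arbitrary coefficient functions. *)
HB.instance Definition _ := Monoid.isComLaw.Build ncpoly (nc0 F) (@ncadd F)
  ncaddA ncaddC ncadd0l.
HB.instance Definition _ := Monoid.isLaw.Build ncpoly nc1 (@ncmul F)
  ncmulA ncmul1l ncmul1r.
HB.instance Definition _ := Monoid.isMulLaw.Build ncpoly (nc0 F) (@ncmul F)
  ncmul0l ncmul0r.
HB.instance Definition _ := Monoid.isAddLaw.Build ncpoly (@ncmul F) (@ncadd F)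
  ncmulDl ncmulDr.

Lemma ncsumE (I : Type) (r : seq I) (P : pred I) (G : I -> ncpoly) w :
  (\big[@ncadd F/nc0 F]_(i <- r | P i) G i) w = \sum_(i <- r | P i) G i w.
Proof. by apply: (big_morph (fun f : ncpoly => f w)). Qed.

Lemma prod_mono (I : Type) (r : seq I) (a : I -> F) (v : I -> seq nat) :
  \big[@ncmul F/nc1]_(i <- r) ncscale (a i) (mono (v i))
  = ncscale (\prod_(i <- r) a i) (mono (flatten (map v r))).
Proof.
elim: r => [|i r IH]; first by rewrite !big_nil; apply: ncP => w; rewrite /ncscale mul1r.
rewrite !big_cons IH ncmulZl ncmulZr ncmul_mono; apply: ncP => w.
by rewrite /ncscale mulrA.
Qed.

Definition ncpow q n := iter n (ncmul q) nc1.

Lemma ncpow_big q n : ncpow q n = \big[@ncmul F/nc1]_(i < n) q.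
Proof. by rewrite big_const_ord. Qed.

Lemma ncpowD q a b : ncpow q (a + b) = ncmul (ncpow q a) (ncpow q b).
Proof. by elim: a => [|a IH]; rewrite /= ?ncmul1l // IH ncmulA. Qed.

Lemma ncpow_sum n l (a : 'I_l -> F) (v : 'I_l -> seq nat) :
  ncpow (\big[@ncadd F/nc0 F]_(k < l) ncscale (a k) (mono (v k))) n =
  \big[@ncadd F/nc0 F]_(h : {ffun 'I_n -> 'I_l})
     ncscale (\prod_i a (h i)) (mono (flatten [seq v (h i) | i <- enum 'I_n])).
Proof.
rewrite ncpow_big bigA_distr_bigA; apply: eq_bigr => h _.
by rewrite prod_mono; congr (ncscale _ (mono (flatten (map _ _)))); rewrite enumT [index_enum _]unlock.
Qed.

Definition finsupp f := exists s : seq (seq nat), forall w, w \notin s -> f w = 0.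

Lemma finsupp_mul f g : finsupp f -> finsupp g -> finsupp (ncmul f g).
Proof.
move=> [s Hs] [t Ht]; exists [seq u ++ v | u <- s, v <- t] => w nw.
rewrite /ncmul big1 // => i _.
case: (boolP (take i w \in s)) => [us|/Hs ->]; last by rewrite mul0r.
case: (boolP (drop i w \in t)) => [ut|/Ht ->]; last by rewrite mulr0.
by case/negP: nw; rewrite -(cat_take_drop i w); apply: allpairs_f.
Qed.

Lemma finsupp_mono u : finsupp (mono u).
Proof. by exists [:: u] => w; rewrite inE /mono => /negPf ->. Qed.

Lemma finsupp_pow q n : finsupp q -> finsupp (ncpow q n).
Proof. by move=> fq; elim: n => [|n IH] /=; [apply: finsupp_mono | apply: finsupp_mul]. Qed.

Lemma ncpoly_mul f g : finsupp f -> is_ncpoly g -> is_ncpoly (ncmul f g).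
Proof.
move=> ff [g0 fg]; split; first by rewrite ncmul_nil g0 mulr0.
exact: finsupp_mul.
Qed.

Lemma ncpoly_mulr f g : is_ncpoly f -> finsupp g -> is_ncpoly (ncmul f g).
Proof.
move=> [f0 ff] fg; split; first by rewrite ncmul_nil f0 mul0r.
exact: finsupp_mul.
Qed.

Lemma ncpoly_pow q n : (0 < n)%N -> is_ncpoly q -> is_ncpoly (ncpow q n).
Proof.
case: n => // n _ qq; rewrite /ncpow /=; apply: ncpoly_mulr => //.
by apply: finsupp_pow; case: qq.
Qed.

Lemma ncpoly_add f g : is_ncpoly f -> is_ncpoly g -> is_ncpoly (ncadd f g).
Proof.
move=> [f0 [s Hs]] [g0 [t Ht]]; split; first by rewrite /ncadd f0 g0 addr0.
by exists (s ++ t) => w; rewrite mem_cat negb_or /ncadd => /andP[/Hs -> /Ht ->]; rewrite addr0.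
Qed.

Lemma ncpoly_scale a f : is_ncpoly f -> is_ncpoly (ncscale a f).
Proof.
move=> [f0 [s Hs]]; split; first by rewrite /ncscale f0 mulr0.
by exists s => w /Hs; rewrite /ncscale => ->; rewrite mulr0.
Qed.

Lemma ncpoly_0 : is_ncpoly (nc0 F).
Proof. by split => //; exists [::]. Qed.

Lemma ncpoly_mono u : u != [::] -> is_ncpoly (mono u).
Proof. by move=> nu; split; [rewrite /mono eq_sym (negPf nu) | apply: finsupp_mono]. Qed.

Inductive ncspan (S : ncpoly -> Prop) : ncpoly -> Prop :=
| ncspan0 : ncspan S (nc0 F)
| ncspanS a g f : S g -> ncspan S f -> ncspan S (ncadd (ncscale a g) f).

Lemma ncspan_add S f g : ncspan S f -> ncspan S g -> ncspan S (ncadd f g).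
Proof.
elim=> [|a h f' Sh _ IH] Hg; first by rewrite ncadd0l.
by rewrite -ncaddA; apply: ncspanS => //; apply: IH.
Qed.

Lemma ncspan_scale S a f : ncspan S f -> ncspan S (ncscale a f).
Proof.
elim=> [|b h f' Sh _ IH].
  have -> : ncscale a (nc0 F) = nc0 F by apply: ncP => w; rewrite /ncscale /nc0 mulr0.
  exact: ncspan0.
have -> : ncscale a (ncadd (ncscale b h) f') = ncadd (ncscale (a * b) h) (ncscale a f').
  by apply: ncP => w; rewrite /ncscale /ncadd mulrDr mulrA.
exact: ncspanS.
Qed.

(** A formal 1 is adjoined as a possible outer factor, so that one shape of product covers an
    element and its left, right and two-sided multiples. *)
Definition unital p := p = nc1 \/ is_ncpoly p.

Lemma unital_finsupp p : unital p -> finsupp p.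
Proof. by case=> [->|[]//]; apply: finsupp_mono. Qed.

Definition Jgen n f := exists p q p', [/\ unital p, is_ncpoly q, unital p' &
  f = ncmul p (ncmul (ncpow q n) p')].

Lemma mono_nseq n : ncpow (mono [:: 0%N]) n = xpow F n.
Proof.
have -> : xpow F n = mono (nseq n 0%N) by apply: ncP => w; rewrite /xpow /mono; case: eqP.
by elim: n => //= n ->; rewrite ncmul_mono.
Qed.

Lemma Jgen_ncpoly n f : (0 < n)%N -> Jgen n f -> is_ncpoly f.
Proof.
move=> n0 [p [q [p' [up qq up' ->]]]]; apply: ncpoly_mul; first exact: unital_finsupp.
by apply: ncpoly_mulr; [apply: ncpoly_pow | apply: unital_finsupp].
Qed.

Lemma unital_endo phi p f : is_endo phi -> unital p -> is_ncpoly f ->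
  exists p', unital p' /\ phi (ncmul p f) = ncmul p' (phi f).
Proof.
move=> [pn pa ps pm] [->|pp] ff; first by exists nc1; rewrite !ncmul1l; split; [left|].
by exists (phi p); rewrite pm //; split; [right; apply: pn|].
Qed.

Lemma unital_endor phi p f : is_endo phi -> unital p -> is_ncpoly f ->
  exists p', unital p' /\ phi (ncmul f p) = ncmul (phi f) p'.
Proof.
move=> [pn pa ps pm] [->|pp] ff; first by exists nc1; rewrite !ncmul1r; split; [left|].
by exists (phi p); rewrite pm //; split; [right; apply: pn|].
Qed.

Lemma unital_mul p f : is_ncpoly p -> unital f -> unital (ncmul p f) /\ unital (ncmul f p).
Proof.
move=> pp [->|ff]; first by rewrite ncmul1l ncmul1r; split; right.
by split; right; apply: ncpoly_mulr => //; [case: ff | case: pp].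
Qed.

Lemma endo_pow phi q n : is_endo phi -> is_ncpoly q -> (0 < n)%N ->
  phi (ncpow q n) = ncpow (phi q) n.
Proof.
move=> pe qq; case: n => // n _; elim: n => [|n IH].
  by rewrite /ncpow /= !ncmul1r.
rewrite [ncpow q _]/(ncmul q (ncpow q n.+1)); case: (pe) => _ _ _ -> //; last exact: ncpoly_pow.
by rewrite IH.
Qed.

(** Multiplication is absorbed by the outer factors, and an endomorphism acts on the base of the
    power. Since it contains [x^n], this span bounds the generated T-ideal from above. *)
Lemma Jspan_Tideal n : (0 < n)%N -> is_Tideal (ncspan (Jgen n)).
Proof.
move=> n0; have allnc f : ncspan (Jgen n) f -> is_ncpoly f.
  elim=> [|a g {}f Jg _ IH]; first exact: ncpoly_0.
  by apply: ncpoly_add => //; apply: ncpoly_scale; apply: Jgen_ncpoly Jg.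
split; first split => //.
- exact: ncspan0.
- exact: ncspan_add.
- exact: ncspan_scale.
- move=> p f pp; elim=> [|a g {}f [p0 [q [p1 [u0 qq u1 ->]]]] _ [IHl IHr]].
    by rewrite ncmul0l ncmul0r; split; apply: ncspan0.
  rewrite ncmulDl ncmulDr ncmulZl ncmulZr; split; apply: ncspanS => //.
    exists (ncmul p p0), q, p1; split => //; last by rewrite !ncmulA.
    exact: (unital_mul pp u0).1.
  exists p0, q, (ncmul p1 p); split => //; last by rewrite !ncmulA.
  exact: (unital_mul pp u1).2.
move=> phi pe f; case: (pe) => pn pa ps pm.
elim=> [|a g {}f Jg Sf IH].
  (* [is_endo] speaks of sums, scalars and products; that zero goes to zero is deduced from scaling
     by 0. *)
  have -> : nc0 F = ncscale 0 (nc0 F) by apply: ncP => w; rewrite /ncscale mul0r.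
  rewrite ps; last exact: ncpoly_0.
  have -> : ncscale 0 (phi (nc0 F)) = nc0 F by apply: ncP => w; rewrite /ncscale mul0r.
  exact: ncspan0.
have gn := Jgen_ncpoly n0 Jg.
rewrite pa ?ps //; [|exact: ncpoly_scale|exact: allnc].
apply: ncspanS => //; case: Jg => p0 [q [p1 [u0 qq u1 ->]]].
have qn := ncpoly_pow n0 qq.
have [p0' [u0' ->]] := unital_endo pe u0 (ncpoly_mulr qn (unital_finsupp u1)).
have [p1' [u1' ->]] := unital_endor pe u1 qn.
by exists p0', (phi q), p1'; rewrite endo_pow //; split => //; apply: pn.
Qed.

Lemma Tideal_gen_Jspan n f : (0 < n)%N -> Tideal_gen (xpow F n) f -> ncspan (Jgen n) f.
Proof.
move=> n0; apply; first exact: Jspan_Tideal.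
have -> : xpow F n = ncadd (ncscale 1 (xpow F n)) (nc0 F).
  by apply: ncP => w; rewrite /ncadd /ncscale /nc0 addr0 mul1r.
apply: ncspanS (ncspan0 _); exists nc1, (mono [:: 0%N]), nc1; split; try by left.
  exact: ncpoly_mono.
by rewrite ncmul1l ncmul1r mono_nseq.
Qed.

(* The endomorphism sending the letter 0 to [q] and every other letter to 0. *)
Definition subst0 q f : ncpoly :=
  fun w => \sum_(k < (size w).+1) f (nseq k 0%N) * ncpow q k w.

(** Without constant term, [q] has order at least 1; this makes the truncation at [size w] in
    [subst0] harmless. *)
Lemma ncpow_small q k w : q [::] = 0 -> (size w < k)%N -> ncpow q k w = 0.
Proof.
move=> q0; elim: k w => // k IH w; rewrite ltnS => wk; rewrite /ncpow /= -/(ncpow q k).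
rewrite /ncmul big1 // => - [[|i] /= il] _; first by rewrite take0 q0 mul0r.
by rewrite IH ?mulr0 // size_drop; lia.
Qed.

Lemma subst0E q f w M : q [::] = 0 -> (size w <= M)%N ->
  subst0 q f w = \sum_(0 <= k < M.+1) f (nseq k 0%N) * ncpow q k w.
Proof.
move=> q0 wM; rewrite /subst0 -(big_mkord xpredT (fun k => f (nseq k 0%N) * ncpow q k w)).
rewrite [RHS](big_cat_nat (n := (size w).+1)) //= [X in _ + X]big_nat_cond [X in _ + X]big1 ?addr0 //.
by move=> k /andP[/andP[wk _] _]; rewrite ncpow_small // mulr0.
Qed.

Lemma subst0_endo q : is_ncpoly q -> is_endo (subst0 q).
Proof.
move=> [q0 fq]; split.
- move=> f [f0 [s Hs]]; split; first by rewrite /subst0 big_ord1 f0 mul0r.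
  pose K := \max_(u <- s) size u.
  (* Only powers up to the length [K] of the longest word in the support of [f] occur, so finitely
     many finite supports suffice. *)
  have [t Ht] : exists t : seq (seq nat), forall k w, (k <= K)%N -> w \notin t -> ncpow q k w = 0.
    elim: K => [|k [t Ht]].
      by have [t Ht] := finsupp_pow 0 fq; exists t => k w; rewrite leqn0 => /eqP ->; apply: Ht.
    have [t' Ht'] := finsupp_pow k.+1 fq; exists (t' ++ t) => l w.
    rewrite leq_eqVlt mem_cat negb_or => /orP[/eqP->|lk] /andP[wt' wt]; first exact: Ht'.
    exact: Ht.
  exists t => w wt; rewrite /subst0 big1 // => k _.
  case: (leqP k K) => [kK|Kk]; first by rewrite Ht ?mulr0.
  rewrite Hs ?mul0r //; apply/negP => ks; move: Kk; rewrite ltnNge => /negP; apply.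
  by rewrite -[X in (X <= _)%N](size_nseq k 0%N); apply: leq_bigmax_seq.
- move=> f g _ _; apply: ncP => w; rewrite /subst0 /ncadd -big_split /=.
  by apply: eq_bigr => k _; rewrite mulrDl.
- move=> a f _; apply: ncP => w; rewrite /subst0 /ncscale mulr_sumr.
  by apply: eq_bigr => k _; rewrite mulrA.
move=> f g _ _; apply: ncP => w; set M := size w.
(* All sums are truncated at the common bound [M]; the terms with [i + j > M] vanish on [w] by
   [ncpow_small], so both sides can be regrouped by [i + j]. *)
have -> : ncmul (subst0 q f) (subst0 q g) w =
    \sum_(0 <= i < M.+1) \sum_(0 <= j < M.+1)
       f (nseq i 0%N) * g (nseq j 0%N) * ncpow q (i + j) w.
  rewrite {1}/ncmul.
  under eq_bigr => k _.
    rewrite (@subst0E q f _ M) ?size_take_min ?geq_minr //.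
    rewrite (@subst0E q g _ M) ?size_drop ?leq_subr //.
    rewrite big_distrlr /=.
    over.
  rewrite exchange_big /=; apply: eq_bigr => i _; rewrite exchange_big /=.
  apply: eq_bigr => j _; rewrite ncpowD /ncmul mulr_sumr; apply: eq_bigr => k _.
  by rewrite mulrACA.
rewrite (@subst0E q _ _ M) //.
have E i : (i < M.+1)%N -> \sum_(0 <= j < M.+1) f (nseq i 0%N) * g (nseq j 0%N) * ncpow q (i + j) w
   = \sum_(0 <= k < M.+1 | (i <= k)%N) f (nseq i 0%N) * g (nseq (k - i) 0%N) * ncpow q k w.
  move=> iM; rewrite (big_cat_nat (n := (M - i).+1)) //=; last by rewrite ltnS leq_subr.
  rewrite [X in _ + X]big_nat_cond [X in _ + X]big1 => [|j /andP[/andP[lj _] _]]; last first.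
    by rewrite ncpow_small ?mulr0 // -/M; lia.
  rewrite addr0 [RHS](big_cat_nat (n := i)) //=; last by rewrite ltnW.
  rewrite [X in _ = X + _]big_nat_cond [X in _ = X + _]big1 => [|j /andP[/andP[_ lj] ij]]; last first.
    by rewrite leqNgt lj in ij.
  rewrite add0r -[X in _ = \sum_(X <= j < _ | _) _]add0n big_addn; have -> : (M.+1 - i = (M - i).+1)%N by lia.
  rewrite [RHS]big_mkcond; apply: eq_bigr => k _; rewrite leq_addl addnK.
  by rewrite [(k + i)%N]addnC.
rewrite [RHS]big_nat_cond.
rewrite [RHS](eq_bigr (fun i => \sum_(0 <= k < M.+1 | (i <= k)%N) f (nseq i 0%N) * g (nseq (k - i) 0%N) * ncpow q k w)); last first.
  by move=> i /andP[/andP[_ iM] _]; rewrite E.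
rewrite -big_nat_cond (exchange_big_dep_nat xpredT) //=.
rewrite big_nat_cond [RHS]big_nat_cond; apply: eq_bigr => k /andP[/andP[_ kM] _].
rewrite /ncmul mulr_suml size_nseq.
rewrite -(big_mkord xpredT (fun i => f (take i (nseq k 0%N)) * g (drop i (nseq k 0%N)) * ncpow q k w)).
rewrite [RHS](big_cat_nat (n := k.+1)) //= [X in _ = _ + X]big_nat_cond.
rewrite [X in _ = _ + X]big1 ?addr0 => [|i /andP[/andP[ki _] ik]]; last by rewrite leqNgt ki in ik.
rewrite [RHS]big_nat_cond big_nat_cond; apply: eq_big => i; first by case: leqP => //=; lia.
move=> /andP[/andP[_ ik] _]; rewrite -ltnS in ik *.
have -> : take i (nseq k 0%N) = nseq i 0%N.
  by rewrite take_nseq.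
by rewrite drop_nseq.
Qed.

End FreeAlgebraTheory.

(** * Multilinear part of the T-ideal *)

(** A finite subfamily either spans or can be extended by one dimension. This makes the span of an
    arbitrary predicate available as a [{vspace}]. *)
Lemma finite_spanning_seq (F : fieldType) (vT : vectType F) (S : vT -> Prop) :
  exists X : seq vT, (forall x, x \in X -> S x) /\ (forall x, S x -> x \in <<X>>%VS).
Proof.
suff H d : (exists X : seq vT, (forall x, x \in X -> S x) /\ (forall x, S x -> x \in <<X>>%VS)) \/
    (exists X : seq vT, (forall x, x \in X -> S x) /\ (d <= \dim <<X>>)%N).
  case: (H (\dim {:vT}).+1) => // - [X [_]]; rewrite ltnNge => /negP[].
  exact: dimvS (subvf _).
elim: d => [|d [H|[X [SX dX]]]]; [by right; exists [::] | by left |].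
case: (classic (forall x, S x -> x \in <<X>>%VS)) => [all|]; first by left; exists X.
case/not_all_ex_not => x nx; have [Sx xX] : S x /\ x \notin <<X>>%VS.
  by split; [apply: NNPP => ns; apply: nx | apply/negP => xX; apply: nx].
right; exists (x :: X); split.
  by move=> y; rewrite inE => /orP[/eqP->|/SX].
rewrite span_cons; apply: leq_ltn_trans dX _; rewrite ltn_neqAle dimvS ?addvSr // andbT.
apply: contra xX => /eqP e; suff -> : (<<X>> = <[x]> + <<X>>)%VS.
  by rewrite (subvP (addvSl _ _)) // memv_line.
by apply/eqP; rewrite eqEdim addvSr e leqnn.
Qed.

Section Bridge.
Variables (F : fieldType) (n m : nat).
Hypothesis F0 : [pchar F] =i pred0.
Hypothesis n0 : (0 < n)%N.
Local Notation FG := (grpalg F m).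
Local Notation ncpoly := (ncpoly F).

Definition isGen (x : FG) := exists u0 us u1, gdata m n u0 us u1 /\ x = Gen F m u0 us u1.

Definition Wspace : {vspace FG} :=
  <<projT1 (constructive_indefinite_description _ (finite_spanning_seq isGen))>>%VS.

Lemma Gen_Wspace u0 us u1 : gdata m n u0 us u1 -> Gen F m u0 us u1 \in Wspace.
Proof.
move=> d; rewrite /Wspace.
case: (constructive_indefinite_description _ _) => X [SX XS] /=.
by apply: XS; exists u0, us, u1.
Qed.

Lemma Wspace_ind (P : FG -> Prop) : P 0 -> (forall a x y, P x -> P y -> P (a *: x + y)) ->
  (forall u0 us u1, gdata m n u0 us u1 -> P (Gen F m u0 us u1)) ->
  forall x, x \in Wspace -> P x.
Proof.
move=> P0 PD PG x; rewrite /Wspace.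
case: (constructive_indefinite_description _ _) => X [SX XS] /=.
move=> xX; rewrite (coord_span (X := in_tuple X) xX).
elim/big_rec: _ => // i y _ Py; apply: PD => //.
have : X`_i \in X by apply: mem_nth.
by case/SX => u0 [us [u1 [d ->]]]; apply: PG.
Qed.

Lemma Gen_mem (V : {vspace FG}) u0 us u1 : size us = n -> all (fun u => u != [::]) us ->
  (gdata m n u0 us u1 -> Gen F m u0 us u1 \in V) -> Gen F m u0 us u1 \in V.
Proof.
move=> sz ne H; case: (boolP (perm_eq (u0 ++ flatten us ++ u1) (iota 0 m))) => P.
  by apply: H; rewrite /gdata sz eqxx ne.
rewrite /Gen big_seq rpred_sum // => t; rewrite mem_perms => Pt.
rewrite mon0 ?mem0v //; apply: contra P => P; apply: perm_trans P.
by rewrite perm_cat2l perm_cat2r perm_flatten // perm_sym.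
Qed.

Definition to_grpalg (f : ncpoly) : FG := [ffun s => f (word_of s)].
Definition of_grpalg (x : FG) : ncpoly := fun w => \sum_s x s * mono F (word_of s) w.

Lemma to_grpalgK f : Vm m f -> of_grpalg (to_grpalg f) = f.
Proof.
move=> Vf; apply: ncP => w; rewrite /of_grpalg; case: (boolP (perm_eq w (iota 0 m))) => [P|nP].
  have [s <-] := word_of_surj P; rewrite (bigD1 s) //= big1 ?addr0 => [|t ts].
    by rewrite ffunE /mono eqxx mulr1.
  by rewrite /mono (inj_eq (@word_of_inj m)) eq_sym (negPf ts) mulr0.
rewrite big1 ?Vf // => s _; rewrite /mono; case: eqP => [e|_]; last by rewrite mulr0.
by rewrite e perm_word_of in nP.
Qed.

Lemma of_grpalgK x : to_grpalg (of_grpalg x) = x.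
Proof.
apply/ffunP => s; rewrite ffunE /of_grpalg (bigD1 s) //= big1 ?addr0 => [|t ts].
  by rewrite /mono eqxx mulr1.
by rewrite /mono (inj_eq (@word_of_inj m)) eq_sym (negPf ts) mulr0.
Qed.

Lemma of_grpalg_Vm x : Vm m (of_grpalg x).
Proof.
move=> w nP; rewrite /of_grpalg big1 // => s _; rewrite /mono; case: eqP => [e|_]; last by rewrite mulr0.
by rewrite e perm_word_of in nP.
Qed.

Lemma of_grpalgD a x y : of_grpalg (a *: x + y) = ncadd (ncscale a (of_grpalg x)) (of_grpalg y).
Proof.
apply: ncP => w; rewrite /ncadd /ncscale /of_grpalg mulr_sumr -big_split /=.
by apply: eq_bigr => s _; rewrite !ffunE mulrDl mulrA.
Qed.

Lemma to_grpalgD a f g : to_grpalg (ncadd (ncscale a f) g) = a *: to_grpalg f + to_grpalg g.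
Proof. by apply/ffunP => s; rewrite !ffunE. Qed.

Lemma to_grpalg_sum (I : Type) (r : seq I) (P : pred I) (G : I -> ncpoly) :
  to_grpalg (\big[@ncadd F/nc0 F]_(i <- r | P i) G i) = \sum_(i <- r | P i) to_grpalg (G i).
Proof.
apply/ffunP => s; rewrite ffunE ncsumE sum_ffunE.
by apply: eq_bigr => i _; rewrite ffunE.
Qed.

Lemma to_grpalg_scale a f : to_grpalg (ncscale a f) = a *: to_grpalg f.
Proof. by apply/ffunP => s; rewrite !ffunE. Qed.

Lemma to_grpalg_mono u : to_grpalg (mono F u) = monom F m u.
Proof. by apply/ffunP => s; rewrite !ffunE. Qed.

(** Expanding the power gives a sum over index functions that is unchanged when the [n] factors are
    permuted. Averaging over [S_n] turns each term into a generator, at the cost of dividing by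
    [n!]. *)
Lemma to_grpalg_pow_mem (V : {vspace FG}) l (a : 'I_l -> F) (v : 'I_l -> seq nat) u0 u1 :
  (forall k, v k != [::]) ->
  (forall u0 us u1, gdata m n u0 us u1 -> Gen F m u0 us u1 \in V) ->
  to_grpalg (ncmul (mono F u0) (ncmul
    (ncpow (\big[@ncadd F/nc0 F]_(k < l) ncscale (a k) (mono F (v k))) n) (mono F u1))) \in V.
Proof.
move=> vne VG; rewrite ncpow_sum big_distrl big_distrr /= to_grpalg_sum.
pose X (us : seq (seq nat)) := monom F m (u0 ++ flatten us ++ u1).
rewrite (eq_bigr (fun h : {ffun 'I_n -> 'I_l} =>
   (\prod_i a (h i)) *: X [seq v (h i) | i <- enum 'I_n])); last first.
  by move=> h _; rewrite ncmulZl ncmulZr to_grpalg_scale !ncmul_mono to_grpalg_mono.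
set Sm := \sum_h _.
have E (s : 'S_n) : Sm = \sum_(h : {ffun 'I_n -> 'I_l})
   (\prod_i a (h i)) *: X [seq v (h (s i)) | i <- enum 'I_n].
  pose fs (t : 'S_n) (h : {ffun 'I_n -> 'I_l}) := [ffun i => h (t i)].
  have fsK : cancel (fs s) (fs s^-1%g).
    by move=> h; apply/ffunP => i; rewrite !ffunE permKV.
  rewrite /Sm (reindex_inj (can_inj fsK)) /=; apply: eq_bigr => h _; congr (_ *: X _).
    rewrite [RHS](reindex_inj (@perm_inj _ s)) /=; by apply: eq_bigr => i _; rewrite ffunE.
  by apply: eq_map => i; rewrite ffunE.
have nf0 : (n`!)%:R != 0 :> F by rewrite (natF_eq0 F0) -lt0n fact_gt0.
suff : (n`!)%:R *: Sm \in V by rewrite rpredZeq (negPf nf0).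
have -> : (n`!)%:R *: Sm = \sum_(h : {ffun 'I_n -> 'I_l})
    (\prod_i a (h i)) *: Gen F m u0 [seq v (h i) | i <- enum 'I_n] u1.
  rewrite -card_Sn scaler_nat -sumr_const (eq_bigr _ (fun s _ => E s)) exchange_big /=.
  apply: eq_bigr => h _; rewrite -scaler_sumr; congr (_ *: _).
  by rewrite /Gen sum_perms_ord.
apply: rpred_sum => h _; rewrite rpredZ //; apply: Gen_mem; last exact: VG.
  by rewrite size_map size_enum_ord.
by apply/allP => _ /mapP[i _ ->].
Qed.

Lemma finsupp_sum (f : ncpoly) : finsupp f -> exists l (v : 'I_l -> seq nat),
  f = \big[@ncadd F/nc0 F]_(k < l) ncscale (f (v k)) (mono F (v k)) /\
  (f [::] = 0 -> forall k, v k != [::]).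
Proof.
case=> s Hs; pose s' := [seq u <- undup s | f u != 0].
exists (size s'), (fun k => nth [::] s' k); split; last first.
  move=> f0 k; have : nth [::] s' k \in s' by apply: mem_nth.
  by rewrite mem_filter => /andP[nz _]; apply: contraNneq nz => ->; rewrite f0.
rewrite -(big_mkord xpredT (fun k => ncscale (f (nth [::] s' k)) (mono F (nth [::] s' k)))).
rewrite -(big_nth [::] xpredT (fun u => ncscale (f u) (mono F u))).
apply: ncP => w; rewrite ncsumE; case: (boolP (w \in s')) => ws.
  rewrite (bigD1_seq w) //= ?filter_uniq ?undup_uniq // /ncscale /mono eqxx mulr1.
  by rewrite big1 ?addr0 // => u uw; rewrite eq_sym (negPf uw) mulr0.
rewrite big_seq big1 => [|u us]; last first.
  rewrite /ncscale /mono; case: eqP => [e|_]; last by rewrite mulr0.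
  by rewrite e us in ws.
apply/eqP; apply: contraNT ws => nz; rewrite mem_filter nz mem_undup /=.
by apply: contraNT nz => /Hs ->.
Qed.

Lemma Jgen_to_grpalg (V : {vspace FG}) f :
  (forall u0 us u1, gdata m n u0 us u1 -> Gen F m u0 us u1 \in V) ->
  Jgen n f -> to_grpalg f \in V.
Proof.
move=> VG [p0 [q [p1 [/unital_finsupp/finsupp_sum[l0 [v0 [E0 _]]] qq
  /unital_finsupp/finsupp_sum[l1 [v1 [E1 _]]] ->]]]].
case: (qq) => q0 /finsupp_sum[l [v [E /(_ q0) ne]]].
rewrite E0 E1 big_distrl /= to_grpalg_sum rpred_sum // => i _.
rewrite big_distrr /= big_distrr /= to_grpalg_sum rpred_sum // => j _.
rewrite ncmulZl ncmulZr ncmulZr !to_grpalg_scale !rpredZ // [q]E.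
exact: to_grpalg_pow_mem.
Qed.

(** Inclusion and exclusion over the subsets of the words: only the index functions that use all [n]
    words survive, and those are permutations. *)
Lemma polarization (u : 'I_n -> seq nat) :
  \big[@ncadd F/nc0 F]_(s : 'S_n) mono F (flatten [seq u (s i) | i <- enum 'I_n]) =
  \big[@ncadd F/nc0 F]_(S : {set 'I_n}) ncscale ((-1) ^+ #|~: S|)
    (ncpow (\big[@ncadd F/nc0 F]_(k < n) ncscale (k \in S)%:R (mono F (u k))) n).
Proof.
apply: ncP => w; rewrite !ncsumE.
under [RHS]eq_bigr => S _ do rewrite ncpow_sum /ncscale ncsumE mulr_sumr.
rewrite exchange_big /=.
have E (h : {ffun 'I_n -> 'I_n}) : \sum_(S : {set 'I_n}) (-1) ^+ #|~: S| * \prod_i (h i \in S)%:R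
    = (injectiveb h)%:R :> F.
  pose im (j : 'I_n) := [exists i, h i == j].
  have -> : injectiveb h = [forall j, im j].
    apply/injectiveP/forallP => [inj j|sur].
      by apply/existsP; have [g _ hg] := injF_bij inj; exists (g j); rewrite hg.
    have : codom h =i predT.
      move=> j; have /existsP[i /eqP <-] := sur j; rewrite codom_f; by [].
    move=> cd; apply/injectiveP; rewrite /injectiveb /dinjectiveb.
    apply/card_uniqP; rewrite (eq_card cd) size_map -cardE; by [].
  (* The signed sum over subsets factors over the words; a word missed by [h] contributes a factor
     0, a word that is hit a factor 1. *)
  transitivity (\prod_(j : 'I_n) (1 + - (~~ im j)%:R) : F).
    rewrite bigA_distr /=; apply: eq_bigr => S _.
    rewrite [RHS](bigID (mem S)) /= [X in _ = X * _]big1 ?mul1r => [|j ->] //.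
    rewrite [RHS](eq_bigr (fun j => (-1) * (~~ im j)%:R)); last first.
      by move=> j /negPf ->; rewrite mulN1r.
    rewrite [RHS]big_split /= prodr_const; congr (_ ^+ _ * _); first by apply: eq_card => j; rewrite !inE.
    case: (boolP [forall i, h i \in S]) => [/forallP hS|]; last first.
      rewrite negb_forall => /existsP[i hi]; rewrite (bigD1 i) //= (negPf hi) mul0r.
      rewrite (bigD1 (h i)) //=; have -> : im (h i) by apply/existsP; exists i.
      by rewrite mul0r.
    rewrite !big1 // => j; last by rewrite hS.
    move=> jS; have -> // : ~~ im j.
    by apply/existsP => - [i /eqP e]; rewrite -e hS in jS.
  case: (boolP [forall j, im j]) => [/forallP H|].
    by rewrite big1 // => j _; rewrite H /= oppr0 addr0.
  rewrite negb_forall => /existsP[j nj]; rewrite (bigD1 j) //= nj subrr mul0r; by [].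
rewrite (eq_bigr (fun h : {ffun 'I_n -> 'I_n} => (injectiveb h)%:R * mono F (flatten [seq u (h i) | i <- enum 'I_n]) w)); last first.
  by move=> h _; rewrite -E mulr_suml; apply: eq_bigr => S _; rewrite mulrA.
rewrite (bigID (fun h : {ffun _} => injectiveb h)) /= [X in _ = _ + X]big1 ?addr0; last first.
  by move=> h /negPf ->; rewrite mul0r.
rewrite (reindex (fun s => pval s)) /=; last first.
  pose s1 : 'S_n := 1%g.
  by exists (insubd s1) => h Hh; rewrite ?insubdK ?valKd.
apply: eq_big => [s|s _]; first by rewrite (valP s).
by rewrite (valP s) mul1r; congr (mono _ (flatten _) _); apply: eq_map => i; rewrite pvalE.
Qed.

Lemma Tideal_Gen u0 us u1 : gdata m n u0 us u1 ->
  Tideal_gen (xpow F n) (of_grpalg (Gen F m u0 us u1)).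
Proof.
case/and3P => /eqP sz ne P I TI Ix.
case: (TI) => - [Inc I0 Iadd Iscale Imul] Iendo.
pose u (i : 'I_n) := nth [::] us i.
have usE : us = map u (enum 'I_n).
  apply: (@eq_from_nth _ [::]); first by rewrite size_map size_enum_ord.
  move=> i; rewrite sz => il; rewrite (nth_map (Ordinal il)) ?size_enum_ord //.
  by rewrite /u -[i]/(val (Ordinal il)) nth_ord_enum.
pose Pn := \big[@ncadd F/nc0 F]_(s : 'S_n) mono F (flatten [seq u (s i) | i <- enum 'I_n]).
have IP : I Pn.
  rewrite /Pn polarization; apply: big_ind => // S _; apply: Iscale.
  set q := \big[_/_]_(k < n) _.
  have nq : is_ncpoly q.
    apply: big_ind; [exact: ncpoly_0 | exact: ncpoly_add|].
    move=> k _; apply: ncpoly_scale; apply: ncpoly_mono.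
    by apply: (allP ne); apply: mem_nth; rewrite sz.
  have -> : ncpow q n = subst0 q (xpow F n).
    have [q0 fq] := nq; apply: ncP => w.
    (* The bound [size w + n] keeps the index [n], the only one where [xpow] is nonzero, inside the
       sum. *)
    rewrite (@subst0E _ q _ w (size w + n)) ?leq_addr //.
    rewrite big_mkord (bigD1 (inord n)) //= inordK ?ltnS ?leq_addl //.
    rewrite {1}/xpow eqxx mul1r big1 ?addr0 // => k kn; rewrite /xpow.
    case: eqP => [/(congr1 size)|_]; last by rewrite mul0r.
    rewrite !size_nseq => e; case/eqP: kn; apply: val_inj; rewrite /= inordK //.
    by rewrite ltnS leq_addl.
  by apply: Iendo => //; apply: subst0_endo.
have -> : of_grpalg (Gen F m u0 us u1) = ncmul (mono F u0) (ncmul Pn (mono F u1)).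
  have -> : Gen F m u0 us u1 = to_grpalg (ncmul (mono F u0) (ncmul Pn (mono F u1))).
    rewrite /Pn big_distrl big_distrr /= to_grpalg_sum /Gen usE sum_perms_ord.
    by apply: eq_bigr => s _; rewrite !ncmul_mono to_grpalg_mono.
  rewrite to_grpalgK // => w nw; rewrite /Pn big_distrl big_distrr /= ncsumE big1 // => s _.
  rewrite !ncmul_mono /mono; case: eqP => // e; case/negP: nw; rewrite e.
  apply: perm_trans P; rewrite perm_cat2l perm_cat2r perm_flatten //.
  rewrite usE (map_comp u s); apply: perm_map; apply: uniq_perm.
  - by rewrite map_inj_uniq ?enum_uniq //; apply: perm_inj.
  - exact: enum_uniq.
  by move=> i; rewrite mem_enum -[i in LHS](permKV s) map_f // mem_enum.
have IP1 : I (ncmul Pn (mono F u1)).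
  case: (eqVneq u1 [::]) => [->|ne1]; first by rewrite ncmul1r.
  by apply: (Imul _ _ _ IP).2; apply: ncpoly_mono.
case: (eqVneq u0 [::]) => [->|ne0]; first by rewrite ncmul1l.
by apply: (Imul _ _ _ IP1).1; apply: ncpoly_mono.
Qed.

Lemma WnmP f : Wnm n m f <-> Vm m f /\ to_grpalg f \in Wspace.
Proof.
split=> [[Vf /(Tideal_gen_Jspan n0) Jf]|[Vf Wf]].
  split=> //; elim: Jf {Vf} => [|a g {}f Jg _ IH].
    have -> : to_grpalg (nc0 F) = 0 by apply/ffunP => s; rewrite !ffunE.
    exact: mem0v.
  rewrite to_grpalgD rpredD // rpredZ //.
  by apply: (Jgen_to_grpalg _ Jg) => u0 us u1; apply: Gen_Wspace.
split=> //; rewrite -(to_grpalgK Vf); move: (to_grpalg f) Wf.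
apply: (Wspace_ind (P := fun x => Tideal_gen (xpow F n) (of_grpalg x))).
- move=> I [[_ I0 _ _ _] _] _; suff -> : of_grpalg 0 = nc0 F by [].
  by apply: ncP => w; rewrite /of_grpalg big1 // => s _; rewrite ffunE mul0r.
- move=> a x y Hx Hy; rewrite of_grpalgD; move=> I TI Ip; case: (TI) => - [_ _ Iadd Iscale _] _.
  by apply: Iadd; [apply: Iscale; apply: Hx | apply: Hy].
exact: Tideal_Gen.
Qed.

End Bridge.

(** The inclusion is taken from the T-ideals, where [x^(n+1)] is visibly a multiple of [x^n],
    instead of being derived from the generators. *)
Lemma Wspace_mono (F : fieldType) (F0 : [pchar F] =i pred0) n m :
  (0 < n)%N -> (Wspace F n.+1 m <= Wspace F n m)%VS.
Proof.
move=> n0; apply/subvP => x Wx.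
have [_ H] : Wnm n m (of_grpalg x).
  have /(WnmP _ F0)[] // : Vm m (of_grpalg x) /\ to_grpalg m (of_grpalg x) \in Wspace F n.+1 m.
    by rewrite of_grpalgK; split => //; apply: of_grpalg_Vm.
  move=> Vx Tx; split=> // I TI Ip; apply: Tx => //.
  case: (TI) => - [_ _ _ _ Imul] _.
  have -> : xpow F n.+1 = ncmul (mono F [:: 0%N]) (xpow F n) by rewrite -!mono_nseq.
  by apply: (Imul _ _ _ Ip).1; apply: ncpoly_mono.
have /(WnmP _ F0)[] // : Wnm n m (of_grpalg x) by split => //; apply: of_grpalg_Vm.
by rewrite of_grpalgK.
Qed.

(** * Deleting a letter *)

Lemma perm_perm_letter m (g : 'S_m) u : perm_eq u (iota 0 m) -> perm_eq (map (perm_letter g) u) (iota 0 m).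
Proof. by case/word_of_surj => s <-; rewrite -wdM perm_word_of. Qed.

Lemma gdata_perm_letter m n (g : 'S_m) u0 us u1 : gdata m n u0 us u1 ->
  gdata m n (map (perm_letter g) u0) (map (map (perm_letter g)) us) (map (perm_letter g) u1).
Proof.
case/and3P => sz ne P; apply/and3P; split; first by rewrite size_map.
  by apply/allP => _ /mapP[u /(allP ne) + ->]; case: u.
by rewrite -map_flatten -!map_cat perm_perm_letter.
Qed.

Lemma Wspace_stable F n m : stable (Wspace F n m).
Proof.
move=> g; apply: Wspace_ind => [|a x y Hx Hy|u0 us u1 d]; first by rewrite mulr0 mem0v.
  by rewrite mulrDr -scalerAr rpredD // rpredZ.
by rewrite gelt_Gen; apply: Gen_Wspace; apply: gdata_perm_letter.
Qed.

Section Deletion.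
Local Open Scope nat_scope.

(* Sets the variable 0 equal to 1 and shifts the remaining letters down. *)
Definition del (u : seq nat) : seq nat := [seq k.-1 | k <- u & k != 0].
Definition up (u : seq nat) : seq nat := map S u.

Lemma del_cat u v : del (u ++ v) = del u ++ del v.
Proof. by rewrite /del filter_cat map_cat. Qed.

Lemma del_flatten us : del (flatten us) = flatten (map del us).
Proof. by elim: us => //= u us IH; rewrite del_cat IH. Qed.

Lemma upK u : del (up u) = u.
Proof. by elim: u => //= k u IH; rewrite /del /= -/(del _) -{2}IH. Qed.

Lemma del_iota m : del (iota 0 m.+1) = iota 0 m.
Proof. by rewrite /= -[1]/(1 + 0) iotaDl; have := upK (iota 0 m). Qed.

Lemma perm_del m u : perm_eq u (iota 0 m.+1) -> perm_eq (del u) (iota 0 m).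
Proof. by move=> P; rewrite -del_iota; apply: perm_map; apply: perm_filter. Qed.

Lemma perm_up m u v w : perm_eq (u ++ v ++ w) (iota 0 m) ->
  perm_eq (up u ++ (0 :: up v) ++ up w) (iota 0 m.+1).
Proof.
move=> P; rewrite /= -cat1s perm_catCA /= perm_cons -!map_cat.
by rewrite -[1]/(1 + 0) iotaDl; apply: perm_map.
Qed.

Lemma del_nil u : uniq u -> u != [::] -> del u = [::] -> u = [:: 0].
Proof.
case: u => [|[|k] [|l u]] //=; rewrite inE negb_or => /andP[/andP[n0 _] _] _.
by rewrite /del /= eq_sym n0.
Qed.

Lemma gdata_uniq m n u0 us u1 : gdata m n u0 us u1 -> uniq (u0 ++ flatten us ++ u1).
Proof. by case/and3P => _ _ P; rewrite (perm_uniq P) iota_uniq. Qed.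

Lemma uniq_flatten_mem (us : seq (seq nat)) u : uniq (flatten us) -> u \in us -> uniq u.
Proof.
elim: us => //= v us IH; rewrite cat_uniq inE => /and3P[uv _ uus] /orP[/eqP->|] //; exact: IH.
Qed.

End Deletion.

Section DeletionMap.
Variables (F : fieldType) (m : nat).
Hypothesis F0 : [pchar F] =i pred0.
Local Notation FG := (grpalg F m).
Local Notation FG1 := (grpalg F m.+1).

Definition dfun (x : FG1) : FG := \sum_s x s *: monom F m (del (word_of s)).

Fact dfun_linear : linear dfun.
Proof.
move=> a x y; rewrite /dfun scaler_sumr -big_split /=; apply: eq_bigr => s _.
by rewrite !ffunE scalerDl scalerA.
Qed.
HB.instance Definition _ := GRing.isLinear.Build F FG1 FG _ dfun dfun_linear.

Definition dmap : 'Hom(FG1, FG) := linfun dfun.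

Lemma dmap_gelt s : dmap (gelt F s) = monom F m (del (word_of s)).
Proof.
rewrite lfunE /= /dfun (bigD1 s) //= ffunE eqxx scale1r big1 ?addr0 // => t ts.
by rewrite ffunE (negPf ts) scale0r.
Qed.

Lemma dmap_monom u : perm_eq u (iota 0 m.+1) -> dmap (monom F m.+1 u) = monom F m (del u).
Proof. by case/word_of_surj => s <-; rewrite monom_word_of dmap_gelt. Qed.

Lemma dmap_Gen u0 us u1 : perm_eq (u0 ++ flatten us ++ u1) (iota 0 m.+1) ->
  dmap (Gen F m.+1 u0 us u1) = Gen F m (del u0) (map del us) (del u1).
Proof.
move=> P; rewrite /Gen linear_sum /= -map_perms big_map big_seq [RHS]big_seq.
apply: eq_bigr => t; rewrite mem_perms => Pt; rewrite dmap_monom ?del_cat ?del_flatten //.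
by apply: perm_trans P; rewrite perm_cat2l perm_cat2r perm_flatten.
Qed.

Lemma dmap_lift (g : 'S_m) x : dmap (gelt F (lift_perm ord0 ord0 g) * x) = gelt F g * dmap x.
Proof.
have := @mul_fg_sum _ _ (gelt F (lift_perm ord0 ord0 g)) 1 x; rewrite mulr1 => ->.
have := @fg_sum _ _ x => {2}->; rewrite !linear_sum /= mulr_sumr; apply: eq_bigr => s _.
rewrite !linearZ /= mulr1 -scalerAr geltM !dmap_gelt gelt_monom wdM; congr (_ *: monom _ _ _).
rewrite /del; elim: (word_of s) => //= k u IH.
have -> : perm_letter (lift_perm ord0 ord0 g) k = if k is k'.+1 then (perm_letter g k').+1 else 0%N.
  case: k => [|k]; first by rewrite -[0%N]/(val (@ord0 m)) perm_letter_ord lift_perm_id.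
  case: (ltnP k m) => km.
    have -> : k.+1 = lift ord0 (Ordinal km) by [].
    rewrite perm_letter_ord lift_perm_lift /=; by rewrite -[k]/(val (Ordinal km)) perm_letter_ord.
  by rewrite /perm_letter !insubN // -leqNgt.
by case: k => [|k] //=; rewrite IH.
Qed.

(* The row coloring of a tableau whose first row gains the new letter 0. *)
Definition cshift (r : 'I_m -> nat) : 'I_m.+1 -> nat :=
  fun i => if unlift ord0 i is Some j then r j else 0%N.

Lemma cshift0 r : cshift r ord0 = 0%N. Proof. by rewrite /cshift unlift_none. Qed.
Lemma cshiftS r j : cshift r (lift ord0 j) = r j. Proof. by rewrite /cshift liftK. Qed.

Lemma sum_stab_lift (r : 'I_m -> nat) :
  \sum_(g | cstab (cshift r) g && (g ord0 == ord0)) gelt F g =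
  \sum_(g | cstab r g) gelt F (lift_perm ord0 ord0 g).
Proof.
pose L (g : 'S_m) : 'S_m.+1 := lift_perm ord0 ord0 g.
have Li : injective L.
  move=> g h e; apply/permP => i; apply: (@lift_inj _ ord0).
  by rewrite -!(lift_perm_lift ord0) -/(L g) -/(L h) e.
rewrite (eq_bigl (mem [set L g | g in [set g | cstab r g]])).
  rewrite big_imset /=; last by move=> g h _ _; apply: Li.
  by apply: eq_bigl => g; rewrite inE.
move=> g; apply/andP/imsetP => [[/cstabP sg /eqP g0]|[h]].
  pose f (k : 'I_m) := odflt k (unlift ord0 (g (lift ord0 k))).
  have fE k : lift ord0 (f k) = g (lift ord0 k).
    have : ord0 != g (lift ord0 k).
      by rewrite -{1}g0 (inj_eq perm_inj) neq_lift.
    by case/unlift_some => j e1 e2; rewrite /f e2 e1.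
  have fi : injective f.
    by move=> i j e; apply: (@lift_inj _ ord0); apply: (@perm_inj _ g); rewrite -!fE e.
  exists (perm fi).
    by rewrite inE; apply/cstabP => i; rewrite permE -cshiftS fE sg cshiftS.
  apply/permP => i; case: (unliftP ord0 i) => [j ->|->].
    by rewrite lift_perm_lift permE fE.
  by rewrite lift_perm_id.
rewrite inE => /cstabP sh ->; split; last by rewrite lift_perm_id.
apply/cstabP => i; case: (unliftP ord0 i) => [j ->|->]; last by rewrite lift_perm_id.
by rewrite lift_perm_lift !cshiftS sh.
Qed.

(** Decomposition at the letter 0: the permutations fixing it pass through the deletion, the coset
    representatives stay inside. *)
Lemma dmap_csym r x : dmap (csym F (cshift r) * x) =
  csym F r * \sum_(i | cshift r i == 0%N) dmap (gelt F (tperm i ord0) * x).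
Proof.
rewrite (csym_decomp F (cshift r) ord0) cshift0 sum_stab_lift -mulrA mulr_suml linear_sum /=.
under eq_bigr do rewrite dmap_lift.
by rewrite -mulr_suml [X in _ * dmap X]mulr_suml linear_sum.
Qed.

(** The transpositions of [dmap_csym] exchange points of color 0 for [cshift r'] too, so they fix
    [x]. It is meant for [r'] obtained from [r] by raising a box. *)
Lemma dmap_csym_cinv r r' x : (forall i, r i = 0%N -> r' i = 0%N) -> cinv (cshift r') x ->
  dmap (csym F (cshift r) * x) = #|[pred i | cshift r i == 0%N]|%:R *: (csym F r * dmap x).
Proof.
move=> H ix; rewrite dmap_csym (eq_bigr (fun _ => dmap x)) => [|i /eqP ri].
  by rewrite sumr_const -scaler_nat scalerAr.
rewrite ix //; apply: cstab_tperm; rewrite cshift0; move: ri.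
by case: (unliftP ord0 i) => [j ->|->]; rewrite ?cshift0 // !cshiftS => /H.
Qed.

Lemma gdata_del n u0 us u1 : gdata m.+1 n u0 us u1 -> [:: 0%N] \notin us ->
  gdata m n (del u0) (map del us) (del u1).
Proof.
move=> d n0; have ud := gdata_uniq d; case/and3P: d => sz ne P; apply/and3P; split.
- by rewrite size_map.
- apply/allP => _ /mapP[u uus ->]; apply: contra n0 => /eqP e.
  rewrite -(@del_nil u) //; last exact: (allP ne).
  apply: (uniq_flatten_mem _ uus); move: ud; rewrite cat_uniq => /and3P[_ _].
  by rewrite cat_uniq => /and3P[].
by rewrite -del_flatten -!del_cat perm_del.
Qed.

Lemma dmap_Gen_notin n u0 us u1 : gdata m.+1 n u0 us u1 -> [:: 0%N] \notin us ->
  dmap (Gen F m.+1 u0 us u1) \in Wspace F n m.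
Proof.
move=> d n0; rewrite dmap_Gen; last by case/and3P: d.
by apply: Gen_Wspace; apply: gdata_del.
Qed.

Lemma Gen_nil u0 us u1 : Gen F m u0 ([::] :: us) u1 = (size us).+1%:R *: Gen F m u0 us u1.
Proof.
by rewrite /Gen (sum_perms_nil us (fun w => monom F m (u0 ++ w ++ u1))) scaler_nat.
Qed.

(** If 0 is a word by itself, deletion empties that word and leaves a multiple of a generator with
    [n] words. Otherwise all [n + 1] words survive, and [Wspace_mono] applies. *)
Lemma dmap_Wspace n x : (0 < n)%N -> x \in Wspace F n.+1 m.+1 -> dmap x \in Wspace F n m.
Proof.
move=> n0; move: x; apply: Wspace_ind => [|a x y Hx Hy|u0 us u1 d].
- by rewrite linear0 mem0v.
- by rewrite linearP rpredD // rpredZ.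
case: (boolP ([:: 0%N] \in us)) => [zin|znot]; last first.
  by apply: (subvP (Wspace_mono F0 m n0)); apply: dmap_Gen_notin.
have P := perm_to_rem zin; set us' := rem _ us in P.
rewrite (Gen_perm F m.+1 u0 u1 P).
have d' : gdata m.+1 n.+1 u0 ([:: 0%N] :: us') u1.
  case/and3P: d => sz ne Pd; apply/and3P; split; first by rewrite -(perm_size P).
    by rewrite -(perm_all _ P).
  by apply: perm_trans Pd; rewrite perm_cat2l perm_cat2r perm_flatten // perm_sym.
have ud := gdata_uniq d'; case/and3P: (d') => /eqP sz ne Pd.
rewrite dmap_Gen //= Gen_nil rpredZ //; apply: Gen_Wspace; apply/and3P; split.
- by move: sz; rewrite size_map => -[->].
- apply/allP => _ /mapP[u uus ->]; apply/eqP => e.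
  have unil : u != [::] by apply: (allP ne); rewrite inE uus orbT.
  move: ud; rewrite cat_uniq => /and3P[_ _]; rewrite cat_uniq => /and3P[+ _ _].
  rewrite /= => /andP[nz uf].
  have u0E := del_nil (uniq_flatten_mem uf uus) unil e.
  by case/negP: nz; apply/flattenP; exists u => //; rewrite u0E mem_head.
- by have := perm_del Pd; rewrite !del_cat del_flatten.
Qed.

Lemma perm_letter_tperm_id (i : 'I_m.+1) k : k != val i -> k != 0%N -> perm_letter (tperm i ord0) k = k.
Proof.
move=> ki k0; rewrite /perm_letter; case: insubP => // j _ e; rewrite tpermD //.
  by apply: contraNneq ki => ->; rewrite e.
by apply: contraNneq k0 => e0; rewrite -e -e0.
Qed.

Lemma map_perm_letter_up (z : 'I_m) u : val z \notin u ->
  map (perm_letter (tperm (lift ord0 z) ord0)) (up u) = up u.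
Proof.
move=> zu; rewrite -[RHS]map_id; apply/eq_in_map => k /mapP[j ju ->].
by rewrite perm_letter_tperm_id //; apply: contraNneq zu => - []; rewrite add0n => ej; rewrite /= -ej.
Qed.

(** A generator lifts to [X] by adding the one-letter word 0. After symmetrization, the terms in
    which 0 has left its one-letter word are deleted into [Wspace F n.+1 m], where the induction on
    [k] applies; the others give a positive multiple of the generator. *)
Lemma dmap_surj k n r x : (0 < n)%N -> (m < n + k)%N -> x \in Wspace F n m ->
  csym F r * x \in (dmap @: (lmulg (csym F (cshift r)) @: Wspace F n.+1 m.+1))%VS.
Proof.
elim: k n x => [|k IH] n x n0 mk; move: x.
  (* With fewer letters than nonempty words there are no generators. *)
  apply: Wspace_ind => [|a x y Hx Hy|u0 us u1]; first by rewrite mulr0 mem0v.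
    by rewrite mulrDr -scalerAr rpredD // rpredZ.
  case/and3P => /eqP sz ne /perm_size; rewrite !size_cat size_iota => szm.
  suff le : (n <= size (flatten us))%N.
    have : (n <= m)%N by rewrite -szm addnCA (leq_trans le) ?leq_addr.
    by rewrite leqNgt -(addn0 n) mk.
  rewrite -sz; elim: (us) ne => //= u l IHl /andP[un /IHl]; rewrite size_cat.
  by case: u un => //=; lia.
apply: Wspace_ind => [|a x y Hx Hy|u0 us u1 d]; first by rewrite mulr0 mem0v.
  by rewrite mulrDr -scalerAr rpredD // rpredZ.
set V := (dmap @: _)%VS.
have IHV y : y \in Wspace F n.+1 m -> csym F r * y \in V.
  move=> Wy; have := IH n.+1 y isT; rewrite addSnnS => /(_ mk Wy).
  by apply: subvP; rewrite limgS // limgS // Wspace_mono.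
case/and3P: (d) => /eqP sz ne P.
pose us' := [:: 0%N] :: map up us.
pose X := Gen F m.+1 (up u0) us' (up u1).
have d' : gdata m.+1 n.+1 (up u0) us' (up u1).
  apply/and3P; split; first by rewrite /= size_map sz.
    by apply/allP => u; rewrite inE => /orP[/eqP-> //|/mapP[v /(allP ne) + ->]]; case: v.
  by have := perm_up P; rewrite /up map_flatten.
have WX : X \in Wspace F n.+1 m.+1 by apply: Gen_Wspace.
have DX : dmap X = n.+1%:R *: Gen F m u0 us u1.
  rewrite /X dmap_Gen; last by case/and3P: d'.
  rewrite /= !upK -map_comp (eq_map (g := id)) ?map_id => [|u /=]; last by rewrite upK.
  by rewrite Gen_nil sz.
have : dmap (csym F (cshift r) * X) \in V.
  by rewrite memv_img // -lmulgE memv_img.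
rewrite dmap_csym (bigID (fun i => gelt F (tperm i ord0) * X == X)) /= mulrDr.
rewrite (eq_bigr (fun _ => dmap X)) => [|i /andP[_ /eqP ->] //].
rewrite sumr_const rpredDr; last first.
  rewrite mulr_sumr rpred_sum // => i /andP[_ neq]; apply: IHV.
  case: (unliftP ord0 i) neq => [z ->|->]; last by rewrite tperm1 gelt1 mul1r eqxx.
  rewrite /X gelt_Gen => neq; apply: dmap_Gen_notin; first exact: gdata_perm_letter.
  rewrite /us' /= inE negb_or; apply/andP; split.
    by rewrite -[0%N]/(val (@ord0 m)) perm_letter_ord tpermR.
  (* If 0 is still a word by itself, then [z] was one before, and the transposition merely exchanges
     two words, which fixes [X]. *)
  apply: contra neq; rewrite -map_comp => /mapP[u uus /= e].
  have ez : u = [:: val z].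
    case: u uus e => [|l [|l' u]] //= _ [e]; congr [:: _].
    have : perm_letter (tperm (lift ord0 z) ord0) (lift ord0 z) = perm_letter (tperm (lift ord0 z) ord0) l.+1.
      by rewrite perm_letter_ord tpermL -e.
    by move/perm_letter_inj => [].
  rewrite ez in uus; have Pu := perm_to_rem uus; set us'' := rem _ us in Pu.
  have Pd : perm_eq (val z :: u0 ++ flatten us'' ++ u1) (u0 ++ flatten us ++ u1).
    rewrite -cat1s perm_catCA perm_cat2l catA perm_cat2r perm_sym.
    exact: perm_flatten Pu.
  have := gdata_uniq d; rewrite -(perm_uniq Pd) /= !mem_cat !negb_or.
  case/andP => /and3P[zu0 zus zu1] _.
  have zus' v : v \in us'' -> val z \notin v.
    by move=> vv; apply: contra zus => zv; apply/flattenP; exists v.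
  set t := tperm _ _.
  have Pus : perm_eq us' [:: [:: 0%N], up [:: val z] & map up us''].
    by rewrite /us' perm_cons; apply: perm_map Pu.
  rewrite (Gen_perm F m.+1 _ _ (perm_map (map (perm_letter t)) Pus)) (Gen_perm F m.+1 _ _ Pus).
  rewrite !map_perm_letter_up //=; have t0 : perm_letter t 0%N = (val z).+1.
    by rewrite -[0%N]/(val (@ord0 m)) perm_letter_ord tpermR.
  have tz : perm_letter t (val z).+1 = 0%N.
    by rewrite -[(val z).+1]/(val (lift ord0 z)) perm_letter_ord tpermL.
  have mE : [seq [seq perm_letter t i | i <- u0] | u0 <- [seq up i | i <- us'']] = map up us''.
    rewrite -map_comp; apply/eq_in_map => v vv /=; by rewrite map_perm_letter_up // zus'.
  rewrite t0 tz mE.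
  by apply/eqP; apply: Gen_perm; rewrite -cat1s -(cat1s [:: 0%N]) perm_catCA.
rewrite -scaler_nat -scalerAr DX -scalerAr scalerA rpredZeq -natrM (natF_eq0 F0).
set q := #|_|; have q0 : (0 < q)%N.
  by apply/card_gt0P; exists ord0; rewrite unfold_in /= cshift0 tperm1 gelt1 mul1r !eqxx.
by rewrite muln_eq0 orbF eqn0Ngt q0.
Qed.

End DeletionMap.

(** * Compatibility of deletion with both terms of the multiplicity formula *)

Section StableDimensions.
Variables (F : fieldType).
Hypothesis F0 : [pchar F] =i pred0.

Lemma dmap_img n m r : (0 < n)%N ->
  (dmap F m @: (lmulg (csym F (cshift r)) @: Wspace F n.+1 m.+1) = lmulg (csym F r) @: Wspace F n m)%VS.
Proof.
move=> n0; apply/eqP; rewrite eqEsubv; apply/andP; split; apply/subvP => x.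
  case/memv_imgP => _ /memv_imgP[w Ww ->] ->; rewrite lmulgE dmap_csym -lmulgE memv_img //.
  apply: rpred_sum => i _; apply: dmap_Wspace => //; exact: Wspace_stable.
case/memv_imgP => w Ww ->; rewrite lmulgE; apply: (dmap_surj F0 (k := m.+1)) => //.
by rewrite addnS ltnS leq_addl.
Qed.

Lemma cshift_recolor m (r : 'I_m -> nat) i k : cshift (recolor r i k) = recolor (cshift r) (lift ord0 i) k.
Proof.
apply: functional_extensionality => j; case: (unliftP ord0 j) => [l ->|->].
  by rewrite cshiftS /recolor (inj_eq (@lift_inj _ ord0)) cshiftS.
by rewrite cshift0 /recolor (negPf (neq_lift ord0 i)) cshift0.
Qed.

Lemma card_cshift0_neq0 m (r : 'I_m -> nat) : #|[pred i | cshift r i == 0%N]|%:R != 0 :> F.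
Proof.
rewrite (natF_eq0 F0) -lt0n; apply/card_gt0P; exists ord0.
by rewrite inE cshift0.
Qed.

Lemma dmap_raised n m (r : 'I_m -> nat) : (0 < n)%N ->
  (dmap F m @: raised (cshift r) (Wspace F n.+1 m.+1) = raised r (Wspace F n m))%VS.
Proof.
move=> n0; apply/eqP; rewrite eqEsubv; apply/andP; split.
  apply/subvP => _ /memv_imgP[u Uu ->].
  have sub : (raised (cshift r) (Wspace F n.+1 m.+1) <= dmap F m @^-1: raised r (Wspace F n m))%VS.
    (* The new letter is in the top row and cannot be raised, so only old letters contribute. *)
    apply: raised_sub => i k w; case: (unliftP ord0 i) => [j ->|->]; last by rewrite cshift0.
    rewrite cshiftS => kj Ww; rewrite -cshift_recolor -memv_preim.
    rewrite (@dmap_csym_cinv _ _ _ (recolor r j k)); last exact: cinv_csym.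
      have : dmap F m (csym F (cshift (recolor r j k)) * w) \in (lmulg (csym F (recolor r j k)) @: Wspace F n m)%VS.
        by rewrite -dmap_img // memv_img // -lmulgE memv_img.
      by case/memv_imgP => y Wy ->; rewrite lmulgE rpredZ // mem_raised.
    by move=> l rl; rewrite /recolor; case: eqP => // e; rewrite -e rl in kj.
  by move/(subvP sub): Uu; rewrite -memv_preim.
apply: raised_sub => j k y kj Wy.
have : csym F (recolor r j k) * y \in (lmulg (csym F (recolor r j k)) @: Wspace F n m)%VS.
  by rewrite -lmulgE memv_img.
rewrite -dmap_img // => /memv_imgP[_ /memv_imgP[w Ww ->] ->]; rewrite lmulgE.
have H l : r l = 0%N -> recolor r j k l = 0%N.
  by move=> rl; rewrite /recolor; case: eqP => // e; rewrite -e rl in kj.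
have E := dmap_csym_cinv H (@cinv_csym F _ (cshift (recolor r j k)) w).
suff : #|[pred i | cshift r i == 0%N]|%:R *: (csym F r * dmap F m (csym F (cshift (recolor r j k)) * w))
     \in (dmap F m @: raised (cshift r) (Wspace F n.+1 m.+1))%VS.
  by rewrite rpredZeq (negPf (card_cshift0_neq0 r)).
by rewrite -E memv_img // cshift_recolor mem_raised // cshiftS.
Qed.

Lemma cshift_rrow m la : is_partition m la -> (0 < m)%N ->
  cshift (rrow m la) = rrow m.+1 (shiftpart 1 la).
Proof.
move=> pl m0; apply: functional_extensionality => i.
case: la pl => [|a l] pl; first by have := partition_sumn pl; rewrite /= => e; rewrite -e in m0.
have a0 : (0 < a)%N by case/and3P: pl => _ /andP[].
case: (unliftP ord0 i) => [j ->|->].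
  rewrite cshiftS /rrow !rowof_cons lift0 addn1 ltnS subSS; by [].
by rewrite cshift0 /rrow rowof_cons addn1.
Qed.

Lemma shift_partition m la s : is_partition m la -> (0 < m)%N ->
  is_partition (m + s) (shiftpart s la).
Proof.
case: la => [|a l] pl m0; first by have := partition_sumn pl; rewrite /= => e; rewrite -e in m0.
case/and3P: pl => srt /andP[a0 al] /eqP <-; apply/and3P; split => /=.
- move: srt; case: l {al} => //= b l /andP[ba ->]; rewrite andbT.
  exact: leq_trans ba (leq_addr _ _).
- by rewrite addn_gt0 a0.
- by rewrite addnAC.
Qed.

Lemma dim_ysym_step n m la : (0 < n)%N -> (0 < m)%N -> is_partition m la ->
  (lmulg (csym F (cshift (rrow m la))) @: Wspace F n.+1 m.+1 :&: lker (dmap F m) = 0)%VS ->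
  \dim (lmulg (ysym F m.+1 (shiftpart 1 la)) @: Wspace F n.+1 m.+1) = \dim (lmulg (ysym F m la) @: Wspace F n m).
Proof.
move=> n0 m0 pl inj.
have pl1 : is_partition m.+1 (shiftpart 1 la) by rewrite -addn1; apply: shift_partition.
have sub : (raised (cshift (rrow m la)) (Wspace F n.+1 m.+1) <= lmulg (csym F (cshift (rrow m la))) @: Wspace F n.+1 m.+1)%VS.
  apply: raised_sub => i k w ki Ww; rewrite -lmulgE memv_img //.
  by apply: stable_mul => //; apply: Wspace_stable.
have := dim_csym_img F0 (@Wspace_stable F n.+1 m.+1) pl1; have := dim_csym_img F0 (@Wspace_stable F n m) pl.
rewrite -cshift_rrow // -dmap_img // -dmap_raised //.
have injU : (raised (cshift (rrow m la)) (Wspace F n.+1 m.+1) :&: lker (dmap F m) = 0)%VS.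
  by apply/eqP; rewrite -subv0 -inj capvS.
by rewrite (limg_dim_eq inj) (limg_dim_eq injU) => -> /addnI ->.
Qed.

End StableDimensions.

(** * Boundedness *)

Section GeneratorTypes.
Local Open Scope nat_scope.

Lemma seqs_finite (T : eqType) (A : seq T) l :
  exists L : seq (seq T), forall w, {subset w <= A} -> size w <= l -> w \in L.
Proof.
elim: l => [|l [L HL]]; first by exists [:: [::]] => - [].
exists ([::] :: [seq a :: w | a <- A, w <- L]) => - [|a w] //= sub sz.
rewrite inE /=; apply: allpairs_f; first by apply: sub; rewrite mem_head.
by apply: HL => // b bw; apply: sub; rewrite inE bw orbT.
Qed.

Lemma gdata_perm m n u0 us vs u1 : perm_eq us vs -> gdata m n u0 us u1 -> gdata m n u0 vs u1.
Proof.
move=> P /and3P[sz ne Pd]; apply/and3P; split; first by rewrite -(perm_size P).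
  by rewrite -(perm_all _ P).
by apply: perm_trans Pd; rewrite perm_cat2l perm_cat2r perm_flatten // perm_sym.
Qed.

Lemma size_flatten_pred (us : seq (seq nat)) : all (fun u => u != [::]) us ->
  size (flatten us) = sumn [seq (size u).-1 | u <- us] + size us.
Proof.
elim: us => //= u us IH /andP[un /IH e]; rewrite size_cat e.
by case: u un => //= k u _; rewrite addnS; lia.
Qed.

Lemma gdata_size K n u0 us u1 : gdata (n + K) n u0 us u1 ->
  size u0 + sumn [seq (size u).-1 | u <- us] + size u1 = K.
Proof.
case/and3P => /eqP sz ne /perm_size; rewrite !size_cat size_iota size_flatten_pred // sz.
by move: (sumn _) (size u0) (size u1) => a b c; lia.
Qed.

(* The first [n - K] letters are treated as interchangeable and become 0. *)
Definition collapse K n k := if k < n - K then 0 else (k - (n - K)).+1.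

(** Words made of one interchangeable letter are dropped, so that the type stays bounded as [n]
    grows; their number is recovered from [n]. *)
Definition gtype K n u0 (us : seq (seq nat)) u1 :=
  (map (collapse K n) u0, [seq map (collapse K n) u | u <- us & map (collapse K n) u != [:: 0]], map (collapse K n) u1).

Lemma gtypes_finite K : exists L : seq (seq nat * seq (seq nat) * seq nat),
  forall n u0 us u1, K <= n -> gdata (n + K) n u0 us u1 -> gtype K n u0 us u1 \in L.
Proof.
(* The alphabet is 0 and one symbol for each of the [2K] remaining letters. The excess of letters
   over words is [K], so no word is longer than [K + 1]. *)
have [L0 HL0] := seqs_finite (iota 0 (2 * K).+1) K.+1.
(* A word that is kept either has excess length, which accounts for at most [K] words, or contains
   one of the [2K] other letters. *)
have [L1 HL1] := seqs_finite L0 (3 * K).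
exists [seq (ab, c) | ab <- [seq (a, b) | a <- L0, b <- L1], c <- L0] => n u0 us u1 Kn d.
have szK := gdata_size d; case/and3P: (d) => /eqP sz ne P.
have small u : {subset u <= u0 ++ flatten us ++ u1} -> size u <= K.+1 -> map (collapse K n) u \in L0.
  move=> sub su; apply: HL0; last by rewrite size_map.
  move=> x /mapP[k /sub + ->]; rewrite (perm_mem P) !mem_iota /collapse; case: ifP; lia.
have szu u : u \in us -> (size u).-1 <= sumn [seq (size v).-1 | v <- us].
  move=> uus; rewrite (perm_sumn (perm_map _ (perm_to_rem uus))) /=; exact: leq_addr.
apply: allpairs_f; [apply: allpairs_f|].
- apply: small; first by move=> k; rewrite mem_cat => ->.
  by move: szK; move: (sumn _) (size u0) (size u1) => a b c; lia.
- apply: HL1.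
    move=> x /mapP[u]; rewrite mem_filter => /andP[_ uus] ->; apply: small.
      move=> k ku; rewrite !mem_cat; apply/orP; right; apply/orP; left.
      by apply/flattenP; exists u.
    by have := szu u uus; move: szK; move: (sumn _) (size u0) (size u1) (size u) => a b c e; lia.
  pose big k := n - K <= k.
  have cb : count big (flatten us) <= 2 * K.
    have : count big (u0 ++ flatten us ++ u1) <= 2 * K.
      have /seq.permP -> := P; have -> : n + K = (n - K) + 2 * K by lia.
      rewrite iotaD count_cat.
      have -> : count big (iota 0 (n - K)) = 0.
        apply/eqP; rewrite -leqn0 leqNgt -has_count; apply/hasP => - [k].
        by rewrite mem_iota /big; lia.
      by rewrite add0n (leq_trans (count_size _ _)) // size_iota.
    by rewrite !count_cat; lia.
  have le : size [seq u <- us | map (collapse K n) u != [:: 0]] <=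
            sumn [seq (size u).-1 | u <- us] + count big (flatten us).
    elim: (us) ne => //= u l IH /andP[un /IH {}IH]; rewrite count_cat.
    case: ifP => [ue|_] /=; last by move: IH; move: (sumn _) (size (filter _ _)) => a b; lia.
    suff : 0 < (size u).-1 + count big u.
      by move: IH; move: (sumn _) (size (filter _ _)) => a b; lia.
    case: u un ue => // k [|k' u] //= _; rewrite /collapse /big; case: ltnP => //=.
  rewrite size_map; move: le cb szK.
  by move: (sumn _) (size u0) (size u1) (size (filter _ _)) (count _ _) => a b c e f; lia.
- apply: small; first by move=> k; rewrite !mem_cat => ->; rewrite !orbT.
  by move: szK; move: (sumn _) (size u0) (size u1) => a b c; lia.
Qed.

End GeneratorTypes.

Section Bounds.
Variable F : fieldType.
Hypothesis F0 : [pchar F] =i pred0.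

(** The permutation carrying one underlying word to the other preserves the coloring [e], so the
    symmetrizer absorbs it; equal shapes let the words be cut back into blocks. *)
Lemma csym_Gen_eq m n (e : nat -> nat) u0 us u1 v0 vs v1 :
  gdata m n u0 us u1 -> gdata m n v0 vs v1 ->
  map e u0 = map e v0 -> map (map e) us = map (map e) vs -> map e u1 = map e v1 ->
  csym F (fun i : 'I_m => e i) * Gen F m u0 us u1 = csym F (fun i : 'I_m => e i) * Gen F m v0 vs v1.
Proof.
move=> /and3P[_ _ /word_of_surj[s Es]] /and3P[_ _ /word_of_surj[t Et]] e0 eu e1.
have sz0 : size u0 = size v0 by have /(congr1 size) := e0; rewrite !size_map.
have szu : shape us = shape vs.
  have /(congr1 shape) := eu; rewrite /shape -!map_comp => H.
  by rewrite (eq_map (g := size \o map e)) ?H => [|u /=]; [apply: eq_map => u /=|]; rewrite size_map.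
have ew : map e (word_of s) = map e (word_of t) by rewrite Es Et !map_cat !map_flatten e0 eu e1.
pose g := (s^-1 * t)%g.
have sg : cstab (fun i : 'I_m => e i) g.
  apply/cstabP => i; rewrite permM.
  have := congr1 (fun l => nth 0%N l (s^-1%g i)) ew.
  by rewrite !(nth_map 0%N) ?size_word_of // !nth_word_of permKV.
have Eg : map (perm_letter g) (word_of s) = word_of t by rewrite -wdM mulKVg.
move: Eg; rewrite Es Et !map_cat map_flatten => /eqP.
rewrite eqseq_cat ?size_map // => /andP[/eqP E0].
rewrite eqseq_cat; last by rewrite !size_flatten -szu /shape -map_comp; congr sumn;
  apply: eq_map => u /=; rewrite size_map.
case/andP => /eqP EF /eqP E1.
have EU : map (map (perm_letter g)) us = vs.
  apply: eq_from_flatten_shape EF _; rewrite -szu /shape -map_comp; apply: eq_map => u /=.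
  by rewrite size_map.
by rewrite -E0 -EU -E1 -gelt_Gen mulrA csymMr.
Qed.

Definition rho K n : 'I_(n + K) -> nat := fun i => collapse K n i.
Arguments rho K n : clear implicits.

Lemma gtype_eq K n u0 us u1 v0 vs v1 :
  gdata (n + K) n u0 us u1 -> gdata (n + K) n v0 vs v1 ->
  gtype K n u0 us u1 = gtype K n v0 vs v1 ->
  csym F (rho K n) * Gen F (n + K) u0 us u1 = csym F (rho K n) * Gen F (n + K) v0 vs v1.
Proof.
move=> d d' [e0 eu e1]; pose p (u : seq nat) := map (collapse K n) u != [:: 0%N].
have P (ws : seq (seq nat)) : perm_eq ws (filter p ws ++ filter (predC p) ws).
  by rewrite perm_sym perm_filterC.
rewrite (Gen_perm _ _ _ _ (P us)) (Gen_perm _ _ _ _ (P vs)).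
apply: (csym_Gen_eq (gdata_perm (P us) d) (gdata_perm (P vs) d')) => //.
have E (ws : seq (seq nat)) : map (map (collapse K n)) (filter (predC p) ws) = nseq (size ws - size (filter p ws)) [:: 0%N].
  rewrite (_ : (size ws - _)%N = size (filter (predC p) ws)).
    elim: ws => //= w ws IH; rewrite /p; case: (altP eqP) => //= ->; congr (_ :: _); exact: IH.
  by rewrite !size_filter -(count_predC p ws) addKn.
have szf : size (filter p us) = size (filter p vs) by have /(congr1 size) := eu; rewrite !size_map.
case/and3P: d => /eqP sz _ _; case/and3P: d' => /eqP sz' _ _.
by rewrite !map_cat !E sz sz' szf eu.
Qed.

Definition Xsp K n : {vspace grpalg F (n + K)} := (lmulg (csym F (rho K n)) @: Wspace F n (n + K))%VS.

(** A type determines the symmetrized generator, so the spanning set is no longer than the list of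
    types, which is independent of [n]. *)
Lemma Xsp_bounded K : exists B, forall n, (K <= n)%N -> (\dim (Xsp K n) <= B)%N.
Proof.
have [L HL] := gtypes_finite K; exists (size L) => n Kn.
pose P tau (x : grpalg F (n + K)) := exists u0 us u1, [/\ gdata (n + K) n u0 us u1,
  gtype K n u0 us u1 = tau & x = csym F (rho K n) * Gen F (n + K) u0 us u1].
have Pfun tau x y : P tau x -> P tau y -> x = y.
  move=> [u0 [us [u1 [d e ->]]]] [v0 [vs [v1 [d' e' ->]]]].
  by apply: gtype_eq => //; rewrite e e'.
have [xs [sz Hxs]] : exists xs : seq (grpalg F (n + K)), (size xs <= size L)%N /\
    forall tau x, tau \in L -> P tau x -> x \in xs.
  elim: (L) => [|tau l [xs [sz Hxs]]]; first by exists [::].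
  case: (classic (exists x, P tau x)) => [[x Px]|no].
    exists (x :: xs); split=> // tau' y; rewrite inE => /orP[/eqP->|tl] Py.
      by rewrite (Pfun _ _ _ Py Px) mem_head.
    by rewrite inE (Hxs _ _ tl Py) orbT.
  exists xs; split; first exact: leqW.
  move=> tau' y; rewrite inE => /orP[/eqP->|tl] Py; last exact: Hxs Py.
  by case: no; exists y.
apply: leq_trans (leq_trans (dim_span xs) sz); apply: dimvS.
apply/subvP => _ /memv_imgP[w Ww ->]; move: w Ww; apply: Wspace_ind => [|a x y Hx Hy|u0 us u1 d].
- by rewrite linear0 mem0v.
- by rewrite linearP rpredD // rpredZ.
rewrite lmulgE memv_span // (Hxs (gtype K n u0 us u1)) ?HL //.
by exists u0, us, u1.
Qed.

Lemma flatten_mem_eq (us : seq (seq nat)) u v k : uniq (flatten us) ->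
  u \in us -> v \in us -> k \in u -> k \in v -> u = v.
Proof.
elim: us => //= w us IH; rewrite cat_uniq !inE => /and3P[_ /hasPn nd uf].
case/orP => [/eqP->|uu] /orP[/eqP->|vv] // ku kv; last exact: IH.
  have : k \in flatten us by apply/flattenP; exists v.
  by move/nd; rewrite /= ku.
have : k \in flatten us by apply/flattenP; exists u.
by move/nd; rewrite /= kv.
Qed.

Lemma uniq_of_flatten (us : seq (seq nat)) : all (fun u => u != [::]) us ->
  uniq (flatten us) -> uniq us.
Proof.
elim: us => //= u us IH /andP[un /IH {}IH]; rewrite cat_uniq => /and3P[_ nd /IH ->].
rewrite andbT; apply: contra nd => uus; apply/hasP; case: u un uus => // k u _ uus.
by exists k; rewrite ?mem_head //; apply/flattenP; exists (k :: u); rewrite ?mem_head.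
Qed.

Lemma uniq_gdata_parts m n u0 us u1 : gdata m n u0 us u1 ->
  [/\ uniq (flatten us), (forall k, k \in u0 -> k \notin flatten us) &
      (forall k, k \in u1 -> k \notin flatten us)].
Proof.
move/gdata_uniq; rewrite cat_uniq => /and3P[_ /hasPn nd].
rewrite cat_uniq => /and3P[uf /hasPn nd' _]; split=> // k ku.
apply/negP => kf; have /nd : k \in flatten us ++ u1 by rewrite mem_cat kf.
by rewrite /= ku.
Qed.

(** Its stabilizer permutes the one-letter words of [us] among themselves and fixes all other
    letters. *)
Definition single_coloring m (us : seq (seq nat)) : 'I_m -> nat :=
  fun i => if [:: val i] \in us then 0%N else i.+1.

Lemma Gen_single_cinv m n u0 us u1 : gdata m n u0 us u1 ->
  cinv (single_coloring us) (Gen F m u0 us u1).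
Proof.
move=> d g /cstabP sg; have [uf n0 n1] := uniq_gdata_parts d.
case/and3P: (d) => _ ne P.
have lt u k : {subset u <= u0 ++ flatten us ++ u1} -> k \in u -> (k < m)%N.
  by move=> sub /sub; rewrite (perm_mem P) mem_iota.
have fix_ k : (k < m)%N -> [:: k] \notin us -> perm_letter g k = k.
  move=> km nk; rewrite -[k]/(val (Ordinal km)) perm_letter_ord; have := sg (Ordinal km).
  by rewrite /single_coloring /= (negPf nk); case: ifP => // _ [].
have out u : {subset u <= u0 ++ flatten us ++ u1} -> (forall k, k \in u -> [:: k] \notin us) ->
    map (perm_letter g) u = u.
  by move=> sub H; rewrite -[RHS]map_id; apply/eq_in_map => k ku; apply: fix_; [apply: lt ku | apply: H].
have nsing k : k \notin flatten us -> [:: k] \notin us.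
  by apply: contra => kus; apply/flattenP; exists [:: k] => //; rewrite mem_head.
rewrite gelt_Gen (out u0); last first.
- by move=> k /n0/nsing.
- by move=> k; rewrite mem_cat => ->.
rewrite (out u1); last first.
- by move=> k /n1/nsing.
- by move=> k; rewrite !mem_cat => ->; rewrite !orbT.
apply: Gen_perm.
have uus := uniq_of_flatten ne uf.
have umap : uniq (map (map (perm_letter g)) us).
  by rewrite map_inj_uniq //; apply: inj_map; apply: perm_letter_inj.
have sub : {subset map (map (perm_letter g)) us <= us}.
  move=> x /mapP[u uus' ->].
  have usub : {subset u <= u0 ++ flatten us ++ u1}.
    move=> k ku; rewrite !mem_cat; apply/orP; right; apply/orP; left.
    by apply/flattenP; exists u.
  case: (boolP (size u == 1%N)) => [|su].
    case: u uus' usub => // k [] // kus usub _ /=.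
    have km : (k < m)%N by apply: lt usub _; rewrite mem_head.
    have := sg (Ordinal km); rewrite /single_coloring /= kus -[k]/(val (Ordinal km)) perm_letter_ord.
    by case: ifP.
  rewrite out // => k ku; apply: contra su => kus.
  by rewrite (flatten_mem_eq uf uus' kus ku (mem_head _ _)).
apply: uniq_perm => //; case: (uniq_min_size umap sub) => //.
by rewrite size_map.
Qed.

(** Every longer word uses up at least one of the [K] excess letters. *)
Lemma card_single_coloring K n u0 us u1 : gdata (n + K) n u0 us u1 ->
  (n - K <= #|fib (@single_coloring (n + K) us) 0|)%N.
Proof.
move=> d; have szK := gdata_size d; have [uf _ _] := uniq_gdata_parts d.
case/and3P: (d) => /eqP sz ne P; have uus := uniq_of_flatten ne uf.
pose sing := [seq u <- us | size u == 1%N].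
have le1 : (n - K <= size sing)%N.
  have : (size us <= size sing + sumn [seq (size u).-1 | u <- us])%N.
    rewrite /sing; elim: (us) ne => //= u l IH /andP[un /IH {}IH].
    by case: u un => // k [|k' u] _ /=; move: IH; move: (sumn _) (size (filter _ _)) => a b; lia.
  rewrite sz; move: szK; move: (sumn _) (size sing) (size u0) (size u1) => a b c e; lia.
apply: leq_trans le1 _; rewrite cardE -(size_map (fun i : 'I_(n + K) => [:: val i])).
apply: uniq_leq_size; first exact: filter_uniq.
move=> u; rewrite mem_filter; case: u => // k [] //= kus.
have km : (k < n + K)%N.
  have : k \in u0 ++ flatten us ++ u1.
    rewrite !mem_cat; apply/orP; right; apply/orP; left; apply/flattenP; exists [:: k] => //.
    exact: mem_head.
  by rewrite (perm_mem P) mem_iota.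
apply/mapP; exists (Ordinal km) => //; rewrite mem_enum inE /single_coloring /=.
by rewrite kus.
Qed.

(** A generator is invariant under permuting its one-letter words, which are more numerous than the
    boxes of the first row; by [straighten_gt] all row invariants then lie in [raised]. *)
Lemma dim_ysym_small K n la : is_partition (n + K) la -> (nth 0%N la 0 < n - K)%N ->
  \dim (lmulg (ysym F (n + K) la) @: Wspace F n (n + K)) = 0%N.
Proof.
move=> pl lt; have := dim_csym_img F0 (@Wspace_stable F n (n + K)) pl.
have : (lmulg (csym F (rrow (n + K) la)) @: Wspace F n (n + K) <= raised (rrow (n + K) la) (Wspace F n (n + K)))%VS.
  apply/subvP => _ /memv_imgP[w Ww ->]; move: w Ww; apply: Wspace_ind => [|a x y Hx Hy|u0 us u1 d].
  - by rewrite linear0 mem0v.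
  - by rewrite linearP rpredD // rpredZ.
  rewrite lmulgE; apply: (straighten_gt F0 _ _ (Gen_single_cinv d)).
  - exact: Wspace_stable.
  - exact: Gen_Wspace.
  apply: leq_trans (card_single_coloring d); apply: leq_ltn_trans lt.
  have -> : #|fib (rrow (n + K) la) 0| = pcard (rrow (n + K) la) 0.
    by apply: eq_card => i; rewrite !inE leqn0.
  rewrite pcard_rrow ?(partition_sumn pl) //; case: (la) => //= a l.
  by rewrite take0 /= addn0.
move=> /dimvS le e; move: le; rewrite e -[X in (_ <= X)%N]addn0 leq_add2l leqn0.
by move/eqP.
Qed.

End Bounds.
Arguments rho K n : clear implicits.

(** * Stability *)

Lemma bounded_monotone_stabilizes (f : nat -> nat) n1 B :
  (forall n, (n1 <= n)%N -> (f n <= f n.+1)%N) -> (forall n, (n1 <= n)%N -> (f n <= B)%N) ->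
  exists2 N, (n1 <= N)%N & forall n, (N <= n)%N -> f n.+1 = f n.
Proof.
move=> mono bnd.
have mono' a b : (n1 <= a)%N -> (a <= b)%N -> (f a <= f b)%N.
  move=> na; elim: b => [|b IH]; first by rewrite leqn0 => /eqP->.
  rewrite leq_eqVlt ltnS => /orP[/eqP->//|ab]; apply: leq_trans (IH ab) (mono _ _).
  exact: leq_trans ab.
suff H d n2 : (n1 <= n2)%N -> (B - f n2 <= d)%N ->
    exists2 N, (n1 <= N)%N & forall n, (N <= n)%N -> f n.+1 = f n.
  exact: (H _ n1 (leqnn _) (leqnn _)).
elim: d n2 => [|d IH] n2 n12 le.
all: case: (classic (forall n, (n2 <= n)%N -> f n.+1 = f n)) => [all|/not_all_ex_not[n Hn]];
  first by exists n2.
all: have [n2n ne] : (n2 <= n)%N /\ f n.+1 <> f n by split; [apply: NNPP => H | move=> H]; apply: Hn.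
all: have h1 := mono' n2 n n12 n2n; have h2 := mono n (leq_trans n12 n2n).
all: have h3 := bnd n.+1 (leqW (leq_trans n12 n2n)).
  by exfalso; lia.
by apply: (IH n.+1); lia.
Qed.

(** * Isomorphisms in the sense of [W_iso_sum] and multiplicities of left ideals *)

Section Transfer.
Variables (F : fieldType) (n m : nat).
Hypothesis F0 : [pchar F] =i pred0.
Hypothesis n0 : (0 < n)%N.
Local Notation FG := (grpalg F m).

Lemma SpechtP la (x : FG) : Specht la x <-> x \in limg (rmulg (ysym F m la)).
Proof.
split=> [[y ->]|/memv_imgP[y _ ->]]; last by exists y; rewrite rmulgE.
by apply/memv_imgP; exists (y : FG); rewrite ?memvf // rmulgE.
Qed.

Lemma to_grpalg_permact (g : 'S_m) (f : ncpoly F) : to_grpalg m (permact g f) = gelt F g * to_grpalg m f.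
Proof.
by apply/ffunP => s; rewrite geltmulE !ffunE wdM.
Qed.

Lemma permact_of_grpalg (g : 'S_m) (x : FG) : permact g (of_grpalg x) = of_grpalg (gelt F g * x).
Proof.
apply: ncP => w; rewrite /permact /of_grpalg [RHS](reindex_inj (mulIg g)) /=.
apply: eq_bigr => s _; rewrite geltmulE mulgK; congr (_ * _); rewrite /mono wdM; congr (_%:R).
rewrite -(inj_eq (inj_map (@perm_letter_inj m g))) -[in RHS]/(map (perm_letter g^-1) w).
congr (_ == _); rewrite -map_comp -[RHS]map_id; apply: eq_map => k /=.
by have := perm_letterK g^-1%g k; rewrite invgK.
Qed.

Lemma of_grpalg_sum (I : finType) (P : pred I) (G : I -> FG) w :
  of_grpalg (\sum_(i | P i) G i) w = \sum_(i | P i) of_grpalg (G i) w.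
Proof.
rewrite /of_grpalg exchange_big /=; apply: eq_bigr => s _.
by rewrite sum_ffunE mulr_suml.
Qed.

Lemma iso_dims ls : all (is_partition m) ls -> W_iso_sum F n m ls ->
  forall mu, is_partition m mu -> \dim (lmulg (ysym F m mu) @: Wspace F n m) = count_mem mu ls.
Proof.
move=> pls [psi [psiP psiG psiW psiS psiI]] mu pm.
apply: (dim_from_iso F0 (psi := fun i x => to_grpalg m (psi i x))) => //.
- move=> i il a x y /SpechtP Sx /SpechtP Sy; apply/ffunP => s; rewrite !ffunE.
  have := psiP i il a x y Sx Sy (word_of s).
  by have -> : [ffun s => a * x s + y s] = a *: x + y by apply/ffunP => t; rewrite !ffunE.
- move=> i il g x /SpechtP Sx; rewrite -to_grpalg_permact -gact_gelt; apply/ffunP => s.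
  by rewrite !ffunE psiG.
- by move=> i il x /SpechtP Sx; have /(WnmP _ F0 n0)[] := psiW i il x Sx.
- move=> w Ww; have [|x [Sx Ex]] := psiS (of_grpalg w).
    by apply/(WnmP _ F0 n0); rewrite of_grpalgK; split=> //; apply: of_grpalg_Vm.
  exists x; split; first by move=> i il; apply/SpechtP; apply: Sx.
  apply/ffunP => s; rewrite sum_ffunE; transitivity (to_grpalg m (of_grpalg w) s); first by rewrite of_grpalgK.
  by rewrite ffunE Ex; apply: eq_bigr => i _; rewrite ffunE.
- move=> x Sx E; apply: psiI; first by move=> i il; apply/SpechtP; apply: Sx.
  move=> w; case: (boolP (perm_eq w (iota 0 m))) => [/word_of_surj[s <-]|nP].
    have /ffunP/(_ s) := E; rewrite sum_ffunE ffunE => e; apply: etrans e.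
    by apply: eq_bigr => i _; rewrite ffunE.
  rewrite big1 // => i _; have [] := psiW i (ltn_ord i) (x i); first by apply/SpechtP; apply: Sx.
  by move=> Vp _; apply: Vp.
Qed.

Lemma dims_iso ls : all (is_partition m) ls ->
  (forall mu, is_partition m mu -> \dim (lmulg (ysym F m mu) @: Wspace F n m) = count_mem mu ls) ->
  W_iso_sum F n m ls.
Proof.
move=> pls dims; have sW := @Wspace_stable F n m.
have [v [vW vS vI]] := specht_sum_exists F0 sW pls dims.
exists (fun i x => of_grpalg ((x : FG) * v i)); split.
- move=> i il a x y _ _ w.
  have -> : [ffun s => a * x s + y s] = a *: (x : FG) + y by apply/ffunP => t; rewrite !ffunE.
  by rewrite mulrDl -scalerAl of_grpalgD.
- by move=> i il g x _ w; rewrite permact_of_grpalg mulrA -gact_gelt.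
- move=> i il x _; apply/(WnmP _ F0 n0); rewrite of_grpalgK; split; first exact: of_grpalg_Vm.
  by apply: stable_mul => //; apply: vW.
- move=> f /(WnmP _ F0 n0)[Vf /vS[x Ex]].
  exists (fun i => x i * ysym F m (nth [::] ls i)); split.
    by move=> i il; exists (x i).
  move=> w; rewrite -(to_grpalgK Vf) Ex of_grpalg_sum; apply: eq_bigr => i _.
  by rewrite mulrA.
move=> x Sx E.
have Hy i : exists y : FG, (i < size ls)%N -> x i = y * ysym F m (nth [::] ls i).
  case: (ltnP i (size ls)) => il; last by exists 0.
  by have [y ->] := Sx i il; exists y.
pose y i := projT1 (constructive_indefinite_description _ (Hy i)).
have yE i : (i < size ls)%N -> x i = y i * ysym F m (nth [::] ls i).
  exact: (projT2 (constructive_indefinite_description _ (Hy i))).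
move=> i il; rewrite yE //; apply: vI il.
rewrite -[LHS](@of_grpalgK F m); apply/ffunP => s; rewrite !ffunE of_grpalg_sum -[RHS](E (word_of s)).
by apply: eq_bigr => j _; rewrite mulrA -yE.
Qed.

End Transfer.

Section Stability.
Variables (F : fieldType) (K : nat).
Hypothesis F0 : [pchar F] =i pred0.

(** The new letter joins the interchangeable ones; [K <= n] keeps the truncated subtraction
    exact. *)
Lemma cshift_rho n : (K <= n)%N -> cshift (rho K n) = rho K n.+1.
Proof.
move=> Kn; apply: functional_extensionality => i; rewrite /rho /collapse.
case: (unliftP ord0 i) => [j ->|->]; first by rewrite cshiftS lift0 subSn // ltnS subSS.
by rewrite cshift0 subSn.
Qed.

Lemma dmap_Xsp n : (0 < n)%N -> (K <= n)%N -> (dmap F (n + K) @: Xsp F K n.+1 = Xsp F K n)%VS.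
Proof. by move=> n0 Kn; rewrite /Xsp -[RHS]dmap_img // cshift_rho. Qed.

(** Deletion is onto, so the dimensions increase; being bounded they become constant, and from then
    on the kernel is zero. *)
Lemma Xsp_stabilizes n1 : exists2 N, (n1 <= N)%N & forall n, (N <= n)%N ->
  (Xsp F K n.+1 :&: lker (dmap F (n + K)) = 0)%VS.
Proof.
have [B HB] := Xsp_bounded F K; pose n2 := (maxn n1 K).+1.
have dimE n : (n2 <= n)%N -> (\dim (Xsp F K n.+1 :&: lker (dmap F (n + K))) + \dim (Xsp F K n)
    = \dim (Xsp F K n.+1))%N.
  by move=> n2n; rewrite -(@dmap_Xsp n) ?limg_ker_dim //; lia.
have [n n2n|n n2n|N n2N HN] := @bounded_monotone_stabilizes (fun n => \dim (Xsp F K n)) n2 B.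
- by rewrite -(dimE n n2n) leq_addl.
- by apply: HB; lia.
exists N; first by lia.
move=> n Nn; apply/eqP; rewrite -dimv_eq0; have := dimE n (leq_trans n2N Nn).
by rewrite (HN n Nn) -[RHS]add0n => /addIn ->.
Qed.

(** The interchangeable letters all fit into the first row, so row invariants are also invariant
    under the stabilizer of [rho], where deletion is known to be injective. *)
Lemma rho_refines n la (i j : 'I_(n + K)) : (n - K <= nth 0%N la 0)%N ->
  rho K n i = rho K n j -> rrow (n + K) la i = rrow (n + K) la j.
Proof.
case: la => [|a l] /=; first by rewrite /rrow /rowof.
move=> le; rewrite /rho /collapse; case: (ltnP i) => ci; case: (ltnP j) => cj //.
  by move=> _; rewrite /rrow !rowof_cons !(leq_trans _ le).
by move=> [e]; congr (rrow _ _ _); apply: val_inj => /=; lia.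
Qed.

Lemma rho0_rrow n la (i : 'I_(n + K)) : (n - K <= nth 0%N la 0)%N ->
  rho K n i = 0%N -> rrow (n + K) la i = 0%N.
Proof.
case: la => [|a l] /=; first by rewrite /rrow /rowof.
move=> le; rewrite /rho /collapse; case: (ltnP i) => // ci _.
by rewrite /rrow rowof_cons (leq_trans ci le).
Qed.

Lemma dim_ysym_next n la : (0 < n)%N -> (K <= n)%N -> is_partition (n + K) la ->
  (n - K <= nth 0%N la 0)%N ->
  (Xsp F K n.+1 :&: lker (dmap F (n + K)) = 0)%VS ->
  \dim (lmulg (ysym F (n.+1 + K) (shiftpart 1 la)) @: Wspace F n.+1 (n.+1 + K))
  = \dim (lmulg (ysym F (n + K) la) @: Wspace F n (n + K)).
Proof.
move=> n0 Kn pl le inj; apply: (dim_ysym_step F0 n0 _ pl); first by rewrite addn_gt0 n0.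
apply/eqP; rewrite -subv0 -inj; apply: capvS => //; apply/subvP => w.
move/(mem_csym_img F0 _ _ (@Wspace_stable F _ _)) => [Ww iw].
rewrite /Xsp -cshift_rho //; apply/(mem_csym_img F0 _ _ (@Wspace_stable F _ _)); split=> // g /cstabP sg.
apply: iw; apply/cstabP => i.
have H (a b : 'I_(n + K).+1) : cshift (rho K n) a = cshift (rho K n) b ->
    cshift (rrow (n + K) la) a = cshift (rrow (n + K) la) b.
  case: (unliftP ord0 a) => [a' ->|->]; case: (unliftP ord0 b) => [b' ->|->];
    rewrite ?cshift0 ?cshiftS //.
  - exact: rho_refines.
  - exact: rho0_rrow.
  - by move/esym/(rho0_rrow le).
exact: H (sg i).
Qed.

End Stability.

Lemma shiftpartS s la : la != [::] -> shiftpart s.+1 la = shiftpart 1 (shiftpart s la).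
Proof. by case: la => //= a l _; rewrite -addnA addn1. Qed.

Lemma shiftpart0 la : la != [::] -> shiftpart 0 la = la.
Proof. by case: la => //= a l _; rewrite addn0. Qed.

Lemma partition_neq_nil m la : (0 < m)%N -> is_partition m la -> la != [::].
Proof. by case: la => // m0 /partition_sumn /= e; rewrite -e in m0. Qed.

Theorem theorem3p8 (F : fieldType) (charF0 : [pchar F]%R =i pred0) (K : nat) :
  exists N : nat, (0 < N)%N /\
    forall ls : seq (seq nat), all (is_partition (N + K)) ls ->
      W_iso_sum F N (N + K) ls ->
      forall n : nat, (N <= n)%N ->
        W_iso_sum F n (n + K) (map (shiftpart (n - N)) ls).
Proof.
(* [3K] keeps the first row longest when boxes are removed from it, and the successor makes [N]
   positive. *)
have [N N0 HN] := Xsp_stabilizes K charF0 (3 * K).+1.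
have Npos : (0 < N)%N by lia.
exists N; split=> // ls pls iso n Nn.
have dimN := iso_dims charF0 Npos pls iso.
have [s ns] : exists s, n = (s + N)%N by exists (n - N)%N; rewrite subnK.
rewrite {}ns addnK in Nn *; move: {n} Nn => _.
have NK0 : (0 < N + K)%N by lia.
have lsP la : la \in ls -> is_partition (N + K) la by move/(allP pls).
have shP la : is_partition (N + K) la -> is_partition (s + N + K) (shiftpart s la).
  by move=> pl; rewrite -addnA addnC; apply: shift_partition.
have step la : is_partition (N + K) la -> (N - K <= nth 0%N la 0)%N ->
    \dim (lmulg (ysym F (s + N + K) (shiftpart s la)) @: Wspace F (s + N) (s + N + K)) =
    \dim (lmulg (ysym F (N + K) la) @: Wspace F N (N + K)).
  move=> pl le; have lane := partition_neq_nil NK0 pl.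
  elim: s {shP} => [|s IH]; first by rewrite shiftpart0.
  rewrite -IH shiftpartS //; apply: (@dim_ysym_next F K charF0 (s + N)) => //; try lia.
  - by rewrite -addnA addnC; apply: shift_partition.
  - by case: la le {pl IH lane} => [|a l] /=; lia.
  - by apply: HN; lia.
apply: dims_iso => //; first by lia.
  by apply/allP => _ /mapP[la /lsP pl ->]; apply: shP.
(* For a short first row both sides vanish: a member of [ls] shifting to [mu] would have a short
   first row itself, hence multiplicity 0. Otherwise [mu] is the shift of a partition. *)
move=> mu pm; case: (ltnP (nth 0%N mu 0) (s + N - K)) => small.
  rewrite dim_ysym_small //; apply/esym/eqP; rewrite -leqn0 leqNgt -has_count.
  apply/hasP => - [_ /mapP[la lals ->] /eqP e].
  have pl := lsP la lals.
  have : \dim (lmulg (ysym F (N + K) la) @: Wspace F N (N + K)) = 0%N.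
    apply: dim_ysym_small => //; move: small; rewrite -e.
    by case: (la) (partition_neq_nil NK0 pl) => //= a l _; lia.
  by rewrite dimN // => /eqP; rewrite -leqn0 leqNgt -has_count => /hasP[]; exists la => /=.
case: mu pm small => [|a l] pm /= small; first by have := partition_sumn pm; rewrite /=; lia.
pose la := (a - s)%N :: l.
have sa : (s <= a)%N by lia.
have muE : a :: l = shiftpart s la by rewrite /= subnK.
(* The rows below the first hold at most [2K] boxes, while [a - s] is at least [N - K > 2K]. *)
have pl : is_partition (N + K) la.
  case/and3P: pm => srt /andP[a0 al] /eqP sm; apply/and3P; split.
  - move: srt sm {al}; rewrite /la; case: (l) => //= b l' /andP[ba ->] sm; rewrite andbT.
    move: sm; move: (sumn l') => q; lia.
  - by apply/andP; split=> //; rewrite subn_gt0; lia.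
  - by move: sm; rewrite /la /=; move: (sumn l) => q; lia.
rewrite muE step //=; last by lia.
rewrite dimN // count_map; apply: eq_in_count => x xls /=.
have := partition_neq_nil NK0 (lsP x xls); case: x {xls} => //= b l' _.
by rewrite /la !eqseq_cons; congr (_ && _); apply/eqP/eqP; lia.
Qed.
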